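(* Let $T^n$ be a regular simplex in $\mathbb{E}^n$ with unit edge length, and let $w(T^n)$ be its mean width, defined as the average of its support function over the unit sphere. Then \begin{align*} 0.4208 &\le w(T^5)\le 0.4215,\\ 0.4067 &\le w(T^6)\le 0.407,\\ 0.39425 &\le w(T^7)\le 0.39427,\\ 0.383 &\le w(T^8)\le 0.38301. \end{align*}
   Context: $\mathbb{E}^n$ denotes $n$-dimensional Euclidean space and $\mathbb{S}^{n-1}=\{x\in\mathbb{E}^n:\|x\|=1\}$. For a convex body $K\subset\mathbb{E}^n$ (convex, compact, with nonempty interior) and $u\in\mathbb{S}^{n-1}$, the support function is $h_K(u)=\sup\{\langle u,y\rangle:y\in K\}$. With $\sigma$ the rotationally invariant probability measure on $\mathbb{S}^{n-1}$, the mean width of $K$ is $$w(K)=\int_{\mathbb{S}^{n-1}}h_K(u)\,d\sigma(u)$$ (note: this is half of the average of $h_K(u)+h_K(-u)$, which is sometimes called the mean width). *)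

(* Defs.v *)
From HB Require Import structures.
From mathcomp Require Import all_boot all_order all_algebra.
From mathcomp Require Import all_classical all_reals all_analysis.

Set Implicit Arguments.
Unset Strict Implicit.
Unset Printing Implicit Defensive.

Import Order.TTheory GRing.Theory Num.Theory.
Import numFieldNormedType.Exports.

Local Open Scope classical_set_scope.
Local Open Scope ring_scope.

Definition dotp (R : realType) (n : nat) (x y : 'rV[R]_n) : R :=
  \sum_(i < n) x 0 i * y 0 i.

(* The library norm on 'rV[R]_n is the sup norm, hence a separate name. *)
Definition enorm (R : realType) (n : nat) (x : 'rV[R]_n) : R :=
  Num.sqrt (dotp x x).

Definition usphere (R : realType) (n : nat) : set 'rV[R]_n :=
  [set x | enorm x = 1].

(* The library topology of 'rV[R]_n is the product one, i.e. the Euclidean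
   one, so this is 'rV[R]_n with its Borel sigma-algebra. *)
Definition borel_rV (R : realType) (n : nat) :=
  g_sigma_algebraType (@open 'rV[R]_n).

(* Rotations act on row vectors on the right. *)
Definition rotation_mx (R : realType) (n : nat) (Q : 'M[R]_n) : Prop :=
  Q *m Q^T = 1%:M /\ \det Q = 1.

(* sigma is the rotation-invariant probability measure of the unit sphere,
   seen as a Borel probability measure of the ambient space carried by the
   sphere.  For n >= 2 this property determines sigma. *)
Definition rotation_invariant_sphere_probability (R : realType) (n : nat)
    (sigma : probability (borel_rV R n) R) : Prop :=
  sigma (@usphere R n) = 1%E /\
  forall (Q : 'M[R]_n) (A : set (borel_rV R n)),
    rotation_mx Q -> measurable A ->
    sigma [set u : 'rV[R]_n | A (u *m Q)] = sigma A.

Definition support_function (R : realType) (n : nat)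
    (K : set 'rV[R]_n) (u : 'rV[R]_n) : R :=
  sup [set dotp u y | y in K].

(* The average of the support function itself, i.e. half of the average of
   the widths h_K(u) + h_K(-u). *)
Definition mean_width (R : realType) (n : nat)
    (sigma : probability (borel_rV R n) R) (K : set 'rV[R]_n) : R :=
  \int[sigma]_(u in @usphere R n) support_function K u.

Definition convex_hull_of (R : realType) (n m : nat)
    (v : 'I_m -> 'rV[R]_n) : set 'rV[R]_n :=
  [set y | exists a : 'I_m -> R,
    [/\ forall i, 0 <= a i, \sum_(i < m) a i = 1
      & y = \sum_(i < m) a i *: v i]].

(* Points at mutual distance 1 are affinely independent, so the n+1 points
   below are the vertices of a nondegenerate n-simplex. *)
Definition unit_regular_simplex (R : realType) (n : nat)
    (T : set 'rV[R]_n) : Prop :=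
  exists v : 'I_n.+1 -> 'rV[R]_n,
    (forall i j, i != j -> enorm (v i - v j) = 1) /\
    T = convex_hull_of v.

(* decimal [:: d1; ...; dk] is the decimal fraction 0.d1...dk; integer literals
   are unary, so numerators such as 39427 are avoided. *)
Definition decimal (R : realType) (ds : seq nat) : R :=
  foldr (fun d x => (d%:R + x) / 10) 0 ds.

(* Main.v *)
Require Import Defs.
From Stdlib Require Import BinNat.
From HB Require Import structures.
From mathcomp Require Import all_boot all_order all_algebra.
From mathcomp Require Import all_classical all_reals all_analysis.
From mathcomp Require Import measurable_realfun zify ring lra.
Import Order.TTheory GRing.Theory Num.Theory.
Import numFieldNormedType.Exports HBNNSimple.
Set Implicit Arguments.
Unset Strict Implicit.
Unset Printing Implicit Defensive.
Local Open Scope classical_set_scope.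
Local Open Scope ring_scope.

(** Let [T] be the simplex of dimension [n] with vertices [v i] and let [g] be a
standard Gaussian vector.  The direction of [g] is uniform on the sphere and
independent of its length, so that averaging a function that is homogeneous of
degree 1 gives [E (f g) = E (enorm g) * average of f] ([sphere_average]).
Applied to the support function, which is [u |-> max_i (dotp u (v i))], this
writes the mean width as a quotient of two Gaussian expectations.

For the numerator, the centred simplex scaled by [sqrt 2] is, up to an isometry,
the projection of the standard basis of dimension [n + 1] to the hyperplane
orthogonal to [(1, ..., 1)] ([dotp_simplex_frame]).  The numerator is therefore
the expected maximum of [n + 1] independent standard normal variables, divided
by [sqrt 2] ([maxf_simplex_frame]).  With the normal distribution function
[Phi] and density [phi], this expectation is the integral of [Phi - Phi ^ (n+1)]
([integral_gauss_rV_max]), hence by parts [n * (n + 1)] times the integral over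
[t >= 0] of [phi ^ 2 * (Phi ^ (n-1) + (1 - Phi) ^ (n-1))] ([integral_PhiB]).
For the denominator, [E (enorm g)] is a multiple of the integral of
[(1 + r ^ 2) ^ (-(n+2)/2)], which satisfies a two-step recurrence
([integral_gauss_rV_enorm], [integral0y_inv_hypSS]).  Together they give
[mean_width_regular_simplex].

For the numerical part, [Phi - 1/2] equals [phi] times the power series
[t + t^3/3 + t^5/15 + ...], and its truncations are lower bounds
([Phi_series_lower], [Phi_series_upper]).  As [Phi^m + (1 - Phi)^m] is an even
polynomial in [Phi - 1/2], increasing and Lipschitz on the relevant range,
replacing the series by its truncation after [K + 1] terms turns the integral
into even moments of Gaussians against rational polynomials, at a cost of at
most [m / (2 ^ (K + 5) * sqrt pi)] ([PhiB_truncation]).  This gives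
[mean_width_bounds]: up to that error the mean width is a combination of the
numbers [(2 pi)^(-j) * q_j / sqrt (j + 1)], where the [q_j] are explicit
rationals.  With [K = 24] these rationals, whose numerators and denominators
have hundreds of digits, are evaluated exactly on binary numbers
([series_moment_between]), and pi is bounded by the alternating series of [atan]
at [1/2] and [1/3] ([pi_bounds]); linear arithmetic finishes. *)

(** * Measurability of functions of row vectors *)

(** Countably many cubes with rational centres suffice, which is what makes
measurability into [borel_rV] a coordinatewise question. *)
Lemma open_rV_bigcup_ball (R : realType) (n : nat) (A : set 'rV[R]_n) :
  open A ->
  A = \bigcup_(p : 'rV[rat]_n * nat)
        [set x | ball (map_mx ratr p.1 : 'rV[R]_n) p.2.+1%:R^-1 x /\
          ball (map_mx ratr p.1 : 'rV[R]_n) p.2.+1%:R^-1 `<=` A].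
Proof.
move=> oA; rewrite eqEsubset; split => [x Ax|x [p _ [xp]]]; last exact.
have /nbhs_ballP[e /= e0 eA] : nbhs x A by apply: open_nbhs_nbhs; split.
have [k ke] : exists k : nat, k.+1%:R^-1 < e / 2.
  have e20 : 0 < e / 2 by rewrite divr_gt0.
  exists (Num.truncn (e / 2)^-1).
  rewrite invf_plt ?posrE//; exact: truncnS_gt.
have hq (i : 'I_n) : exists q : rat, `|ratr q - x ord0 i| < k.+1%:R^-1.
  have [q] := @rat_in_itvoo R (x ord0 i - k.+1%:R^-1) (x ord0 i + k.+1%:R^-1)
    ltac:(by rewrite ltrD2l (lt_trans (y := 0))// ?oppr_lt0 invr_gt0).
  rewrite in_itv/= => /andP[q1 q2]; exists q.
  by rewrite ltr_distl q1 q2.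
have /choice[f hf] := hq.
have k0 : 0 < k.+1%:R^-1 :> R by rewrite invr_gt0.
exists (\row_i f i, k) => //=; split.
  by split => // i j; rewrite !mxE ord1; exact: hf.
move=> y [_ yb]; apply: eA; split => // i j.
have := yb i j; rewrite !mxE ord1 /ball/= => h1; have h2 := hf j.
rewrite -(subrK (ratr (f j)) (x ord0 j)) -addrA (le_lt_trans (ler_normD _ _))//.
by rewrite (splitr e) ltrD// (lt_trans _ ke)// distrC.
Qed.

Lemma measurable_fun_rV (d : measure_display) (T : measurableType d)
    (R : realType) (n : nat) (f : T -> borel_rV R n) :
  (forall i, measurable_fun setT (fun x => (f x : 'rV[R]_n) ord0 i)) ->
  measurable_fun setT f.
Proof.
move=> mf; apply: (@measurability _ _ T (borel_rV R n) _ f (@open 'rV[R]_n) erefl) => _ [A oA <-].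
rewrite setTI (open_rV_bigcup_ball oA) preimage_bigcup.
apply: countable_bigcupT_measurable => // -[q k] /=.
have [sub|nsub] := pselect (ball (map_mx ratr q : 'rV[R]_n) k.+1%:R^-1 `<=` A);
  last first.
  rewrite (_ : _ @^-1` _ = set0); first exact: measurable0.
  by rewrite -subset0 => x [_ /nsub].
rewrite (_ : _ @^-1` _ = \bigcap_(i in [set: 'I_n])
  [set x | ball (ratr (q ord0 i) : R) k.+1%:R^-1 ((f x : 'rV[R]_n) ord0 i)]).
  apply: fin_bigcap_measurable; first exact: finite_finset.
  move=> i _; rewrite -[X in measurable X]setTI.
  by apply: mf => //; exact: measurable_ball.
apply/seteqP; split=> x /=.
  by move=> [[_ h] _] i _; have := h ord0 i; rewrite mxE.
move=> h; split => //; split; first by rewrite invr_gt0.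
by move=> i j; rewrite ord1 mxE; exact: h.
Qed.

Lemma continuous_measurable_rV (R : realType) (n : nat) (f : 'rV[R]_n -> R) :
  continuous f -> measurable_fun setT (f : borel_rV R n -> R).
Proof.
move=> cf; apply: (measurability _ (RGenOpens.measurableE R)).
move=> _ [_ [a [b ->] <-]].
rewrite setTI; apply: sub_sigma_algebra.
by move/continuousP : cf; apply; exact: interval_open.
Qed.

Lemma measurable_coord (R : realType) (n : nat) (i : 'I_n) :
  measurable_fun setT (fun x : borel_rV R n => (x : 'rV[R]_n) ord0 i).
Proof. by apply: continuous_measurable_rV; exact: coord_continuous. Qed.

Lemma measurable_dotp (d : measure_display) (T : measurableType d)
    (R : realType) (n : nat) (f g : T -> 'rV[R]_n) :
  (forall i, measurable_fun setT (fun x => f x ord0 i)) ->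
  (forall i, measurable_fun setT (fun x => g x ord0 i)) ->
  measurable_fun setT (fun x => dotp (f x) (g x)).
Proof.
move=> mf mg; rewrite /dotp.
apply: (@measurable_sum _ _ _ _ _ (index_enum _) (fun i x => f x ord0 i * g x ord0 i)) => i.
exact: measurable_funM.
Qed.

Lemma measurable_enorm (d : measure_display) (T : measurableType d)
    (R : realType) (n : nat) (f : T -> 'rV[R]_n) :
  (forall i, measurable_fun setT (fun x => f x ord0 i)) ->
  measurable_fun setT (fun x => enorm (f x)).
Proof.
move=> mf; apply: measurableT_comp; last exact: measurable_dotp.
by apply: continuous_measurable_fun; exact: sqrt_continuous.
Qed.

(** * The standard normal law *)

Notation stdnormal := (normal_prob 0 1).

Lemma ge0_integral_normal_prob (R : realType) (m s : R) (h : measurableTypeR R -> \bar R) :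
  measurable_fun setT h -> (forall x, 0 <= h x)%E ->
  (\int[normal_prob m s]_x h x =
   \int[lebesgue_measure]_x (h x * (normal_pdf m s x)%:E))%E.
Proof.
move=> mh h0.
have mpdf : measurable_fun setT (EFin \o normal_pdf m s).
  by apply/measurable_EFinP; exact: measurable_normal_pdf.
pose h_ : {nnsfun measurableTypeR R >-> R}^nat := nnsfun_approx measurableT mh.
have mhn n : measurable_fun setT (fun x => (h_ n x)%:E).
  by apply/measurable_EFinP; exact: measurable_funPT.
have cvgh x : (h_ n x)%:E @[n --> \oo] --> h x by exact: cvg_nnsfun_approx.
have ndh x : {homo (fun n => (h_ n x)%:E) : a b / (a <= b)%N >-> (a <= b)%E}.
  by move=> a b ab; rewrite lee_fin; exact/lefP/nd_nnsfun_approx.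
transitivity (limn (fun n => \int[normal_prob m s]_x (h_ n x)%:E)%E).
  rewrite -monotone_convergence//=.
  - by apply: eq_integral => x _; apply/esym/cvg_lim.
  - by move=> n x _; rewrite lee_fin.
transitivity (limn (fun n => \int[lebesgue_measure]_x
    ((h_ n x)%:E * (normal_pdf m s x)%:E))%E); last first.
  rewrite -monotone_convergence//=.
  - apply: eq_integral => x _; apply/cvg_lim => //.
    by apply: cvgeZr => //; exact: cvgh.
  - by move=> n; apply: emeasurable_funM => //; exact: mhn.
  - by move=> n x _; rewrite mule_ge0 ?lee_fin ?normal_pdf_ge0.
  - by move=> x _ a b ab; rewrite lee_wpmul2r ?lee_fin ?normal_pdf_ge0//; exact: ndh.
congr (limn _); apply/funext => n.
under [LHS]eq_integral do rewrite fimfunE -fsumEFin//.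
rewrite [LHS]ge0_integral_fsum//; last 2 first.
- by move=> r; exact/measurable_EFinP/measurableT_comp.
- by move=> k x _; rewrite EFinM nnfun_muleindic_ge0.
under [RHS]eq_integral.
  move=> x xD; rewrite fimfunE -fsumEFin// muleC ge0_mule_fsumr; last first.
    by move=> r; rewrite EFinM nnfun_muleindic_ge0.
  over.
rewrite [RHS]ge0_integral_fsum//; last 2 first.
- move=> r; apply: emeasurable_funM => //.
  by apply/measurable_EFinP; apply/measurableT_comp.
- move=> k x _; rewrite mule_ge0//; first by rewrite lee_fin normal_pdf_ge0.
  by rewrite EFinM nnfun_muleindic_ge0.
apply: eq_fsbigr => r _; rewrite integralZl_indic_nnsfun//= integral_indic//= setIT.
have [r0|r0] := ltP r 0.
  rewrite preimage_nnfun0// measure0 mule0.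
  by under eq_integral do rewrite indic0 mulr0 mule0; rewrite integral0.
under [RHS]eq_integral do rewrite EFinM muleCA.
rewrite ge0_integralZl//; last 2 first.
- by apply: emeasurable_funM => //; apply/measurable_EFinP.
- by move=> x _; rewrite mule_ge0 ?lee_fin ?normal_pdf_ge0.
congr (_ * _)%E; rewrite /normal_prob [LHS]integral_mkcond; apply: eq_integral => x _.
by rewrite patchE indicE; case: ifPn => _; rewrite ?mule1 ?mule0.
Qed.

(** The translated measure agrees with the Lebesgue measure on half-open intervals,
and this determines it. *)
Lemma lebesgue_measureD (R : realType) (b : R) (A : set R) : measurable A ->
  pushforward lebesgue_measure ((fun t => t + b) : R -> measurableTypeR R) A =
  lebesgue_measure A.
Proof.
move=> mA.
have mf : measurable_fun setT ((fun t => t + b) : measurableTypeR R -> measurableTypeR R).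
  exact: measurable_funD.
pose mfB := isMeasurableFun.Build _ _ _ _ _ mf.
pose F : {mfun measurableTypeR R >-> measurableTypeR R} := HB.pack (fun t : R => t + b) mfB.
apply/esym/(@lebesgue_measure_unique R (pushforward lebesgue_measure F)) => //= _ [[u v]] _ <-.
rewrite /pushforward (_ : _ @^-1` _ = `](u - b), (v - b)]%classic).
  by rewrite !lebesgue_measure_itv/= !lte_fin ltrD2r -!EFinB opprB addrA subrK.
by apply/seteqP; split=> x/=; rewrite !in_itv/= ltrBlDr lerBrDr.
Qed.

(** The Cameron-Martin formula in dimension one: shifting the variable is the same
as tilting the density by an exponential. *)
Lemma ge0_integral_stdnormal_shift (R : realType) (b : R) (h : measurableTypeR R -> \bar R) :
  measurable_fun setT h -> (forall x, 0 <= h x)%E ->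
  (\int[stdnormal]_t h (t + b)%R =
   \int[stdnormal]_t (h t * (expR (b * t - b ^+ 2 / 2))%:E))%E.
Proof.
move=> mh h0.
pose G t := (h t * (normal_pdf 0 1 (t - b))%:E)%E.
have mD : measurable_fun setT ((fun t => t + b) : measurableTypeR R -> measurableTypeR R).
  exact: measurable_funD.
have mG : measurable_fun setT G.
  apply: emeasurable_funM => //; apply/measurable_EFinP.
  by apply: measurableT_comp (measurable_normal_pdf _ _) _; exact: measurable_funB.
have G0 x : (0 <= G x)%E by rewrite mule_ge0 ?lee_fin ?normal_pdf_ge0.
rewrite ge0_integral_normal_prob//; last exact: (measurableT_comp mh mD).
rewrite [RHS]ge0_integral_normal_prob; last 2 first.
- apply: emeasurable_funM => //; apply/measurable_EFinP.
  apply: measurableT_comp => //; apply: measurable_funB => //.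
- by move=> x; rewrite mule_ge0 ?lee_fin ?expR_ge0.
transitivity (\int[lebesgue_measure]_t (G (t + b)%R))%E.
  by apply: eq_integral => t _; rewrite /G addrK.
transitivity (\int[lebesgue_measure]_t (G t))%E.
  have := @ge0_integral_pushforward _ _ _ _ R _ mD lebesgue_measure setT G measurableT mG.
  rewrite preimage_setT => <-; last by move=> x _.
  by apply: eq_measure_integral => A mA _; exact: lebesgue_measureD.
apply: eq_integral => t _; rewrite /G -muleA -EFinM; congr (_ * _%:E)%E.
rewrite normal_pdfE ?oner_neq0// /normal_fun !subr0 mulrCA -expRD.
by congr (_ * expR _); field.
Qed.

(** * The standard Gaussian vector *)

Definition cons_rV (R : realType) (n : nat)
    (p : measurableTypeR R * borel_rV R n) : borel_rV R n.+1 :=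
  \row_j (if unlift ord0 j is Some i then (p.2 : 'rV[R]_n) ord0 i else p.1).

Definition tail_rV (R : realType) (n : nat) (x : 'rV[R]_n.+1) : 'rV[R]_n :=
  \row_i x ord0 (lift ord0 i).

Lemma cons_rV0 (R : realType) (n : nat) (p : measurableTypeR R * borel_rV R n) :
  (cons_rV p : 'rV[R]_n.+1) ord0 ord0 = p.1.
Proof. by rewrite mxE unlift_none. Qed.

Lemma cons_rVS (R : realType) (n : nat) (p : measurableTypeR R * borel_rV R n)
    (i : 'I_n) :
  (cons_rV p : 'rV[R]_n.+1) ord0 (lift ord0 i) = (p.2 : 'rV[R]_n) ord0 i.
Proof. by rewrite mxE liftK. Qed.

Lemma cons_rVK (R : realType) (n : nat) (p : measurableTypeR R * borel_rV R n) :
  tail_rV (cons_rV p) = p.2.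
Proof. by apply/rowP => i; rewrite mxE cons_rVS. Qed.

Lemma measurable_cons_rV (R : realType) (n : nat) :
  measurable_fun setT (@cons_rV R n).
Proof.
apply: measurable_fun_rV => i; case: (unliftP ord0 i) => [j|] ->.
  under eq_fun do rewrite cons_rVS.
  exact: (measurableT_comp (@measurable_coord R n j) measurable_snd).
under eq_fun do rewrite cons_rV0.
exact: measurable_fst.
Qed.

HB.instance Definition _ (R : realType) (n : nat) :=
  isMeasurableFun.Build _ _ _ _ (@cons_rV R n) (@measurable_cons_rV R n).

(** The law of a vector with independent standard normal coordinates, built one
coordinate at a time so that Tonelli's theorem gives inductions on the
dimension. *)
Fixpoint gauss_rV (R : realType) (n : nat) : probability (borel_rV R n) R :=
  match n return probability (borel_rV R n) R with
  | 0%N => [the probability _ _ of @dirac _ (borel_rV R 0) (0 : 'rV[R]_0) R]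
  | n'.+1 => [the probability _ _ of
      distribution (product_measure1 (stdnormal : probability (measurableTypeR R) R) (gauss_rV R n')) (@cons_rV R n')]
  end.

Lemma ge0_integral_gauss_rVS (R : realType) (n : nat)
    (F : borel_rV R n.+1 -> \bar R) :
  measurable_fun setT F -> (forall x, 0 <= F x)%E ->
  (\int[gauss_rV R n.+1]_x F x =
   \int[stdnormal]_t \int[gauss_rV R n]_y F (cons_rV (t, y)))%E.
Proof.
move=> mF F0; rewrite /= ge0_integral_distribution// fubini_tonelli1//.
  exact: (measurableT_comp mF (@measurable_cons_rV R n)).
by move=> x; exact: F0.
Qed.

Lemma measurable_prod_coord (R : realType) (n : nat)
    (h : 'I_n -> measurableTypeR R -> R) :
  (forall i, measurable_fun setT (h i)) ->
  measurable_fun setT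
    (fun x : borel_rV R n => \prod_(i < n) h i ((x : 'rV[R]_n) ord0 i)).
Proof.
move=> mh; apply: (@measurable_prod _ _ _ _ _ (index_enum _)
  (fun i (x : borel_rV R n) => h i ((x : 'rV[R]_n) ord0 i))) => i _.
exact: (measurableT_comp (mh i) (@measurable_coord R n i)).
Qed.

Lemma integral_gauss_rV_prod (R : realType) (n : nat)
    (h : 'I_n -> measurableTypeR R -> R) (c : 'I_n -> R) :
  (forall i, measurable_fun setT (h i)) -> (forall i t, 0 <= h i t) ->
  (forall i, \int[stdnormal]_t (h i t)%:E = (c i)%:E)%E ->
  (\int[gauss_rV R n]_x (\prod_(i < n) h i ((x : 'rV[R]_n) ord0 i))%:E =
   (\prod_(i < n) c i)%:E)%E.
Proof.
elim: n h c => [|n IH] h c mh h0 hc.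
  under eq_integral do rewrite big_ord0.
  rewrite integral_cst// mul1e big_ord0.
  exact: (@probability_setT _ _ _ (gauss_rV R 0)).
rewrite ge0_integral_gauss_rVS; last 2 first.
- by apply/measurable_EFinP; exact: measurable_prod_coord.
- by move=> x; rewrite lee_fin prodr_ge0.
have pr t (y : borel_rV R n) :
    (\prod_(i < n.+1) h i ((cons_rV (t, y) : 'rV[R]_n.+1) ord0 i))%:E =
    ((h ord0 t)%:E * (\prod_(i < n) h (lift ord0 i) ((y : 'rV[R]_n) ord0 i))%:E)%E.
  rewrite big_ord_recl cons_rV0 EFinM; congr (_ * _%:E)%E.
  by apply: eq_bigr => i _; rewrite cons_rVS.
transitivity (\int[stdnormal]_t ((h ord0 t)%:E * (\prod_(i < n) c (lift ord0 i))%:E))%E.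
  apply: eq_integral => t _; under eq_integral do rewrite pr.
  rewrite ge0_integralZl ?lee_fin//.
  - by rewrite (IH (fun i => h (lift ord0 i)) (fun i => c (lift ord0 i))).
  - by apply/measurable_EFinP; exact: (measurable_prod_coord (h := fun i => h (lift ord0 i))).
  - by move=> x _; rewrite lee_fin prodr_ge0.
rewrite ge0_integralZr//.
- by rewrite hc -EFinM big_ord_recl.
- by apply/measurable_EFinP.
- by move=> t _; rewrite lee_fin.
- rewrite lee_fin prodr_ge0// => i _; rewrite -lee_fin -hc.
  by apply: integral_ge0 => t _; rewrite lee_fin.
Qed.

Lemma measurable_addrV (R : realType) (n : nat) (b : 'rV[R]_n) :
  measurable_fun setT ((fun x => x + b) : borel_rV R n -> borel_rV R n).
Proof.
apply: measurable_fun_rV => i; under eq_fun do rewrite mxE.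
by apply: measurable_funD => //; exact: measurable_coord.
Qed.

(** The Cameron-Martin formula: the law of [x + b] has an exponential density with
respect to the law of [x]. *)
Lemma ge0_integral_gauss_rV_shift (R : realType) (n : nat) (b : 'rV[R]_n)
    (F : borel_rV R n -> \bar R) :
  measurable_fun setT F -> (forall x, 0 <= F x)%E ->
  (\int[gauss_rV R n]_x F ((x : 'rV[R]_n) + b)%R =
   \int[gauss_rV R n]_x (F x * (expR (dotp x b - dotp b b / 2))%:E))%E.
Proof.
elim: n b F => [|n IH] b F mF F0.
  apply: eq_integral => x _; rewrite /dotp !big_ord0 mul0r subrr expR0 mule1.
  by congr F; apply/rowP => -[].
have mE m (d : 'rV[R]_m) : measurable_fun setT
    (fun x : borel_rV R m => expR (dotp x d - dotp d d / 2)).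
  apply: measurableT_comp => //; apply: measurable_funB => //.
  by apply: measurable_dotp => // i; exact: measurable_coord.
rewrite ge0_integral_gauss_rVS//; last exact: (measurableT_comp mF (measurable_addrV b)).
rewrite ge0_integral_gauss_rVS//; last 2 first.
- by apply: emeasurable_funM => //; exact/measurable_EFinP.
- by move=> x; rewrite mule_ge0// lee_fin expR_ge0.
pose G t := (\int[gauss_rV R n]_y (F (cons_rV (t, y)) *
  (expR (dotp y (tail_rV b) - dotp (tail_rV b) (tail_rV b) / 2))%:E))%E.
have mG2 : measurable_fun setT (fun p : measurableTypeR R * borel_rV R n =>
   (F (cons_rV p) *
  (expR (dotp p.2 (tail_rV b) - dotp (tail_rV b) (tail_rV b) / 2))%:E)%E).
  apply: emeasurable_funM.
    exact: (measurableT_comp mF (@measurable_cons_rV R n)).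
  apply/measurable_EFinP.
  exact: (measurableT_comp (mE _ (tail_rV b)) measurable_snd).
have G2_ge0 p : (0 <= F (cons_rV p) *
  (expR (dotp p.2 (tail_rV b) - dotp (tail_rV b) (tail_rV b) / 2))%:E)%E.
  by rewrite mule_ge0// lee_fin expR_ge0.
have mG : measurable_fun setT G by exact: (measurable_fun_fubini_tonelli_F _ mG2 G2_ge0).
have dS (x y : 'rV[R]_n.+1) : dotp x y =
    x ord0 ord0 * y ord0 ord0 + dotp (tail_rV x) (tail_rV y).
  by rewrite /dotp big_ord_recl; congr (_ + _); apply: eq_bigr => i _; rewrite !mxE.
transitivity (\int[stdnormal]_t G (t + b ord0 ord0)%R)%E.
  apply: eq_integral => t _; rewrite /G.
  rewrite -(IH (tail_rV b) (fun y => F (cons_rV (t + b ord0 ord0, y))))//.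
    apply: eq_integral => y _; congr F; apply/rowP => i; rewrite !mxE.
    by case: (unliftP ord0 i) => [j|] ->; rewrite // !mxE.
  apply: (measurableT_comp mF); apply: (measurableT_comp (@measurable_cons_rV R n)).
  exact: measurable_pair1.
rewrite ge0_integral_stdnormal_shift//; last by move=> t; exact: integral_ge0.
apply: eq_integral => t _; rewrite /G -ge0_integralZr//.
- apply: eq_integral => y _; rewrite -muleA -EFinM; congr (_ * _%:E)%E.
  rewrite -expRD !dS cons_rVK cons_rV0; congr expR.
  by rewrite /=; field.
- apply: (measurableT_comp mG2); exact: measurable_pair1.
Qed.

(** * Integrals over the half-line *)

Notation "'int0y' f" := (\int[lebesgue_measure]_(x in `[0%R, +oo[) (f x)%:E)%E
  (at level 10, f at level 8, only parsing).

Lemma is_derive_continuous (R : realType) (F f : R -> R) :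
  (forall x : R, is_derive x 1 F (f x)) -> continuous F.
Proof.
move=> dF x; apply: differentiable_continuous; apply/derivable1_diffP.
by have [] := dF x.
Qed.

Lemma continuous_mul (R : realType) (f g : R -> R) :
  continuous f -> continuous g -> continuous (fun t => f t * g t).
Proof. by move=> cf cg t; apply: cvgM; [exact: cf|exact: cg]. Qed.

Lemma continuous_pow (R : realType) (f : R -> R) (k : nat) :
  continuous f -> continuous (fun t => f t ^+ k).
Proof.
move=> cf; elim: k => [|k IH]; first by move=> t; exact: cvg_cst.
by under eq_fun do rewrite exprS; exact: continuous_mul.
Qed.

Lemma FTC2_segment (R : realType) (f F : R -> R) (a b : R) :
  a <= b -> continuous f -> (forall x : R, is_derive x 1 F (f x)) ->
  (\int[lebesgue_measure]_(x in `[a, b]) (f x)%:E = (F b - F a)%:E)%E.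
Proof.
rewrite le_eqVlt => /predU1P[<- _ _|ab cf dF].
  by rewrite set_itv1 integral_set1 subrr.
have cF := is_derive_continuous dF.
rewrite (@continuous_FTC2 _ f F)//.
- exact: continuous_subspaceT.
- split.
  + by move=> x _; have [] := dF x.
  + exact/cvg_at_right_filter/cF.
  + exact/cvg_at_left_filter/cF.
- by move=> x _; rewrite derive1E; have [] := dF x.
Qed.

Lemma integrable_segment (R : realType) (f : R -> R) (a b : R) :
  continuous f -> lebesgue_measure.-integrable `[a, b] (EFin \o f).
Proof.
move=> cf; apply: continuous_compact_integrable; first exact: segment_compact.
exact: continuous_subspaceT.
Qed.

Lemma is_derive_mul (R : realType) (f g : R -> R) (x df dg : R) :
  is_derive x 1 f df -> is_derive x 1 g dg ->
  is_derive x 1 (fun t => f t * g t) (df * g x + f x * dg).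
Proof.
move=> hf hg; apply: is_derive_eq (is_deriveM hf hg) _.
by rewrite /GRing.scale/= addrC [g x * df]mulrC.
Qed.

Lemma is_derive_scale (R : realType) (c : R) (f : R -> R) (x df : R) :
  is_derive x 1 f df -> is_derive x 1 (fun t => c * f t) (c * df).
Proof. by move=> hf; exact: (is_deriveZ c hf). Qed.

Lemma is_derive_add (R : realType) (f g : R -> R) (x df dg : R) :
  is_derive x 1 f df -> is_derive x 1 g dg ->
  is_derive x 1 (fun t => f t + g t) (df + dg).
Proof. by move=> hf hg; exact: (is_deriveD hf hg). Qed.

Lemma is_derive_sub (R : realType) (f g : R -> R) (x df dg : R) :
  is_derive x 1 f df -> is_derive x 1 g dg ->
  is_derive x 1 (fun t => f t - g t) (df - dg).
Proof. by move=> hf hg; exact: (is_deriveB hf hg). Qed.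

Lemma is_derive_pow (R : realType) (f : R -> R) (k : nat) (x df : R) :
  is_derive x 1 f df -> is_derive x 1 (fun t => f t ^+ k) (k%:R * f x ^+ k.-1 * df).
Proof. by move=> hf; have := @is_deriveX _ _ f k x 1 df hf; rewrite exprfctE. Qed.

Lemma integral0yD (R : realType) (f g : R -> R) (a b : R) :
  (forall x, 0 <= x -> 0 <= f x) -> (forall x, 0 <= x -> 0 <= g x) ->
  continuous f -> continuous g -> int0y f = a%:E -> int0y g = b%:E ->
  int0y (fun x => f x + g x) = (a + b)%:E.
Proof.
move=> f0 g0 cf cg fa gb; under eq_integral do rewrite EFinD.
rewrite ge0_integralD//; last 4 first.
- by move=> x /=; rewrite in_itv/= andbT lee_fin; auto.
- apply/measurable_EFinP; apply: measurable_funTS; exact: continuous_measurable_fun.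
- by move=> x /=; rewrite in_itv/= andbT lee_fin; auto.
- apply/measurable_EFinP; apply: measurable_funTS; exact: continuous_measurable_fun.
by rewrite fa gb EFinD.
Qed.

Lemma integral0yZ (R : realType) (c : R) (f : R -> R) (a : R) :
  0 <= c -> (forall x, 0 <= x -> 0 <= f x) -> continuous f -> int0y f = a%:E ->
  int0y (fun x => c * f x) = (c * a)%:E.
Proof.
move=> c0 f0 cf fa; under eq_integral do rewrite EFinM.
rewrite ge0_integralZl ?lee_fin//; last 2 first.
- apply/measurable_EFinP; apply: measurable_funTS; exact: continuous_measurable_fun.
- by move=> x /=; rewrite in_itv/= andbT lee_fin; auto.
by rewrite fa EFinM.
Qed.

Lemma integral0y_le (R : realType) (f g : R -> R) :
  (forall x, 0 <= x -> 0 <= f x <= g x) -> continuous f -> continuous g ->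
  (int0y f <= int0y g)%E.
Proof.
move=> fg cf cg; apply: ge0_le_integral => //=.
- by move=> x; rewrite in_itv/= andbT lee_fin => /fg/andP[].
- apply/measurable_EFinP; apply: measurable_funTS; exact: continuous_measurable_fun.
- apply/measurable_EFinP; apply: measurable_funTS; exact: continuous_measurable_fun.
- by move=> x; rewrite in_itv/= andbT lee_fin => /fg/andP[].
Qed.

Lemma integral0y_sum (R : realType) (n : nat) (f : 'I_n -> R -> R) (b : 'I_n -> R) :
  (forall i x, 0 <= x -> 0 <= f i x) -> (forall i, continuous (f i)) ->
  (forall i, int0y (f i) = (b i)%:E) ->
  int0y (fun x => \sum_i f i x) = (\sum_i b i)%:E.
Proof.
move=> f0 cf fb; under eq_integral do rewrite -sumEFin.
rewrite ge0_integral_sum//; last 2 first.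
- move=> i; apply/measurable_EFinP; apply: measurable_funTS.
  exact: continuous_measurable_fun.
- by move=> i x /=; rewrite in_itv/= andbT lee_fin; exact: f0.
by rewrite -sumEFin; apply: eq_bigr => i _; rewrite fb.
Qed.

(** Integration by parts in the form in which it is used: if [F' = f - g] and [F] has
a limit at infinity, the integral of [f] is obtained from that of [g].  Only
the nonnegative functions [f] and [g] are integrated to infinity, so that
monotone convergence along the segments [[0, n]] replaces any integrability
assumption. *)
Lemma integral0y_by_parts (R : realType) (f g F : R -> R) (B l : R) :
  (forall x, 0 <= f x) -> (forall x, 0 <= g x) ->
  continuous f -> continuous g ->
  (forall x : R, is_derive x 1 F (f x - g x)) -> F x @[x --> +oo] --> l ->
  int0y g = B%:E -> int0y f = (B + l - F 0)%:E.
Proof.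
move=> f0 g0 cf cg dF Fl gB.
have mf : measurable_fun setT f by exact: continuous_measurable_fun.
have mg : measurable_fun setT g by exact: continuous_measurable_fun.
have cvgf := @ge0_cvgn_integral R lebesgue_measure f f0 mf.
have cvgg := @ge0_cvgn_integral R lebesgue_measure g g0 mg.
have seg n : (\int[lebesgue_measure]_(x in `[0%R, n%:R]) (f x)%:E =
   \int[lebesgue_measure]_(x in `[0%R, n%:R]) (g x)%:E + (F n%:R - F 0)%:E)%E.
  rewrite -(@FTC2_segment _ (fun x => f x - g x) F)//; last first.
    by move=> x; apply: cvgB; [exact: cf|exact: cg].
  rewrite -integralD//=; last 2 first.
  - exact: integrable_segment.
  - apply: (@integrable_segment _ (fun x => f x - g x)) => x.
    by apply: cvgB; [exact: cf|exact: cg].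
  by apply: eq_integral => x _; rewrite -EFinD addrCA subrr addr0.
rewrite -(cvg_lim _ cvgf)//; apply/cvg_lim => //.
under eq_fun do rewrite seg.
rewrite -addrA EFinD; apply: cvgeD => //; first by rewrite -gB.
apply: cvg_EFin; first by near=> n.
rewrite /=; apply: cvgB; last exact: cvg_cst.
by move/cvg_pinftyP : Fl; apply; exact: cvgr_idn.
Unshelve. all: end_near.
Qed.

Lemma integral0y_FTC (R : realType) (f F : R -> R) (l : R) :
  (forall x, 0 <= f x) -> continuous f ->
  (forall x : R, is_derive x 1 F (f x)) -> F x @[x --> +oo] --> l ->
  int0y f = (l - F 0)%:E.
Proof.
move=> f0 cf dF Fl; rewrite -[l]add0r.
apply: (@integral0y_by_parts _ f (cst 0) F 0 l) => //.
- exact: cst_continuous.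
- by move=> x; rewrite subr0.
- by rewrite integral0_eq.
Qed.

Lemma cvgyV (R : realType) : x^-1 @[x --> +oo] --> (0 : R).
Proof.
apply/(@gtr0_cvgV0 _ _ _ _ (id : R -> R)) => //.
by near=> x; near: x; exact: nbhs_pinfty_gt.
Unshelve. all: end_near.
Qed.

(** One term of the exponential series suffices: [expR y >= y ^ (k+1) / (k+1)!] at
[y = a * x ^ 2] bounds the function by a multiple of [1 / x]. *)
Lemma cvgy_pow_gauss (R : realType) (a : R) (k : nat) :
  0 < a -> x ^+ k * expR (- (a * x ^+ 2)) @[x --> +oo] --> (0 : R).
Proof.
move=> a0; pose C : R := k.+1`!%:R / a ^+ k.+1.
have C0 : 0 < C by rewrite divr_gt0// ?exprn_gt0// ltr0n fact_gt0.
apply: (@squeeze_cvgr _ _ _ _ (cst 0) (fun x => C * x^-1)).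
- near=> x.
  have x1 : 1 <= x by near: x; exact: nbhs_pinfty_ge.
  have x0 : 0 < x by exact: lt_le_trans x1.
  rewrite mulr_ge0 ?exprn_ge0 ?expR_ge0 ?(ltW x0)//=.
  rewrite expRN ler_pdivrMr ?expR_gt0//.
  have ax0 : 0 <= a * x ^+ 2 by rewrite mulr_ge0 ?ltW// exprn_gt0.
  have := expR_ge1Dxn k ax0; rewrite exprMn -exprM => h.
  have {}h : a ^+ k.+1 * x ^+ (2 * k.+1) / k.+1`!%:R <= expR (a * x ^+ 2).
    by apply: le_trans h; rewrite lerDr.
  apply: (@le_trans _ _ (C / x * (a ^+ k.+1 * x ^+ (2 * k.+1) / k.+1`!%:R))); last first.
    by rewrite ler_pM2l// divr_gt0.
  have -> : C / x * (a ^+ k.+1 * x ^+ (2 * k.+1) / k.+1`!%:R) = x ^+ (2 * k + 1).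
    rewrite /C (_ : 2 * k.+1 = (2 * k + 1).+1)%N; last by rewrite mulnS addnC addn2 addn1.
    have A0 : a ^+ k.+1 != 0 by rewrite gt_eqF// exprn_gt0.
    have f0 : (k.+1`!)%:R != 0 :> R by rewrite pnatr_eq0 -lt0n fact_gt0.
    have x0' : x != 0 by rewrite gt_eqF.
    rewrite (exprS x); move: (a ^+ k.+1) (k.+1`!%:R : R) (x ^+ (2 * k + 1)) A0 f0.
    by move=> A f y A0 f0; field; rewrite x0' A0 f0.
  by apply: ler_weXn2l => //; lia.
- exact: cvg_cst.
- rewrite -[X in _ --> X](mulr0 C); apply: cvgM; first exact: cvg_cst.
  exact: cvgyV.
Unshelve. all: end_near.
Qed.

Lemma continuous_pow_gauss (R : realType) (a : R) (k : nat) :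
  continuous (fun x : R => x ^+ k * expR (- (a * x ^+ 2))).
Proof.
move=> x; apply: cvgM; first exact: exprn_continuous.
apply: (@cvg_comp _ _ _ (fun x : R => - (a * x ^+ 2)) expR); last exact: continuous_expR.
apply: cvgN; apply: cvgM; first exact: cvg_cst.
exact: exprn_continuous.
Qed.

Lemma even_moment_ge0 (R : realType) (i : nat) (x y : R) :
  0 <= x ^+ (2 * i) * expR y.
Proof. by rewrite mulr_ge0 ?expR_ge0// exprM exprn_ge0// sqr_ge0. Qed.

Lemma is_derive_gauss (R : realType) (a x : R) :
  is_derive x 1 (fun x : R => expR (- (a * x ^+ 2)))
    (- (2 * a * x) * expR (- (a * x ^+ 2))).
Proof.
apply: (@is_derive_eq _ _ _ (expR \o (fun x : R => - (a * x ^+ 2)))).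
rewrite [X in X = _]mulrC; congr (_ * _); rewrite /GRing.scale/=.
by ring.
Qed.

(** The integral of a normal density is 1, and the function is even. *)
Lemma integral0y_gauss_scale (R : realType) (a : R) : 0 < a ->
  int0y (fun x => expR (- (a * x ^+ 2))) = (Num.sqrt (pi / a) / 2)%:E.
Proof.
move=> a0; pose s := (Num.sqrt (2 * a))^-1.
have s0 : s != 0 by rewrite gt_eqF// invr_gt0 sqrtr_gt0 mulr_gt0.
have s2 : s ^+ 2 = (2 * a)^-1 by rewrite exprVn sqr_sqrtr// ltW// mulr_gt0.
have pdfE x : normal_pdf 0 s x = Num.sqrt (a / pi) * expR (- (a * x ^+ 2)).
  rewrite normal_pdfE// /normal_fun /normal_peak s2 subr0; congr (_ * expR _).
    rewrite -sqrtrV; last by rewrite mulrn_wge0// mulr_ge0 ?pi_ge0// invr_ge0 mulr_ge0 ?ltW.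
    congr Num.sqrt; rewrite -mulr_natr; move: pi (pi_gt0 R) => p p0.
    by field; rewrite !gt_eqF.
  by rewrite -mulr_natr; field; rewrite gt_eqF.
have := integral_normal_pdf (0 : R) s.
rewrite ge0_symfun_integralT; last 3 first.
- by move=> x; exact: normal_pdf_ge0.
- exact: continuous_normal_pdf.
- by move=> x /=; rewrite !pdfE sqrrN.
rewrite (_ : [set x | _] = `[0, +oo[%classic); last first.
  by apply/seteqP; split => x/=; rewrite in_itv/= andbT.
have k0 : 0 < Num.sqrt (a / pi) by rewrite sqrtr_gt0 divr_gt0// pi_gt0.
under eq_integral do rewrite pdfE EFinM.
rewrite ge0_integralZl ?lee_fin ?(ltW k0)//; last first.
  apply: measurable_funTS; apply/measurable_EFinP.
  apply: continuous_measurable_fun.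
  exact: (is_derive_continuous (is_derive_gauss a)).
rewrite muleA -EFinM => h.
have k2 : 2 * Num.sqrt (a / pi) != 0 by rewrite gt_eqF// mulr_gt0.
transitivity (((2 * Num.sqrt (a / pi))^-1)%:E * ((2 * Num.sqrt (a / pi))%:E *
    int0y (fun x => expR (- (a * x ^+ 2)))))%E.
  by rewrite muleA -EFinM mulVf// mul1e.
rewrite h mule1; congr _%:E.
by rewrite invfM mulrC -sqrtrV ?divr_ge0 ?pi_ge0 ?ltW// invf_div.
Qed.

(** Each step multiplies the moment by [(2 i + 1) / (2 a)], by parts with the
derivative of [x ^ (2 i + 1) * expR (- (a * x ^ 2))]. *)
Lemma integral0y_moment (R : realType) (a : R) (i : nat) : 0 < a ->
  int0y (fun x => x ^+ (2 * i) * expR (- (a * x ^+ 2))) =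
  (Num.sqrt (pi / a) / 2 * \prod_(j < i) ((2 * j + 1)%:R / (2 * a)))%:E.
Proof.
move=> a0; elim: i => [|i IH].
  under eq_integral do rewrite muln0 expr0 mul1r.
  by rewrite big_ord0 mulr1 integral0y_gauss_scale.
have a20 : 2 * a != 0 by rewrite gt_eqF// mulr_gt0.
pose c : R := (2 * i + 1)%:R / (2 * a).
have c0 : 0 <= c by rewrite divr_ge0 ?ler0n// mulr_ge0// ltW.
pose B := Num.sqrt (pi / a) / 2 * \prod_(j < i) ((2 * j + 1)%:R / (2 * a)).
pose F (x : R) := - (2 * a)^-1 * (x ^+ (2 * i + 1) * expR (- (a * x ^+ 2))).
transitivity (c * B + 0 - F 0)%:E; last first.
  rewrite big_ord_recr /= /F addn1 expr0n mul0r mulr0 subr0 addr0 /B.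
  by congr EFin; rewrite [LHS]mulrC [RHS]mulrA /c addn1.
have dF (x : R) : is_derive x 1 F (x ^+ (2 * i.+1) * expR (- (a * x ^+ 2)) -
    c * (x ^+ (2 * i) * expR (- (a * x ^+ 2)))).
  apply: is_derive_eq (is_derive_scale _ (is_derive_mul
    (is_derive_pow (2 * i + 1) (is_derive_id x 1)) (is_derive_gauss a x))) _.
  rewrite /c addn1/= mulnS !exprS; field.
  by rewrite gt_eqF.
have IH' : int0y (fun x => c * (x ^+ (2 * i) * expR (- (a * x ^+ 2)))) = (c * B)%:E.
  apply: integral0yZ IH => //; last exact: continuous_pow_gauss.
  by move=> x _; exact: even_moment_ge0.
apply: integral0y_by_parts dF _ IH' => //.
- by move=> x; rewrite even_moment_ge0.
- by move=> x; rewrite mulr_ge0// even_moment_ge0.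
- exact: continuous_pow_gauss.
- by move=> x; apply: cvgM; [exact: cvg_cst|exact: continuous_pow_gauss].
- rewrite /F -[X in _ --> X](mulr0 (- (2 * a)^-1)); apply: cvgM; first exact: cvg_cst.
  exact: cvgy_pow_gauss.
Qed.

(** This is [cos (atan r)], and also the standard deviation of the normal law whose
density with respect to the standard one is proportional to
[expR (- r ^ 2 * t ^ 2 / 2)]. *)
Definition inv_hyp (R : realType) (r : R) : R := (Num.sqrt (1 + r ^+ 2))^-1.

Lemma inv_hyp_gt0 (R : realType) (r : R) : 0 < inv_hyp r.
Proof. by rewrite invr_gt0 sqrtr_gt0 ltr_pwDl// sqr_ge0. Qed.

Lemma inv_hyp_sqr (R : realType) (r : R) : inv_hyp r ^+ 2 * (1 + r ^+ 2) = 1.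
Proof.
have h : 0 < 1 + r ^+ 2 by rewrite ltr_pwDl// sqr_ge0.
by rewrite exprVn sqr_sqrtr ?(ltW h)// mulVf// gt_eqF.
Qed.

Lemma is_derive_inv_hyp (R : realType) (r : R) :
  is_derive r 1 (@inv_hyp R) (- r * inv_hyp r ^+ 3).
Proof.
have h : 0 < 1 + r ^+ 2 by rewrite ltr_pwDl// sqr_ge0.
have s0 : Num.sqrt (1 + r ^+ 2) != 0 by rewrite gt_eqF// sqrtr_gt0.
have d1 := is_derive_add (is_derive_cst (1 : R) r 1) (is_derive_pow 2 (is_derive_id r 1)).
have d2 : is_derive r 1 (fun t : R => Num.sqrt (1 + t ^+ 2)) _ :=
  @is_derive1_comp _ Num.sqrt _ r _ _ (is_derive1_sqrt h) d1.
apply: is_derive_eq (@is_deriveV _ _ r _ _ s0 d2) _.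
rewrite /inv_hyp /GRing.scale/=; field.
by rewrite s0.
Qed.

Lemma continuous_inv_hyp_pow (R : realType) (k : nat) :
  continuous (fun r : R => inv_hyp r ^+ k).
Proof.
apply: (is_derive_continuous (f := fun r => k%:R * inv_hyp r ^+ k.-1 * (- r * inv_hyp r ^+ 3))).
by move=> r; exact: is_derive_pow (is_derive_inv_hyp r).
Qed.

Lemma inv_hyp_le (R : realType) (r : R) : 0 < r -> inv_hyp r <= r^-1.
Proof.
move=> r0; rewrite lef_pV2 ?posrE ?sqrtr_gt0 ?ltr_pwDl ?sqr_ge0//.
by rewrite -[leLHS](gtr0_norm r0) -sqrtr_sqr ler_wsqrtr// lerDr.
Qed.

Lemma inv_hyp_mul_le (R : realType) (r : R) : 0 < r -> r * inv_hyp r <= 1.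
Proof.
by move=> r0; rewrite mulrC -ler_pdivlMr// div1r inv_hyp_le.
Qed.

(** Wallis' recurrence, by parts with the derivative of [r * inv_hyp r ^ (k+2)]. *)
Lemma integral0y_inv_hypSS (R : realType) (k : nat) (c : R) :
  int0y (fun r => inv_hyp r ^+ k.+2) = c%:E ->
  int0y (fun r => inv_hyp r ^+ k.+4) = (k.+1%:R / k.+2%:R * c)%:E.
Proof.
move=> hc; pose F (r : R) := k.+2%:R^-1 * (r * inv_hyp r ^+ k.+2).
pose d : R := k.+1%:R / k.+2%:R.
have d0 : 0 <= d by rewrite divr_ge0 ?ler0n.
have dF (r : R) : is_derive r 1 F (inv_hyp r ^+ k.+4 - d * inv_hyp r ^+ k.+2).
  apply: is_derive_eq (is_derive_scale _ (is_derive_mul (is_derive_id r 1)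
    (is_derive_pow k.+2 (is_derive_inv_hyp r)))) _.
  have h := inv_hyp_sqr r.
  rewrite /= /d [inv_hyp r ^+ k.+4]exprSr [inv_hyp r ^+ k.+3]exprSr.
  rewrite [inv_hyp r ^+ k.+2]exprSr.
  move: (inv_hyp r) (inv_hyp r ^+ k.+1) h => s t h.
  have {}h : r ^+ 2 * s ^+ 2 = 1 - s ^+ 2 by rewrite -h; ring.
  rewrite (_ : 1 * (t * s) + r * (k.+2%:R * t * (- r * s ^+ 3)) =
    t * s - k.+2%:R * t * s * (r ^+ 2 * s ^+ 2)); last by ring.
  by rewrite h -[k.+2]addn2 -[k.+1]addn1 !natrD; field; rewrite -natrD pnatr_eq0 addn2.
apply: etrans (integral0y_by_parts (B := d * c) (l := 0) _ _ _ _ dF _ _) _ => //.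
- by move=> r; rewrite exprn_ge0// ltW// inv_hyp_gt0.
- by move=> r; rewrite mulr_ge0// exprn_ge0// ltW// inv_hyp_gt0.
- exact: continuous_inv_hyp_pow.
- by move=> r; apply: cvgM; [exact: cvg_cst|exact: continuous_inv_hyp_pow].
- rewrite /F -[X in _ --> X](mulr0 k.+2%:R^-1); apply: cvgM; first exact: cvg_cst.
  apply: (@squeeze_cvgr _ _ _ _ (cst 0) (fun x => x^-1)); [|exact: cvg_cst|exact: cvgyV].
  near=> r.
  have r1 : 1 <= r by near: r; exact: nbhs_pinfty_ge.
  have r0 : 0 < r by exact: lt_le_trans r1.
  have s0 := inv_hyp_gt0 r; have sr := inv_hyp_le r0.
  have rs := inv_hyp_mul_le r0.
  rewrite mulr_ge0 ?exprn_ge0 ?(ltW r0) ?(ltW s0)//=.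
  have s1 : inv_hyp r <= 1 by rewrite (le_trans sr)// invf_le1.
  apply: le_trans sr; rewrite !exprS mulrA -[leRHS]mul1r ler_pM//.
  + by rewrite mulr_ge0 ?(ltW r0) ?(ltW s0).
  + by rewrite mulr_ge0 ?exprn_ge0 ?(ltW s0).
  + by rewrite ler_piMr ?(ltW s0)// exprn_ile1// ltW.
- apply: integral0yZ hc => //; last exact: continuous_inv_hyp_pow.
  by move=> r _; rewrite exprn_ge0// ltW// inv_hyp_gt0.
- by rewrite addr0 /F mul0r mulr0 subr0.
Unshelve. all: end_near.
Qed.

Lemma integral0y_inv_hyp2 (R : realType) :
  int0y (fun r => @inv_hyp R r ^+ 2) = (pi / 2)%:E.
Proof.
rewrite -[in RHS](subr0 (pi / 2)) -[X in _ - X]atan0.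
apply: integral0y_FTC; last exact: cvgy_atan.
- by move=> r; rewrite exprn_ge0// ltW// inv_hyp_gt0.
- exact: continuous_inv_hyp_pow.
move=> r; apply: is_derive_eq (is_derive1_atan r) _.
have h0 : 1 + r ^+ 2 != 0 by rewrite gt_eqF// ltr_pwDl// sqr_ge0.
by apply: (mulIf h0); rewrite inv_hyp_sqr mulVf.
Qed.

Lemma integral0y_inv_hyp3 (R : realType) :
  int0y (fun r => @inv_hyp R r ^+ 3) = 1%:E.
Proof.
transitivity (1 - (fun r : R => r * inv_hyp r) 0)%:E; last by rewrite mul0r subr0.
apply: (@integral0y_FTC _ _ (fun r => r * inv_hyp r) 1).
- by move=> r; rewrite exprn_ge0// ltW// inv_hyp_gt0.
- exact: continuous_inv_hyp_pow.
- move=> r; apply: is_derive_eq (is_derive_mul (is_derive_id r 1) (is_derive_inv_hyp r)) _.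
  have h := inv_hyp_sqr r; rewrite -[in RHS](mul1r (inv_hyp r ^+ 3)).
  transitivity (inv_hyp r * (inv_hyp r ^+ 2 * (1 + r ^+ 2)) - r ^+ 2 * inv_hyp r ^+ 3); last by ring.
  by rewrite h; ring.
- apply: (@squeeze_cvgr _ _ _ _ (fun r => 1 - r^-1) (cst 1)); [| |exact: cvg_cst].
  + near=> r.
    have r0 : 0 < r by near: r; exact: nbhs_pinfty_gt.
    have s0 := inv_hyp_gt0 r; have sr := inv_hyp_le r0; have h := inv_hyp_sqr r.
    have rs := inv_hyp_mul_le r0.
    rewrite rs andbT.
    have r1 : 1 <= r by near: r; exact: nbhs_pinfty_ge.
    have s1 : inv_hyp r <= 1 by rewrite (le_trans sr)// invf_le1.
    have e2 : (r * inv_hyp r) ^+ 2 = 1 - inv_hyp r ^+ 2 by rewrite -h; ring.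
    have : (r * inv_hyp r) ^+ 2 <= r * inv_hyp r.
      by rewrite expr2 ler_piMl// mulr_ge0// ltW.
    have : inv_hyp r ^+ 2 <= inv_hyp r by rewrite expr2 ler_piMl// ltW.
    rewrite e2; lra.
  + rewrite -[X in _ --> X]subr0; apply: cvgB; first exact: cvg_cst.
    exact: cvgyV.
Unshelve. all: end_near.
Qed.

(** * Gaussian exponential integrals *)

Lemma normal_pdf_expR (R : realType) (m s t : R) : s != 0 ->
  normal_pdf m s t = normal_peak s * expR (- (t - m) ^+ 2 / (s ^+ 2 *+ 2)).
Proof. by move=> s0; rewrite normal_pdfE. Qed.

(** Completing the square: the tilted density is again a normal density, with
standard deviation [inv_hyp r]. *)
Lemma normal_pdf_tilt (R : realType) (r b t : R) :
  expR (b * t - r ^+ 2 * t ^+ 2 / 2) * normal_pdf 0 1 t =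
  inv_hyp r * expR (inv_hyp r ^+ 2 * b ^+ 2 / 2) *
    normal_pdf (inv_hyp r ^+ 2 * b) (inv_hyp r) t.
Proof.
have s0 := inv_hyp_gt0 r; have hs := inv_hyp_sqr r.
rewrite !normal_pdf_expR ?oner_neq0 ?gt_eqF//.
have -> : normal_peak (1 : R) = inv_hyp r * normal_peak (inv_hyp r).
  rewrite /normal_peak expr1n mul1r -mulrnAr sqrtrM ?sqr_ge0//.
  by rewrite sqrtr_sqr gtr0_norm// invfM mulVKf// gt_eqF.
rewrite expr1n subr0 [LHS]mulrCA -expRD [RHS]mulrACA -expRD.
congr (_ * expR _).
have -> : r ^+ 2 = inv_hyp r ^- 2 - 1.
  by apply: (addrI 1); rewrite addrCA subrr addr0; apply: (mulfI (lt0r_neq0 (exprn_gt0 2 s0))); rewrite hs mulfV ?lt0r_neq0 ?exprn_gt0.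
by move: (inv_hyp r) s0 => s s0; field; rewrite gt_eqF.
Qed.

Lemma continuous_quadratic (R : realType) (r b : R) :
  continuous (fun t : R => b * t - r ^+ 2 * t ^+ 2 / 2).
Proof.
move=> t; apply: cvgB; first by apply: cvgM; [exact: cvg_cst|exact: cvg_id].
apply: cvgM; last exact: cvg_cst.
by apply: cvgM; [exact: cvg_cst|exact: exprn_continuous].
Qed.

Lemma integral_stdnormal_exp (R : realType) (r b : R) :
  (\int[stdnormal]_t (expR (b * t - r ^+ 2 * t ^+ 2 / 2))%:E =
   (inv_hyp r * expR (inv_hyp r ^+ 2 * b ^+ 2 / 2))%:E)%E.
Proof.
have s0 := inv_hyp_gt0 r; have hs := inv_hyp_sqr r.
have q0 : 0 < 1 + r ^+ 2 by rewrite ltr_pwDl// sqr_ge0.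
rewrite ge0_integral_normal_prob; last 2 first.
- apply/measurable_EFinP; apply: measurableT_comp => //.
  by apply: continuous_measurable_fun; exact: continuous_quadratic.
- by move=> t; rewrite lee_fin expR_ge0.
pose c := inv_hyp r * expR (inv_hyp r ^+ 2 * b ^+ 2 / 2).
have c0 : 0 <= c by rewrite mulr_ge0 ?expR_ge0 ?ltW.
transitivity (\int[lebesgue_measure]_t (c%:E *
    (normal_pdf (inv_hyp r ^+ 2 * b) (inv_hyp r) t)%:E))%E.
  apply: eq_integral => t _; rewrite -!EFinM; congr _%:E.
  exact: normal_pdf_tilt.
rewrite ge0_integralZl//.
- by rewrite integral_normal_pdf mule1.
- by apply/measurable_EFinP; exact: measurable_normal_pdf.
- by move=> t _; rewrite lee_fin normal_pdf_ge0.
Qed.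

Lemma integral_stdnormal_sqr (R : realType) (r : R) :
  (\int[stdnormal]_t (t ^+ 2 * expR (- (r ^+ 2 * t ^+ 2 / 2)))%:E =
   (inv_hyp r ^+ 3)%:E)%E.
Proof.
have s0 := inv_hyp_gt0 r; have hs := inv_hyp_sqr r.
have q0 : 0 < 1 + r ^+ 2 by rewrite ltr_pwDl// sqr_ge0.
pose a := (1 + r ^+ 2) / 2; have a0 : 0 < a by rewrite divr_gt0.
have ct2 := @continuous_pow_gauss R (r ^+ 2 / 2) 2.
have eqr t : r ^+ 2 * t ^+ 2 / 2 = r ^+ 2 / 2 * t ^+ 2 :> R by field.
under eq_integral do rewrite eqr.
rewrite ge0_integral_normal_prob; last 2 first.
- by apply/measurable_EFinP; apply: continuous_measurable_fun.
- by move=> t; rewrite lee_fin mulr_ge0 ?sqr_ge0 ?expR_ge0.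
pose f (t : R) := normal_peak 1 * (t ^+ (2 * 1) * expR (- (a * t ^+ 2))).
transitivity (\int[lebesgue_measure]_t (f t)%:E)%E.
  apply: eq_integral => t _; rewrite -EFinM normal_pdf_expR ?oner_neq0//.
  rewrite /f expr1n subr0 muln1 mulrCA; congr (_ * _)%:E.
  by rewrite -[LHS]mulrA -expRD; congr (_ * expR _); rewrite /a; field.
have p0 : 0 <= normal_peak (1 : R) := normal_peak_ge0 1.
have cf : continuous f.
  by move=> t; apply: cvgM; [exact: cvg_cst|exact: continuous_pow_gauss].
rewrite ge0_symfun_integralT//; last 2 first.
- by move=> t; rewrite mulr_ge0// even_moment_ge0.
- by move=> t; rewrite /f /= muln1 sqrrN.
rewrite (_ : [set x | _] = `[0, +oo[%classic); last first.
  by apply/seteqP; split => x/=; rewrite in_itv/= andbT.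
under eq_integral do rewrite /f EFinM.
rewrite ge0_integralZl//; last 2 first.
- apply: measurable_funTS; apply/measurable_EFinP.
  by apply: continuous_measurable_fun; exact: continuous_pow_gauss.
- by move=> t _; rewrite lee_fin even_moment_ge0.
rewrite integral0y_moment// big_ord_recl big_ord0 mulr1 -!EFinM; congr _%:E.
have -> : Num.sqrt (pi / a) = inv_hyp r / normal_peak 1.
  rewrite /inv_hyp /normal_peak invrK expr1n mul1r -sqrtrV; last exact: ltW.
  rewrite -sqrtrM ?invr_ge0 ?(ltW q0)//; congr Num.sqrt.
  by rewrite /a; move: pi => p; field; rewrite gt_eqF.
have -> : 2 * a = inv_hyp r ^- 2.
  apply: (mulfI (lt0r_neq0 (exprn_gt0 2 s0))).
  rewrite mulfV ?lt0r_neq0 ?exprn_gt0//; apply: etrans hs; rewrite /a.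
  by field.
have := normal_peak_gt0 (oner_neq0 R); move: (normal_peak 1) (inv_hyp r) s0 => p s s0' p0'.
by rewrite muln0 add0n; field; rewrite !gt_eqF.
Qed.

Lemma dotpC (R : realType) (n : nat) (x y : 'rV[R]_n) : dotp x y = dotp y x.
Proof. by apply: eq_bigr => i _; rewrite mulrC. Qed.

Lemma dotp_ge0 (R : realType) (n : nat) (x : 'rV[R]_n) : 0 <= dotp x x.
Proof. by apply: sumr_ge0 => i _; rewrite -expr2 sqr_ge0. Qed.

Lemma enorm_ge0 (R : realType) (n : nat) (x : 'rV[R]_n) : 0 <= enorm x.
Proof. exact: sqrtr_ge0. Qed.

Lemma enorm_sqr (R : realType) (n : nat) (x : 'rV[R]_n) : enorm x ^+ 2 = dotp x x.
Proof. by rewrite sqr_sqrtr// dotp_ge0. Qed.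

(** The value depends on [b] through [dotp b b] only; the rotational symmetry of the
Gaussian vector comes from here. *)
Lemma integral_gauss_rV_exp (R : realType) (n : nat) (r : R) (b : 'rV[R]_n) :
  (\int[gauss_rV R n]_x (expR (dotp x b - r ^+ 2 * dotp x x / 2))%:E =
   (inv_hyp r ^+ n * expR (inv_hyp r ^+ 2 * dotp b b / 2))%:E)%E.
Proof.
pose h i (t : measurableTypeR R) := expR (b ord0 i * t - r ^+ 2 * t ^+ 2 / 2).
transitivity (\int[gauss_rV R n]_x (\prod_(i < n) h i ((x : 'rV[R]_n) ord0 i))%:E)%E.
  apply: eq_integral => x _; rewrite -expR_sum; congr (expR _)%:E.
  rewrite /dotp mulr_sumr mulr_suml -sumrB; apply: eq_bigr => i _.
  by rewrite mulrC -expr2.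
rewrite (integral_gauss_rV_prod (c := fun i =>
    inv_hyp r * expR (inv_hyp r ^+ 2 * b ord0 i ^+ 2 / 2))).
- rewrite big_split/= prodr_const card_ord -expR_sum; congr (_ * expR _)%:E.
  rewrite /dotp mulr_sumr mulr_suml; apply: eq_bigr => i _; by rewrite -expr2.
- move=> i; apply: measurableT_comp => //.
  by apply: continuous_measurable_fun; exact: continuous_quadratic.
- by move=> i t; rewrite expR_ge0.
- by move=> i; exact: integral_stdnormal_exp.
Qed.

(** Summing over the coordinate that carries the square leaves products of
one-dimensional integrals. *)
Lemma integral_gauss_rV_sqr (R : realType) (n : nat) (r : R) :
  (\int[gauss_rV R n]_x (dotp x x * expR (- (r ^+ 2 * dotp x x / 2)))%:E =
   (n%:R * inv_hyp r ^+ n.+2)%:E)%E.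
Proof.
pose h (j i : 'I_n) (t : measurableTypeR R) :=
  (if i == j then t ^+ 2 else 1) * expR (- (r ^+ 2 * t ^+ 2 / 2)).
have mh j i : measurable_fun setT (h j i).
  apply: measurable_funM; first by case: (i == j).
  apply: measurableT_comp => //.
  rewrite (_ : (fun t => _) = (fun t : R => 0 * t - r ^+ 2 * t ^+ 2 / 2)).
    by apply: continuous_measurable_fun; exact: continuous_quadratic.
  by apply/funext => t; rewrite mul0r sub0r.
have h0 j i t : 0 <= h j i t.
  by rewrite mulr_ge0 ?expR_ge0//; case: ifP => _ //; rewrite sqr_ge0.
transitivity (\int[gauss_rV R n]_x (\sum_(j < n)
    (\prod_(i < n) h j i ((x : 'rV[R]_n) ord0 i))%:E))%E.
  apply: eq_integral => x _; rewrite sumEFin; congr _%:E.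
  rewrite {1}/dotp mulr_suml; apply: eq_bigr => j _.
  rewrite /h big_split/= -(expR_sum _ _ (fun i => - (r ^+ 2 * x ord0 i ^+ 2 / 2))).
  rewrite (bigD1 j)//= eqxx big1 ?mulr1; last by move=> i /negbTE ->.
  rewrite expr2; congr (_ * expR _); rewrite sumrN /dotp mulr_sumr mulr_suml.
  by congr (- _); apply: eq_bigr => i _; rewrite -expr2.
rewrite ge0_integral_sum//; last 2 first.
- by move=> j; apply/measurable_EFinP; exact: measurable_prod_coord.
- by move=> j x _; rewrite lee_fin prodr_ge0.
transitivity (\sum_(j < n) (inv_hyp r ^+ n.+2)%:E)%E; last first.
  by rewrite sumEFin sumr_const card_ord mulr_natl.
apply: eq_bigr => j _.
rewrite (integral_gauss_rV_prod (c := fun i =>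
    inv_hyp r * (if i == j then inv_hyp r ^+ 2 else 1)))//.
  rewrite big_split/= prodr_const card_ord (bigD1 j)//= eqxx big1 ?mulr1; last by move=> i /negbTE ->.
  by rewrite -exprD addn2.
move=> i; rewrite /h; case: ifP => _; first by rewrite -exprS integral_stdnormal_sqr.
have := integral_stdnormal_exp r 0; rewrite expr0n mulr0 mul0r expR0 => <-.
by apply: eq_integral => t _; rewrite mul1r mul0r add0r.
Qed.

Lemma integral_gauss_rV_enorm_lty (R : realType) (n : nat) :
  (\int[gauss_rV R n]_x (enorm (x : 'rV[R]_n))%:E < +oo)%E.
Proof.
have md : measurable_fun setT (fun x : borel_rV R n => dotp (x : 'rV[R]_n) x).
  by apply: measurable_dotp => i; exact: measurable_coord.
have me : measurable_fun setT (fun x : borel_rV R n => enorm (x : 'rV[R]_n)).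
  by apply: measurable_enorm => i; exact: measurable_coord.
apply: (@le_lt_trans _ _ (\int[gauss_rV R n]_x (1%:E + (dotp (x : 'rV[R]_n) x)%:E))%E).
  apply: ge0_le_integral => //.
  - by move=> x _; rewrite lee_fin enorm_ge0.
  - exact/measurable_EFinP.
  - by apply: emeasurable_funD => //; exact/measurable_EFinP.
  - move=> x _; rewrite -EFinD lee_fin -enorm_sqr.
    have := enorm_ge0 (x : 'rV[R]_n); nra.
rewrite ge0_integralD//; last 2 first.
- by move=> x _; rewrite lee_fin dotp_ge0.
- exact/measurable_EFinP.
rewrite integral_cst// mul1e [X in (X + _)%E]probability_setT.
rewrite (_ : (\int[_]_x _)%E = (n%:R * inv_hyp 0 ^+ n.+2)%:E) -?EFinD ?ltry//.
rewrite -integral_gauss_rV_sqr; apply: eq_integral => x _.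
by rewrite expr0n !mul0r oppr0 expR0 mulr1.
Qed.

(** * The Euclidean norm and Lipschitz functions *)

Lemma dotpE (R : realType) (n : nat) (x y : 'rV[R]_n) :
  dotp x y = (x *m y^T) ord0 ord0.
Proof. by rewrite mxE; apply: eq_bigr => i _; rewrite mxE. Qed.

Lemma dotpDl (R : realType) (n : nat) (x y z : 'rV[R]_n) :
  dotp (x + y) z = dotp x z + dotp y z.
Proof. by rewrite !dotpE mulmxDl mxE. Qed.

Lemma dotpZl (R : realType) (n : nat) (a : R) (x z : 'rV[R]_n) :
  dotp (a *: x) z = a * dotp x z.
Proof. by rewrite !dotpE -scalemxAl mxE. Qed.

Lemma dotpNl (R : realType) (n : nat) (x z : 'rV[R]_n) : dotp (- x) z = - dotp x z.
Proof. by rewrite !dotpE mulNmx mxE. Qed.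

Lemma dotp_suml (R : realType) (n : nat) (I : finType) (f : I -> 'rV[R]_n)
    (z : 'rV[R]_n) : dotp (\sum_i f i) z = \sum_i dotp (f i) z.
Proof.
by rewrite dotpE mulmx_suml summxE; apply: eq_bigr => i _; rewrite dotpE.
Qed.

Lemma dotp_mulmx (R : realType) (n m : nat) (A : 'M[R]_(n, m)) x y :
  dotp (x *m A) y = dotp x (y *m A^T).
Proof. by rewrite !dotpE trmx_mul trmxK mulmxA. Qed.

Lemma enormN (R : realType) (n : nat) (x : 'rV[R]_n) : enorm (- x) = enorm x.
Proof. by rewrite /enorm dotpNl dotpC dotpNl opprK. Qed.

Lemma enormZ (R : realType) (n : nat) (a : R) (x : 'rV[R]_n) :
  enorm (a *: x) = `|a| * enorm x.
Proof.
rewrite /enorm dotpZl dotpC dotpZl mulrA -expr2 sqrtrM ?sqr_ge0//.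
by rewrite sqrtr_sqr.
Qed.

Lemma enorm0 (R : realType) (n : nat) : enorm (0 : 'rV[R]_n) = 0.
Proof. by rewrite -(scale0r (0 : 'rV[R]_n)) enormZ normr0 mul0r. Qed.

Lemma enorm_eq0 (R : realType) (n : nat) (x : 'rV[R]_n) : enorm x = 0 -> x = 0.
Proof.
move=> x0; apply/rowP => i; rewrite mxE; apply/eqP.
have : dotp x x == 0 by rewrite -enorm_sqr x0 expr0n.
rewrite psumr_eq0 => [/allP/(_ i)|j _]; last by rewrite -expr2 sqr_ge0.
by rewrite mem_index_enum /= mulf_eq0 orbb => /(_ isT).
Qed.

Lemma dotp_le_enorm (R : realType) (n : nat) (x y : 'rV[R]_n) :
  dotp x y <= enorm x * enorm y.
Proof.
have dotp0 (z : 'rV[R]_n) : dotp 0 z = 0 by rewrite -(scale0r z) dotpZl mul0r.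
have [/enorm_eq0->|x0] := eqVneq (enorm x) 0; first by rewrite dotp0 enorm0 mul0r.
have [/enorm_eq0->|y0] := eqVneq (enorm y) 0; first by rewrite dotpC dotp0 enorm0 mulr0.
have xy0 : 0 < enorm x * enorm y by rewrite mulr_gt0// lt0r enorm_ge0 ?x0 ?y0.
have := dotp_ge0 (enorm y *: x - enorm x *: y).
rewrite dotpDl dotpNl !dotpZl ![dotp _ (_ - _)]dotpC !dotpDl !dotpNl !dotpZl.
rewrite -!enorm_sqr (dotpC y x); nra.
Qed.

Lemma enormD (R : realType) (n : nat) (x y : 'rV[R]_n) :
  enorm (x + y) <= enorm x + enorm y.
Proof.
rewrite -(@ler_pXn2r _ 2)// ?nnegrE ?addr_ge0 ?enorm_ge0//.
rewrite enorm_sqr dotpDl ![dotp _ (_ + _)]dotpC !dotpDl -!enorm_sqr (dotpC y x).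
have := dotp_le_enorm x y; nra.
Qed.

Lemma enorm_lipschitz (R : realType) (n : nat) (x y : 'rV[R]_n) :
  enorm x - enorm y <= enorm (x - y).
Proof. by rewrite lerBlDr -{1}(subrK y x) enormD. Qed.

Lemma enorm_mulmx (R : realType) (n m : nat) (A : 'M[R]_(n, m)) x :
  A *m A^T = 1%:M -> enorm (x *m A) = enorm x.
Proof. by move=> AA; rewrite /enorm dotp_mulmx -mulmxA AA mulmx1. Qed.

(** Lipschitz functions for the Euclidean norm form the class of test functions:
they are continuous, integrable against the Gaussian law, stable under orthogonal
maps, and change little under small Gaussian perturbations of the argument. *)
Definition elipschitz (R : realType) (n : nat) (L : R) (f : 'rV[R]_n -> R) :=
  forall x y, f x - f y <= L * enorm (x - y).

Lemma elipschitz_continuous (R : realType) (n : nat) (L : R) (f : 'rV[R]_n -> R) :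
  0 <= L -> elipschitz L f -> continuous f.
Proof.
move=> L0 fL x; apply/(@cvgrPdist_lt _ R _ _ (nbhs_filter x)) => e e0.
pose d := e / (1 + L * (n.+1)%:R).
have n0 : 0 <= n.+1%:R :> R by [].
have D0 : 0 < 1 + L * n.+1%:R by rewrite ltr_pwDl// mulr_ge0.
have d0 : 0 < d by rewrite divr_gt0.
apply/nbhs_ballP; exists d => //= y [_ xy].
have exy : enorm (x - y) <= d * n.+1%:R.
  have dn0 : 0 <= d * n.+1%:R by apply: mulr_ge0 => //; exact: ltW.
  rewrite -(@ler_pXn2r _ 2)// ?nnegrE ?enorm_ge0//.
  rewrite enorm_sqr exprMn (@le_trans _ _ (d ^+ 2 * n%:R))//.
    rewrite mulr_natr -[leRHS](_ : \sum_(i < n) d ^+ 2 = _); last first.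
      by rewrite sumr_const card_ord.
    apply: ler_sum => i _; rewrite -expr2 -real_normK ?num_real// !mxE.
    by rewrite ler_pXn2r ?nnegrE ?(ltW d0)// ltW//; exact: xy.
  rewrite ler_pM2l ?exprn_gt0// -natrX ler_nat.
  by rewrite (leq_trans (leqnSn n))// leq_pmulr.
have eyx : enorm (y - x) = enorm (x - y) by rewrite -enormN opprB.
have h1 := fL x y; have h2 := fL y x; rewrite eyx in h2.
have : L * enorm (x - y) < e.
  apply: (@le_lt_trans _ _ (L * (d * n.+1%:R))); first by rewrite ler_wpM2l.
  have -> : e = d * (1 + L * n.+1%:R) by rewrite /d divfK// gt_eqF.
  by rewrite mulrCA mulrDr mulr1 ltrDr.
by rewrite ltr_norml => h; apply/andP; split; lra.
Qed.

Lemma elipschitz_measurable (R : realType) (n : nat) (L : R) (f : 'rV[R]_n -> R) :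
  0 <= L -> elipschitz L f -> measurable_fun setT (f : borel_rV R n -> R).
Proof.
by move=> L0 fL; apply: continuous_measurable_rV; exact: elipschitz_continuous fL.
Qed.

Lemma measurable_mulmx_coord (d : measure_display) (T : measurableType d)
    (R : realType) (n m : nat) (O : 'M[R]_(n, m)) (f : T -> 'rV[R]_n) (i : 'I_m) :
  (forall k, measurable_fun setT (fun x => f x ord0 k)) ->
  measurable_fun setT (fun x => (f x *m O) ord0 i).
Proof.
move=> mf; under eq_fun do rewrite mxE.
apply: (@measurable_sum _ _ _ _ _ (index_enum _) (fun k x => f x ord0 k * O k i)) => k.
exact: measurable_funM.
Qed.

(** * Orthogonal invariance of the Gaussian vector *)

Lemma trmx_orthogonal (R : realType) (n : nat) (O : 'M[R]_n) :
  O *m O^T = 1%:M -> O^T *m O = 1%:M.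
Proof. exact: mulmx1C. Qed.

(** Adding a small independent Gaussian vector [z / r] makes the dependence on [O]
explicit: after shifting [z] by [r *: (g *m O)], the variable [g] is integrated
against the exponential of a quadratic form, and [O] enters only through
[O *m O^T].  The right-hand side no longer mentions [O]. *)
Lemma integral_gauss_rV_mollified (R : realType) (n : nat) (O : 'M[R]_n) (r : R)
    (f : 'rV[R]_n -> R) :
  0 < r -> O *m O^T = 1%:M -> (forall x, 0 <= f x) ->
  measurable_fun setT (f : borel_rV R n -> R) ->
  (\int[gauss_rV R n]_g \int[gauss_rV R n]_z
     (f ((g : 'rV[R]_n) *m O + r^-1 *: (z : 'rV[R]_n)))%:E =
   \int[gauss_rV R n]_z (f (r^-1 *: (z : 'rV[R]_n)) *
     (inv_hyp r ^+ n * expR (inv_hyp r ^+ 2 * (r ^+ 2 * dotp z z) / 2)))%:E)%E.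
Proof.
move=> r0 OO f0 mf.
have mF : measurable_fun setT (fun z : borel_rV R n => f (r^-1 *: (z : 'rV[R]_n))).
  apply: (measurableT_comp mf); apply: measurable_fun_rV => i.
  under eq_fun do rewrite mxE.
  by apply: measurable_funM => //; exact: measurable_coord.
pose w (g z : 'rV[R]_n) := expR (dotp z (r *: (g *m O)) -
  dotp (r *: (g *m O)) (r *: (g *m O)) / 2).
pose H (p : borel_rV R n * borel_rV R n) := (f (r^-1 *: (p.2 : 'rV[R]_n)) * w p.1 p.2)%:E.
have mfst k : measurable_fun setT (fun p : borel_rV R n * borel_rV R n =>
    (p.1 : 'rV[R]_n) ord0 k).
  exact: (measurableT_comp (@measurable_coord R n k) measurable_fst).
have msnd k : measurable_fun setT (fun p : borel_rV R n * borel_rV R n =>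
    (p.2 : 'rV[R]_n) ord0 k).
  exact: (measurableT_comp (@measurable_coord R n k) measurable_snd).
have mgO k : measurable_fun setT (fun p : borel_rV R n * borel_rV R n =>
    (r *: ((p.1 : 'rV[R]_n) *m O)) ord0 k).
  under eq_fun do rewrite mxE.
  by apply: measurable_funM => //; exact: measurable_mulmx_coord.
have mH : measurable_fun setT H.
  apply/measurable_EFinP; apply: measurable_funM.
    exact: (measurableT_comp mF measurable_snd).
  apply: measurableT_comp => //; apply: measurable_funB.
    exact: measurable_dotp.
  by apply: measurable_funM => //; exact: measurable_dotp.
have H0 p : (0 <= H p)%E by rewrite lee_fin mulr_ge0 ?f0 ?expR_ge0.
transitivity (\int[gauss_rV R n]_g \int[gauss_rV R n]_z H (g, z))%E.
  apply: eq_integral => g _.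
  transitivity (\int[gauss_rV R n]_z (f (r^-1 *: ((z : 'rV[R]_n) + r *: ((g : 'rV[R]_n) *m O))))%:E)%E.
    apply: eq_integral => z _; rewrite scalerDr scalerA mulVf ?gt_eqF// scale1r.
    by rewrite addrC.
  rewrite (@ge0_integral_gauss_rV_shift _ _ _ (fun z => (f (r^-1 *: (z : 'rV[R]_n)))%:E)).
  - by apply: eq_integral => z _; rewrite -EFinM.
  - exact/measurable_EFinP.
  - by move=> z; rewrite lee_fin.
rewrite fubini_tonelli//; apply: eq_integral => z _.
rewrite EFinM.
transitivity ((f (r^-1 *: (z : 'rV[R]_n)))%:E * \int[gauss_rV R n]_g
    (expR (dotp (g : 'rV[R]_n) (r *: ((z : 'rV[R]_n) *m O^T)) -
           r ^+ 2 * dotp (g : 'rV[R]_n) g / 2))%:E)%E.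
  rewrite -ge0_integralZl ?lee_fin//.
  - apply: eq_integral => g _; rewrite -EFinM; congr (_ * expR _)%:E.
    congr (_ - _).
      by rewrite dotpC [RHS]dotpC !dotpZl dotp_mulmx dotpC.
    rewrite dotpZl dotpC dotpZl mulrA -expr2 dotp_mulmx -mulmxA OO mulmx1.
    by [].
  - apply/measurable_EFinP; apply: measurableT_comp => //; apply: measurable_funB.
      by apply: measurable_dotp => // i; exact: measurable_coord.
    do 2 apply: measurable_funM => //.
    by apply: measurable_dotp => // i; exact: measurable_coord.
rewrite integral_gauss_rV_exp; congr (_ * (_ * expR (_ * _ / 2))%:E)%E.
rewrite dotpZl dotpC dotpZl mulrA -expr2 dotp_mulmx trmxK -mulmxA.
by rewrite trmx_orthogonal// mulmx1.
Qed.

(** The price of the mollification, uniform in the point [x]. *)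
Lemma ge0_integral_gauss_rV_perturb (R : realType) (n : nat) (L r : R)
    (f : 'rV[R]_n -> R) (x : 'rV[R]_n) :
  0 <= L -> 0 < r -> (forall x, 0 <= f x) -> elipschitz L f ->
  ((f x)%:E <= \int[gauss_rV R n]_z (f (x + r^-1 *: (z : 'rV[R]_n)))%:E +
    (L / r)%:E * \int[gauss_rV R n]_z (enorm (z : 'rV[R]_n))%:E)%E /\
  (\int[gauss_rV R n]_z (f (x + r^-1 *: (z : 'rV[R]_n)))%:E <= (f x)%:E +
    (L / r)%:E * \int[gauss_rV R n]_z (enorm (z : 'rV[R]_n))%:E)%E.
Proof.
move=> L0 r0 f0 fL.
have mf := elipschitz_measurable L0 fL.
have mf' : measurable_fun setT (fun z : borel_rV R n => (f (x + r^-1 *: (z : 'rV[R]_n)))%:E).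
  apply/measurable_EFinP; apply: (measurableT_comp mf); apply: measurable_fun_rV => i.
  under eq_fun do rewrite !mxE.
  by apply: measurable_funD => //; apply: measurable_funM => //; exact: measurable_coord.
have me : measurable_fun setT (fun x : borel_rV R n => (enorm (x : 'rV[R]_n))%:E).
  by apply/measurable_EFinP; apply: measurable_enorm => i; exact: measurable_coord.
have Lr0 : 0 <= L / r by rewrite divr_ge0// ltW.
have me2 : measurable_fun setT (fun x : borel_rV R n => ((L / r)%:E * (enorm (x : 'rV[R]_n))%:E)%E).
  by apply: emeasurable_funM.
have e0 (z : borel_rV R n) : setT z -> (0 <= (enorm (z : 'rV[R]_n))%:E)%E.
  by rewrite lee_fin enorm_ge0.
have cst1 (c : R) : (\int[gauss_rV R n]_z c%:E = c%:E)%E.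
  by rewrite integral_cst// [X in (_ * X)%E]probability_setT mule1.
have Lz (z : 'rV[R]_n) : L * enorm (r^-1 *: z) = L / r * enorm z.
  by rewrite enormZ gtr0_norm ?invr_gt0// mulrA.
rewrite -ge0_integralZl ?lee_fin//; split.
- rewrite -ge0_integralD//; last 2 first.
  + by move=> z _; rewrite lee_fin.
  + by move=> z zT; rewrite mule_ge0 ?lee_fin// enorm_ge0.
  rewrite -[leLHS]cst1; apply: ge0_le_integral => //.
  + by move=> z _; rewrite lee_fin.
  + exact: emeasurable_funD.
  + move=> z _; rewrite -EFinM -EFinD lee_fin -lerBlDl -Lz.
    have := fL x (x + r^-1 *: (z : 'rV[R]_n)).
    by rewrite opprD addNKr enormN.
- rewrite -[X in (_ <= X + _)%E]cst1 -ge0_integralD//; last 2 first.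
  + by move=> z _; rewrite lee_fin.
  + by move=> z zT; rewrite mule_ge0 ?lee_fin// enorm_ge0.
  apply: ge0_le_integral => //.
  + by move=> z _; rewrite lee_fin.
  + by apply: emeasurable_funD.
  + move=> z _; rewrite -EFinM -EFinD lee_fin -lerBlDl -Lz.
    have := fL (x + r^-1 *: (z : 'rV[R]_n)) x.
    by rewrite addrAC subrr add0r.
Qed.

(** Mollify, use that the mollified integral is the same for [O] and for the
identity, and let the size of the perturbation tend to 0. *)
Lemma gauss_rV_orthogonal_le (R : realType) (n : nat) (L : R) (O : 'M[R]_n)
    (f : 'rV[R]_n -> R) :
  O *m O^T = 1%:M -> 0 <= L -> (forall x, 0 <= f x) -> elipschitz L f ->
  (\int[gauss_rV R n]_x (f ((x : 'rV[R]_n) *m O))%:E <=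
   \int[gauss_rV R n]_x (f x)%:E)%E.
Proof.
move=> OO L0 f0 fL.
have mf := elipschitz_measurable L0 fL.
have Mlty := integral_gauss_rV_enorm_lty R n.
set M := (\int[_]_x _)%E in Mlty.
have M0 : (0 <= M)%E by apply: integral_ge0 => x _; rewrite lee_fin enorm_ge0.
have {}Mlty : M \is a fin_num by rewrite ge0_fin_numE.
apply/lee_addgt0Pr => e e0.
(* Each of the two perturbations costs [L * M / r]. *)
pose c := 2 * L * fine M.
have c0 : 0 <= c by rewrite !mulr_ge0// fine_ge0.
pose r := (c + 1) / e.
have r0 : 0 < r by rewrite divr_gt0// ltr_wpDl.
have mA (Q : 'M[R]_n) : measurable_fun setT (fun p : borel_rV R n * borel_rV R n =>
    (f ((p.1 : 'rV[R]_n) *m Q + r^-1 *: (p.2 : 'rV[R]_n)))%:E).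
  apply/measurable_EFinP; apply: (measurableT_comp mf); apply: measurable_fun_rV => i.
  under eq_fun do rewrite !mxE.
  apply: measurable_funD.
    apply: (@measurable_sum _ _ _ _ _ (index_enum _)
      (fun k (p : borel_rV R n * borel_rV R n) => (p.1 : 'rV[R]_n) ord0 k * Q k i)) => k.
    apply: measurable_funM => //.
    exact: (measurableT_comp (@measurable_coord R n k) measurable_fst).
  apply: measurable_funM => //.
  exact: (measurableT_comp (@measurable_coord R n i) measurable_snd).
have mB (Q : 'M[R]_n) := @measurable_fun_fubini_tonelli_F _ _ _ _ _ (gauss_rV R n) _
  (mA Q) (fun p => f0 _).
have mfO : measurable_fun setT (fun x : borel_rV R n => (f ((x : 'rV[R]_n) *m O))%:E).
  apply/measurable_EFinP; apply: (measurableT_comp mf); apply: measurable_fun_rV => i.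
  by apply: measurable_mulmx_coord => k; exact: measurable_coord.
pose d := L / r * fine M.
have d0 : 0 <= d.
  by apply: mulr_ge0; [rewrite divr_ge0// (ltW r0)|exact: fine_ge0].
have Md : ((L / r)%:E * M)%E = d%:E by rewrite /d [RHS]EFinM fineK.
have cst1 : (\int[gauss_rV R n]_z d%:E = d%:E)%E.
  by rewrite integral_cst// [X in (_ * X)%E]probability_setT mule1.
have one : (1%:M : 'M[R]_n) *m 1%:M^T = 1%:M by rewrite trmx1 mulmx1.
apply: (@le_trans _ _ (\int[gauss_rV R n]_g \int[gauss_rV R n]_z
     (f ((g : 'rV[R]_n) *m O + r^-1 *: (z : 'rV[R]_n)))%:E + d%:E)%E).
  rewrite -[X in (_ <= _ + X)%E]cst1 -ge0_integralD//; last 2 first.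
  - by move=> g _; apply: integral_ge0 => z _; rewrite lee_fin.
  - exact: mB.
  apply: ge0_le_integral => //.
  - by move=> g _; rewrite lee_fin.
  - by apply: emeasurable_funD => //; exact: mB.
  - move=> g _; rewrite -Md.
    by have [] := ge0_integral_gauss_rV_perturb ((g : 'rV[R]_n) *m O) L0 r0 f0 fL.
rewrite (integral_gauss_rV_mollified r0 OO f0 mf).
rewrite -(integral_gauss_rV_mollified r0 one f0 mf).
apply: (@le_trans _ _ (\int[gauss_rV R n]_g (f (g : 'rV[R]_n))%:E + d%:E + d%:E)%E).
  apply: leeD => //; rewrite -[X in (_ <= _ + X)%E]cst1 -ge0_integralD//; last 2 first.
  - by move=> g _; rewrite lee_fin.
  - exact/measurable_EFinP.
  apply: ge0_le_integral => //.
  - by move=> g _; apply: integral_ge0 => z _; rewrite lee_fin.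
  - exact: mB.
  - by apply: emeasurable_funD => //; exact/measurable_EFinP.
  - move=> g _; rewrite -Md mulmx1.
    by have [] := ge0_integral_gauss_rV_perturb (g : 'rV[R]_n) L0 r0 f0 fL.
rewrite -addeA leeD2l// -EFinD lee_fin /d.
have -> : L / r * fine M + L / r * fine M = c / r by rewrite /c; ring.
rewrite /r invf_div mulrA ler_pdivrMr ?ltr_wpDl//; nra.
Qed.

(** The reverse inequality is the same one for [O^T] and the function [f] composed
with [O]. *)
Lemma gauss_rV_orthogonal (R : realType) (n : nat) (L : R) (O : 'M[R]_n)
    (f : 'rV[R]_n -> R) :
  O *m O^T = 1%:M -> 0 <= L -> (forall x, 0 <= f x) -> elipschitz L f ->
  (\int[gauss_rV R n]_x (f ((x : 'rV[R]_n) *m O))%:E =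
   \int[gauss_rV R n]_x (f x)%:E)%E.
Proof.
move=> OO L0 f0 fL; apply/eqP; rewrite eq_le (gauss_rV_orthogonal_le OO L0 f0 fL)/=.
have OO' : O^T *m O^T^T = 1%:M by rewrite trmxK trmx_orthogonal.
apply: le_trans (gauss_rV_orthogonal_le (f := fun x => f (x *m O)) OO' L0 _ _).
- rewrite le_eqVlt; apply/orP; left; apply/eqP; apply: eq_integral => x _.
  by rewrite -mulmxA trmx_orthogonal// mulmx1.
- by move=> x; exact: f0.
- by move=> x y; rewrite (le_trans (fL _ _))// -mulmxBl enorm_mulmx.
Qed.

(** * Rotations are transitive on spheres *)

(** The reflection in the hyperplane orthogonal to [d]. *)
Definition householder (R : realType) (n : nat) (d : 'rV[R]_n) : 'M[R]_n :=
  1%:M - (2 / dotp d d) *: (d^T *m d).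

Lemma mul_householder (R : realType) (n : nat) (d x : 'rV[R]_n) :
  x *m householder d = x - (2 * dotp x d / dotp d d) *: d.
Proof.
rewrite /householder mulmxBr mulmx1 -scalemxAr mulmxA.
rewrite (_ : x *m d^T = (dotp x d)%:M); last first.
  by rewrite dotpE [LHS]mx11_scalar.
by rewrite mul_scalar_mx scalerA mulrAC.
Qed.

Lemma householder_orthogonal (R : realType) (n : nat) (d : 'rV[R]_n) :
  d != 0 -> householder d *m (householder d)^T = 1%:M.
Proof.
move=> d0; have dd0 : dotp d d != 0.
  apply: contra d0 => /eqP h; apply/eqP/enorm_eq0/eqP.
  by rewrite -sqrf_eq0 enorm_sqr h.
have -> : (householder d)^T = householder d.
  by rewrite /householder linearB linearZ/= trmx_mul trmxK trmx1.
apply/row_matrixP => i; rewrite !rowE mulmxA; move: (delta_mx _ _) => x.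
rewrite !mul_householder mulmx1 dotpDl dotpNl dotpZl divfK//.
rewrite -addrA -opprD -scalerDl [X in X *: d](_ : _ = 0) ?scale0r ?subr0//.
by field.
Qed.

(** Two vectors of the same norm are exchanged by the reflection in the hyperplane
orthogonal to their difference. *)
Lemma exists_orthogonal (R : realType) (n : nat) (a b : 'rV[R]_n) :
  enorm a = enorm b -> exists2 O : 'M[R]_n, O *m O^T = 1%:M & a *m O = b.
Proof.
move=> ab; have [->|nab] := eqVneq a b.
  by exists 1%:M; rewrite ?trmx1 mulmx1.
have d0 : a - b != 0 by rewrite subr_eq0.
exists (householder (a - b)); first exact: householder_orthogonal.
have {}ab : dotp a a = dotp b b by rewrite -!enorm_sqr ab.
have dd0 : dotp (a - b) (a - b) != 0.
  apply: contra d0 => /eqP h; apply/eqP/enorm_eq0/eqP.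
  by rewrite -sqrf_eq0 enorm_sqr h.
rewrite mul_householder (_ : _ / _ = 1) ?scale1r ?opprB ?subrKC//.
rewrite (_ : 2 * dotp a (a - b) = dotp (a - b) (a - b)) ?divff//.
rewrite dotpDl dotpNl ![dotp _ (a - b)]dotpC !dotpDl !dotpNl (dotpC b a) -ab.
by ring.
Qed.

(** In dimension at least 2 there is a direction orthogonal to [b]: transport [b] to
the last coordinate axis and change the sign of the first coordinate.  This
corrects the determinant of an orthogonal map that is not a rotation. *)
Lemma exists_reflection (R : realType) (n : nat) (b : 'rV[R]_n.+2) :
  exists P : 'M[R]_n.+2, [/\ P *m P^T = 1%:M, \det P = -1 & b *m P = b].
Proof.
pose e : 'rV[R]_n.+2 := enorm b *: delta_mx ord0 ord_max.
have eb : enorm b = enorm e.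
  rewrite /e enormZ ger0_norm ?enorm_ge0// {3}/enorm /dotp.
  rewrite (bigD1 ord_max)//= big1 ?addr0.
    by rewrite !mxE !eqxx mulr1 sqrtr1 mulr1.
  by move=> i /negbTE ni; rewrite !mxE ni andbF mulr0.
have [A AA bA] := exists_orthogonal eb.
pose s (i : 'I_n.+2) : R := if i == ord0 then -1 else 1.
pose D : 'M[R]_n.+2 := diag_mx (\row_i s i).
have s2 i : s i * s i = 1 by rewrite /s; case: ifP => _; rewrite ?mulrNN mulr1.
exists (A *m D *m A^T); split.
- rewrite !trmx_mul trmxK !mulmxA -(mulmxA (A *m D)) trmx_orthogonal// mulmx1.
  rewrite -(mulmxA A) (_ : D *m D^T = 1%:M) ?mulmx1//.
  rewrite tr_diag_mx mulmx_diag; apply/matrixP => i j; rewrite !mxE.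
  by case: eqVneq => [->|]; rewrite ?mulr1n ?s2 ?mulr0n.
- rewrite !det_mulmx det_tr det_diag mulrAC -expr2.
  have : \det A ^+ 2 = 1 by rewrite expr2 -{2}det_tr -det_mulmx AA det1.
  move=> ->; rewrite mul1r big_ord_recl mxE /s eqxx big1 ?mulr1// => i _.
  by rewrite mxE.
- rewrite !mulmxA bA (_ : e *m D = e); first by rewrite -bA -mulmxA AA mulmx1.
  rewrite /e -scalemxAl; congr (_ *: _); apply/rowP => j.
  rewrite mul_mx_diag !mxE /s; case: (eqVneq j ord0) => [->|_]; last by rewrite mulr1.
  by rewrite mul0r.
Qed.

Lemma exists_rotation (R : realType) (n : nat) (a b : 'rV[R]_n) :
  (1 < n)%N -> enorm a = enorm b ->
  exists2 Q : 'M[R]_n, rotation_mx Q & a *m Q = b.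
Proof.
case: n a b => [|[|n]]// a b _ ab.
have [H HH aH] := exists_orthogonal ab.
have [dH|dH] := eqVneq (\det H) 1; first by exists H.
have [P [PP dP bP]] := exists_reflection b.
exists (H *m P); last by rewrite mulmxA aH bP.
split; first by rewrite trmx_mul mulmxA -(mulmxA H) PP mulmx1.
have : \det H ^+ 2 == 1 by rewrite expr2 -{2}det_tr -det_mulmx HH det1.
rewrite sqrf_eq1 (negbTE dH)/= => /eqP dH1.
by rewrite det_mulmx dH1 dP mulrNN mulr1.
Qed.

(** * Spherical averages through Gaussian integrals *)

(** A Lipschitz bump on pairs [(u, x)], positive only where the direction of [x] is
within [e] of the unit vector [u].  It is homogeneous in [x] and invariant under
simultaneous rotations of [u] and [x]. *)
Definition cone_kernel (R : realType) (n : nat) (e : R) (u x : 'rV[R]_n) : R :=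
  Num.max 0 (e * enorm x - enorm (x - enorm x *: u)).

Lemma cone_kernel_ge0 (R : realType) (n : nat) (e : R) (u x : 'rV[R]_n) :
  0 <= cone_kernel e u x.
Proof. by rewrite le_max lexx. Qed.

Lemma cone_kernel_le (R : realType) (n : nat) (e : R) (u x : 'rV[R]_n) :
  0 <= e -> cone_kernel e u x <= e * enorm x.
Proof.
by move=> e0; rewrite ge_max mulr_ge0 ?enorm_ge0//= gerBl enorm_ge0.
Qed.

Lemma cone_kernel_mulmx (R : realType) (n : nat) (e : R) (Q : 'M[R]_n) (u x : 'rV[R]_n) :
  Q *m Q^T = 1%:M -> cone_kernel e (u *m Q) (x *m Q) = cone_kernel e u x.
Proof.
by move=> QQ; rewrite /cone_kernel enorm_mulmx// scalemxAl -mulmxBl enorm_mulmx.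
Qed.

Lemma cone_kernelZ (R : realType) (n : nat) (e a : R) (u x : 'rV[R]_n) :
  0 <= a -> cone_kernel e u (a *: x) = a * cone_kernel e u x.
Proof.
move=> a0; rewrite /cone_kernel enormZ ger0_norm// -scalerA -scalerBr enormZ.
by rewrite ger0_norm// mulrCA -mulrBr maxr_pMr// mulr0.
Qed.

Lemma cone_kernel_lipschitz (R : realType) (n : nat) (e : R) (u : 'rV[R]_n) :
  0 <= e -> enorm u = 1 -> elipschitz (e + 2) (cone_kernel e u).
Proof.
move=> e0 u1 x y; rewrite lerBlDr ge_max addr_ge0 ?cone_kernel_ge0 ?mulr_ge0 ?enorm_ge0 ?addr_ge0//=.
have h : e * enorm y - enorm (y - enorm y *: u) <= cone_kernel e u y.
  by rewrite le_max lexx orbT.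
apply: le_trans (lerD (lexx _) h).
have h1 := enorm_lipschitz x y.
have h2 := enorm_lipschitz y x.
have h3 := enorm_lipschitz (y - enorm y *: u) (x - enorm x *: u).
have h4 : enorm (y - enorm y *: u - (x - enorm x *: u)) <=
    enorm (x - y) + `|enorm x - enorm y|.
  have -> : y - enorm y *: u - (x - enorm x *: u) = - (x - y) + (enorm x - enorm y) *: u.
    by apply/rowP => i; rewrite !mxE; ring.
  by apply: le_trans (enormD _ _) _; rewrite enormN enormZ u1 mulr1.
have h5 : `|enorm x - enorm y| <= enorm (x - y).
  by rewrite ler_norml h1 andbT lerNl opprB -[enorm (x - y)]enormN opprB.
have h6 : e * (enorm x - enorm y) <= e * enorm (x - y) by rewrite ler_wpM2l.
lra.
Qed.

(** Where the kernel does not vanish, [x] is within [e * enorm x] of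
[enorm x *: u]. *)
Lemma cone_kernel_close (R : realType) (n : nat) (e L : R) (f : 'rV[R]_n -> R)
    (u x : 'rV[R]_n) :
  0 <= L -> elipschitz L f -> (forall a x, 0 <= a -> f (a *: x) = a * f x) ->
  f x * cone_kernel e u x <= enorm x * (f u + L * e) * cone_kernel e u x /\
  enorm x * f u * cone_kernel e u x <= (f x + L * e * enorm x) * cone_kernel e u x.
Proof.
move=> L0 fL fZ; rewrite /cone_kernel.
have [h|h] := leP (e * enorm x - enorm (x - enorm x *: u)) 0.
  by rewrite !mulr0.
have h1 := fL x (enorm x *: u); have h2 := fL (enorm x *: u) x.
rewrite -[enorm (_ - x)]enormN opprB in h2.
rewrite !fZ ?enorm_ge0// in h1 h2.
have h3 : L * enorm (x - enorm x *: u) <= L * (e * enorm x).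
  by rewrite ler_wpM2l// -subr_ge0 ltW.
by split; rewrite ler_pM2r//; lra.
Qed.

Lemma measurable_cone_kernel (d : measure_display) (T : measurableType d)
    (R : realType) (n : nat) (e : R) (f g : T -> 'rV[R]_n) :
  (forall i, measurable_fun setT (fun t => f t ord0 i)) ->
  (forall i, measurable_fun setT (fun t => g t ord0 i)) ->
  measurable_fun setT (fun t => cone_kernel e (f t) (g t)).
Proof.
move=> mf mg; apply: measurable_maxr => //; apply: measurable_funB.
  by apply: measurable_funM => //; exact: measurable_enorm.
apply: measurable_enorm => i; under eq_fun do rewrite !mxE.
apply: measurable_funB => //; apply: measurable_funM => //.
exact: measurable_enorm.
Qed.

Lemma ge0_integral_rotation (R : realType) (n : nat)
    (sigma : probability (borel_rV R n) R) (Q : 'M[R]_n) (g : 'rV[R]_n -> \bar R) :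
  rotation_invariant_sphere_probability sigma -> rotation_mx Q ->
  measurable_fun setT (g : borel_rV R n -> \bar R) -> (forall u, 0 <= g u)%E ->
  (\int[sigma]_u g ((u : 'rV[R]_n) *m Q) = \int[sigma]_u g u)%E.
Proof.
move=> [_ inv] rQ mg g0.
have mQ : measurable_fun setT ((fun u => (u : 'rV[R]_n) *m Q) : borel_rV R n -> borel_rV R n).
  apply: measurable_fun_rV => i.
  by apply: measurable_mulmx_coord => k; exact: measurable_coord.
have := @ge0_integral_pushforward _ _ _ _ R _ mQ sigma setT g measurableT mg.
rewrite preimage_setT => <-; last by move=> u _.
by apply: eq_measure_integral => A mA _; exact: inv.
Qed.

Lemma measurable_usphere (R : realType) (n : nat) :
  measurable (@usphere R n : set (borel_rV R n)).
Proof.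
have me : measurable_fun setT (fun u : borel_rV R n => enorm (u : 'rV[R]_n)).
  by apply: measurable_enorm => i; exact: measurable_coord.
rewrite (_ : @usphere R n = (fun u : borel_rV R n => enorm (u : 'rV[R]_n)) @^-1` [set 1]).
  by rewrite -[X in measurable X]setTI; exact: me.
by apply/seteqP; split.
Qed.

(** If the integral were 0, the kernel would vanish almost everywhere; by the
Cameron-Martin formula the integral of its translate by [a *: u] would vanish
too.  But the kernel is [a * e] at [a *: u] and Lipschitz, so this integral is at
least [a * e] minus a constant, which is positive for large [a]. *)
Lemma integral_cone_kernel_neq0 (R : realType) (n : nat) (e : R) (u : 'rV[R]_n) :
  0 < e -> enorm u = 1 -> (\int[gauss_rV R n]_x (cone_kernel e u x)%:E != 0)%E.
Proof.
move=> e0 u1; apply/eqP => I0.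
have mK : measurable_fun setT (fun x : borel_rV R n => (cone_kernel e u x)%:E).
  apply/measurable_EFinP; apply: measurable_cone_kernel => // i.
  exact: measurable_coord.
have K0 x : (0 <= (cone_kernel e u x)%:E)%E by rewrite lee_fin cone_kernel_ge0.
have ae0 : ae_eq (gauss_rV R n) setT (fun x : borel_rV R n => (cone_kernel e u x)%:E) (cst 0%E).
  apply/ae_eq_integral_abs => //.
  by under eq_integral do rewrite gee0_abs//.
pose L := e + 2; have L0 : 0 <= L by rewrite addr_ge0// ltW.
have Mlty := integral_gauss_rV_enorm_lty R n.
have me : measurable_fun setT (fun x : borel_rV R n => (enorm (x : 'rV[R]_n))%:E).
  by apply/measurable_EFinP; apply: measurable_enorm => i; exact: measurable_coord.
set M := (\int[_]_x _)%E in Mlty.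
have M0 : (0 <= M)%E by apply: integral_ge0 => x _; rewrite lee_fin enorm_ge0.
have Mfin : M \is a fin_num by rewrite ge0_fin_numE.
pose a := (L * fine M + 1) / e.
have a0 : 0 < a by rewrite divr_gt0// ltr_wpDl// mulr_ge0// fine_ge0.
have shift0 : (\int[gauss_rV R n]_x (cone_kernel e u ((x : 'rV[R]_n) + a *: u))%:E = 0)%E.
  rewrite (@ge0_integral_gauss_rV_shift _ _ _ (fun x => (cone_kernel e u x)%:E))//.
  rewrite (ae_eq_integral (cst 0%E))//.
  - by rewrite integral0.
  - apply: emeasurable_funM => //; apply/measurable_EFinP; apply: measurableT_comp => //.
    apply: measurable_funB => //.
    by apply: measurable_dotp => // i; exact: measurable_coord.
  - by apply: filterS ae0 => x /= h /h ->; rewrite mul0e.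
have : ((a * e)%:E <= \int[gauss_rV R n]_x ((cone_kernel e u ((x : 'rV[R]_n) + a *: u))%:E +
    L%:E * (enorm (x : 'rV[R]_n))%:E))%E.
  rewrite -[leLHS](_ : (\int[gauss_rV R n]_x (a * e)%:E = _)%E); last first.
    by rewrite integral_cst// [X in (_ * X)%E]probability_setT mule1.
  have mKs : measurable_fun setT (fun x : borel_rV R n => (cone_kernel e u ((x : 'rV[R]_n) + a *: u))%:E).
    exact: (measurableT_comp mK (measurable_addrV (a *: u))).
  apply: ge0_le_integral => //.
  - by move=> x _; rewrite lee_fin mulr_ge0// ltW.
  - by apply: emeasurable_funD => //; exact: emeasurable_funM.
  - move=> x _; rewrite -EFinM -EFinD lee_fin.
    have h := cone_kernel_lipschitz (ltW e0) u1 (a *: u) ((x : 'rV[R]_n) + a *: u).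
    have sx : a *: u - ((x : 'rV[R]_n) + a *: u) = - (x : 'rV[R]_n).
      by rewrite opprD addrCA subrr addr0.
    rewrite sx enormN in h.
    have k : cone_kernel e u (a *: u) = a * e.
      rewrite cone_kernelZ ?ltW// /cone_kernel u1 scale1r subrr enorm0 mulr1 subr0.
      by rewrite max_r// ltW.
    by rewrite k in h; rewrite -lerBlDl.
have mKs : measurable_fun setT (fun x : borel_rV R n => (cone_kernel e u ((x : 'rV[R]_n) + a *: u))%:E).
  exact: (measurableT_comp mK (measurable_addrV (a *: u))).
rewrite ge0_integralD//; last 2 first.
- by move=> x _; rewrite mule_ge0// lee_fin// enorm_ge0.
- exact: emeasurable_funM.
rewrite shift0 add0e ge0_integralZl ?lee_fin//; last first.
  by move=> x _; rewrite lee_fin enorm_ge0.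
rewrite -/M -(fineK Mfin) -EFinM lee_fin /a divfK ?gt_eqF//.
by rewrite gerDl ler10.
Qed.

Lemma ge0_integral_le_fin (d : measure_display) (T : measurableType d) (R : realType)
    (mu : {measure set T -> \bar R}) (c : R) (f g : T -> R) :
  0 <= c -> (forall x, 0 <= f x) -> (forall x, 0 <= g x) ->
  (forall x, f x <= c * g x) -> measurable_fun setT f -> measurable_fun setT g ->
  (\int[mu]_x (g x)%:E < +oo)%E -> (\int[mu]_x (f x)%:E)%E \is a fin_num.
Proof.
move=> c0 f0 g0 fg mf mg glty.
have gI : (0 <= \int[mu]_x (g x)%:E)%E by apply: integral_ge0 => x _; rewrite lee_fin.
rewrite ge0_fin_numE; last by apply: integral_ge0 => x _; rewrite lee_fin.
apply: (@le_lt_trans _ _ (c%:E * \int[mu]_x (g x)%:E)%E); last by rewrite lte_mul_pinfty.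
have mgE : measurable_fun setT (EFin \o g) by exact/measurable_EFinP.
rewrite -ge0_integralZl ?lee_fin//; last by move=> x _; rewrite lee_fin.
apply: ge0_le_integral => //.
- by move=> x _; rewrite lee_fin.
- exact/measurable_EFinP.
- exact: emeasurable_funM.
- by move=> x _; rewrite -EFinM lee_fin.
Qed.

(** The polar decomposition of the Gaussian vector.  Both sides are compared by
integrating the cone kernel in two ways: over [u] it gives a constant times
[enorm x], by rotation invariance of [sigma], and over [x] a constant, by
orthogonal invariance of the Gaussian law.  Inserting [f] and using that [f x]
and [enorm x * f u] differ by at most [L * e * enorm x] on the support of the
kernel proves the identity up to [e]. *)
Lemma sphere_average (R : realType) (n : nat) (L : R)
    (sigma : probability (borel_rV R n) R) (f : 'rV[R]_n -> R) :
  (1 < n)%N -> rotation_invariant_sphere_probability sigma ->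
  0 <= L -> (forall x, 0 <= f x) -> elipschitz L f ->
  (forall a x, 0 <= a -> f (a *: x) = a * f x) ->
  (\int[gauss_rV R n]_x (f x)%:E =
   \int[gauss_rV R n]_x (enorm (x : 'rV[R]_n))%:E *
   \int[sigma]_(u in @usphere R n) (f u)%:E)%E.
Proof.
move=> n1 sinv L0 f0 fL fZ; have [sS _] := sinv.
have f00 : f 0 = 0 by rewrite -(scale0r 0) fZ// mul0r.
have f_le x : f x <= L * enorm x by have := fL x 0; rewrite f00 !subr0.
pose gam := gauss_rV R n.
have mf := elipschitz_measurable L0 fL.
have me : measurable_fun setT (fun x : borel_rV R n => enorm (x : 'rV[R]_n)).
  by apply: measurable_enorm => i; exact: measurable_coord.
have mS : measurable (@usphere R n : set (borel_rV R n)) by exact: measurable_usphere.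
pose chi (u : borel_rV R n) : R := \1_(@usphere R n : set (borel_rV R n)) u.
have mchi : measurable_fun setT chi by exact: measurable_indic.
have chi0 u : 0 <= chi u by rewrite /chi indicE.
have chi1 u : enorm (u : 'rV[R]_n) = 1 -> chi u = 1.
  by move=> u1; rewrite /chi indicE mem_set.
have chiN u : enorm (u : 'rV[R]_n) <> 1 -> chi u = 0.
  by move=> u1; rewrite /chi indicE memNset.
have Ichi : (\int[sigma]_u (chi u)%:E = 1)%E by rewrite integral_indic// setIT.
(* The expected norm [M], the integral [F] of [f] and its spherical average [A] are
   finite, so that the rest is an inequality between real numbers. *)
have Mlty := integral_gauss_rV_enorm_lty R n.
set M := (\int[_]_x (enorm _)%:E)%E in Mlty *.
have M0 : (0 <= M)%E by apply: integral_ge0 => x _; rewrite lee_fin enorm_ge0.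
have Mfin : M \is a fin_num by rewrite ge0_fin_numE.
set F := (\int[gauss_rV R n]_x (f x)%:E)%E.
have F0 : (0 <= F)%E by apply: integral_ge0 => x _; rewrite lee_fin.
have Ffin : F \is a fin_num.
  by apply: (@ge0_integral_le_fin _ (borel_rV R n) R gam L f (@enorm R n)) => // x; exact: enorm_ge0.
have -> : (\int[sigma]_(u in @usphere R n) (f u)%:E =
    \int[sigma]_u (f u * chi u)%:E)%E.
  rewrite [LHS]integral_mkcond; apply: eq_integral => u _.
  by rewrite patchE /chi indicE; case: ifPn => _; rewrite ?mulr1 ?mulr0.
set A := (\int[sigma]_u (f u * chi u)%:E)%E.
have mfchi : measurable_fun setT (fun u : borel_rV R n => (f u * chi u)%:E).
  by apply/measurable_EFinP; exact: measurable_funM.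
have A0 : (0 <= A)%E by apply: integral_ge0 => u _; rewrite lee_fin mulr_ge0.
have Afin : A \is a fin_num.
  apply: (ge0_integral_le_fin L0 _ chi0 _ _ mchi); last by rewrite Ichi ltry.
  - by move=> u; rewrite mulr_ge0.
  - move=> u; have [u1|u1] := pselect (enorm (u : 'rV[R]_n) = 1); last by rewrite chiN// !mulr0.
    by rewrite ler_wpM2r// -[L]mulr1 -u1.
  - exact: measurable_funM.
(* It suffices to prove the identity up to errors linear in [e]. *)
suff key e : 0 < e -> fine F <= fine M * (fine A + L * e) /\
    fine M * fine A <= fine F + L * e * fine M.
  rewrite -(fineK Ffin) -(fineK Mfin) -(fineK Afin) -EFinM; congr _%:E.
  have M0' : 0 <= fine M by rewrite fine_ge0.
  apply/eqP; rewrite eq_le; apply/andP; split; apply/ler_addgt0Pr => e e0.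
    pose d := e / (L * fine M + 1).
    have D0 : 0 < L * fine M + 1 by rewrite ltr_wpDl// mulr_ge0.
    have d0 : 0 < d by rewrite divr_gt0.
    have dE : d * (L * fine M + 1) = e by rewrite divfK// gt_eqF.
    have [h _] := key _ d0; nra.
  pose d := e / (L * fine M + 1).
  have D0 : 0 < L * fine M + 1 by rewrite ltr_wpDl// mulr_ge0.
  have d0 : 0 < d by rewrite divr_gt0.
  have dE : d * (L * fine M + 1) = e by rewrite divfK// gt_eqF.
  have [_ h] := key _ d0; nra.
move=> e0; have e0' := ltW e0.
pose k (p : borel_rV R n * borel_rV R n) := cone_kernel e p.1 p.2 * chi p.1.
have k0 p : 0 <= k p by rewrite mulr_ge0 ?cone_kernel_ge0.
have mfst : measurable_fun setT (fst : borel_rV R n * borel_rV R n -> _).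
  exact: measurable_fst.
have msnd : measurable_fun setT (snd : borel_rV R n * borel_rV R n -> _).
  exact: measurable_snd.
have mk : measurable_fun setT k.
  apply: measurable_funM; last exact: (measurableT_comp mchi mfst).
  apply: measurable_cone_kernel => i.
    exact: (measurableT_comp (@measurable_coord R n i) mfst).
  exact: (measurableT_comp (@measurable_coord R n i) msnd).
have mk1 x : measurable_fun setT (fun u => k (u, x)).
  exact: (measurableT_comp mk (measurable_pair2 x)).
have mk2 u : measurable_fun setT (fun x => k (u, x)).
  exact: (measurableT_comp mk (measurable_pair1 u)).
(* Any unit vector serves as the reference direction. *)
pose x0 : 'rV[R]_n := delta_mx ord0 (Ordinal (ltnW n1)).
have x01 : enorm x0 = 1.
  rewrite /enorm /dotp (bigD1 (Ordinal (ltnW n1)))//= big1 ?addr0.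
    by rewrite !mxE !eqxx mulr1 sqrtr1.
  by move=> i /negbTE ni; rewrite !mxE ni andbF mulr0.
have kS u : chi u * enorm u = chi u.
  have [u1|u1] := pselect (enorm (u : 'rV[R]_n) = 1); first by rewrite u1 mulr1.
  by rewrite chiN// mul0r.
pose kap := fine (\int[sigma]_u (k (u, x0))%:E)%E.
have kapfin : (\int[sigma]_u (k (u, x0))%:E)%E \is a fin_num.
  apply: (ge0_integral_le_fin e0' _ chi0 _ (mk1 x0) mchi) => [u|u|]; rewrite ?Ichi ?ltry//.
  by rewrite ler_wpM2r// (le_trans (cone_kernel_le _ _ e0'))// x01 mulr1.
have kap0 : 0 <= kap.
  by rewrite fine_ge0//; apply: integral_ge0 => u _; rewrite lee_fin.
(* Rotate [x] to a multiple of the reference vector [x0]. *)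
have Iu x : (\int[sigma]_u (k (u, x))%:E = (kap * enorm (x : 'rV[R]_n))%:E)%E.
  have xx : enorm (x : 'rV[R]_n) = enorm (enorm (x : 'rV[R]_n) *: x0).
    by rewrite enormZ x01 mulr1 ger0_norm ?enorm_ge0.
  have [Q rQ xQ] := exists_rotation n1 xx; have [QQ _] := rQ.
  transitivity (\int[sigma]_u (k ((u : 'rV[R]_n) *m Q, enorm (x : 'rV[R]_n) *: x0))%:E)%E.
    apply: eq_integral => u _; rewrite -xQ /k/= cone_kernel_mulmx//.
    have [u1|u1] := pselect (enorm (u : 'rV[R]_n) = 1).
      by rewrite !chi1// enorm_mulmx.
    by rewrite !chiN// enorm_mulmx.
  rewrite (ge0_integral_rotation (g := fun u => (k (u, enorm (x : 'rV[R]_n) *: x0))%:E) sinv rQ); last 2 first.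
  - exact/measurable_EFinP.
  - by move=> u; rewrite lee_fin.
  rewrite EFinM fineK// muleC -ge0_integralZl ?lee_fin ?enorm_ge0//; last 2 first.
  - exact/measurable_EFinP.
  - by move=> u _; rewrite lee_fin.
  apply: eq_integral => u _; rewrite -EFinM /k/= cone_kernelZ ?enorm_ge0//.
  by rewrite mulrA.
pose c := fine (\int[gauss_rV R n]_x (cone_kernel e x0 (x : 'rV[R]_n))%:E)%E.
have mck (u : 'rV[R]_n) : measurable_fun setT (fun x : borel_rV R n => (cone_kernel e u (x : 'rV[R]_n))%:E).
  apply/measurable_EFinP; apply: measurable_cone_kernel => // i.
  exact: measurable_coord.
have cfin : (\int[gauss_rV R n]_x (cone_kernel e x0 (x : 'rV[R]_n))%:E)%E \is a fin_num.
  apply: (@ge0_integral_le_fin _ (borel_rV R n) R gam e (cone_kernel e x0) (@enorm R n)) => // [x|x|x|].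
  - exact: cone_kernel_ge0.
  - exact: enorm_ge0.
  - exact: cone_kernel_le.
  - by apply/measurable_EFinP; exact: mck.
have c0 : c != 0 by have := integral_cone_kernel_neq0 e0 x01; rewrite -(fineK cfin) eqe.
have cge0 : 0 <= c.
  by rewrite fine_ge0//; apply: integral_ge0 => x _; rewrite lee_fin cone_kernel_ge0.
(* Rotate [u] to the reference vector [x0]. *)
have Ix u : (\int[gauss_rV R n]_x (k (u, x))%:E = (c * chi u)%:E)%E.
  have [u1|u1] := pselect (enorm (u : 'rV[R]_n) = 1); last first.
    rewrite chiN// mulr0 -[RHS](integral0 (gauss_rV R n) setT).
    by apply: eq_integral => x _; rewrite /k/= chiN// mulr0.
  have ux0 : enorm (u : 'rV[R]_n) = enorm x0 by rewrite x01.
  have [Q QQ uQ] := exists_orthogonal ux0.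
  rewrite chi1// mulr1 fineK//.
  rewrite -(gauss_rV_orthogonal (f := cone_kernel e x0) (L := e + 2) QQ)//.
  - apply: eq_integral => x _; rewrite -uQ cone_kernel_mulmx// /k/=.
    by rewrite chi1// mulr1.
  - by rewrite addr_ge0.
  - by move=> x; rewrite cone_kernel_ge0.
  - exact: cone_kernel_lipschitz.
have swap (h : borel_rV R n * borel_rV R n -> R) : measurable_fun setT h ->
    (forall p, 0 <= h p) ->
    (\int[gauss_rV R n]_x \int[sigma]_u (h (u, x))%:E =
     \int[sigma]_u \int[gauss_rV R n]_x (h (u, x))%:E)%E.
  move=> mh h0; apply/esym.
  apply: (@fubini_tonelli _ _ _ _ _ sigma (gauss_rV R n) (EFin \o h)).
    exact/measurable_EFinP.
  by move=> p; rewrite lee_fin.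
(* The total mass of the kernel, computed in both orders. *)
have cE : c = kap * fine M.
  apply: EFin_inj; rewrite EFinM [(fine M)%:E]fineK// /M -ge0_integralZl ?lee_fin//; last 2 first.
  - exact/measurable_EFinP.
  - by move=> x _; rewrite lee_fin enorm_ge0.
  transitivity (\int[gauss_rV R n]_x \int[sigma]_u (k (u, x))%:E)%E; last first.
    by apply: eq_integral => x _; rewrite Iu.
  rewrite swap// -[LHS]mule1 -Ichi -ge0_integralZl ?lee_fin//.
  - by apply: eq_integral => u _; rewrite Ix.
  - exact/measurable_EFinP.
  - by move=> u _; rewrite lee_fin.
have kc0 : 0 < kap.
  by rewrite lt0r kap0 andbT; apply: contra c0 => /eqP; rewrite cE => ->; rewrite mul0r.
(* Dividing by [enorm x] compensates the factor that the integral over [u]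
   produces. *)
pose g (p : borel_rV R n * borel_rV R n) := f p.2 * (k p / enorm (p.2 : 'rV[R]_n)).
have g0 p : 0 <= g p by rewrite mulr_ge0// mulr_ge0// invr_ge0 enorm_ge0.
have men2 : measurable_fun setT (fun p : borel_rV R n * borel_rV R n => enorm (p.2 : 'rV[R]_n)).
  exact: (measurableT_comp me msnd).
have mg : measurable_fun setT g.
  apply: measurable_funM; first exact: (measurableT_comp mf msnd).
  apply: measurable_funM => //.
  under eq_fun do rewrite -powR_inv1 ?enorm_ge0//.
  exact: (measurableT_comp (measurable_powR _) men2).
have Ig : (\int[gauss_rV R n]_x \int[sigma]_u (g (u, x))%:E = (kap * fine F)%:E)%E.
  rewrite EFinM [(fine F)%:E]fineK// /F -ge0_integralZl ?lee_fin//; last 2 first.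
  - exact/measurable_EFinP.
  - by move=> x _; rewrite lee_fin.
  apply: eq_integral => x _; rewrite /g/=.
  transitivity ((f x / enorm (x : 'rV[R]_n))%:E * \int[sigma]_u (k (u, x))%:E)%E.
    rewrite -ge0_integralZl ?lee_fin ?divr_ge0 ?enorm_ge0//.
    - by apply: eq_integral => u _; rewrite -EFinM mulrA mulrAC.
    - exact/measurable_EFinP.
    - by move=> u _; rewrite lee_fin.
  rewrite Iu -!EFinM; congr _%:E.
  have [/enorm_eq0 ->|nx0] := eqVneq (enorm (x : 'rV[R]_n)) 0.
    by rewrite f00 mul0r !mulr0 mul0r.
  by rewrite mulrCA divfK.
have Ifk : (\int[sigma]_u \int[gauss_rV R n]_x (f u * k (u, x))%:E = (c * fine A)%:E)%E.
  rewrite EFinM [(fine A)%:E]fineK// /A -ge0_integralZl ?lee_fin//; last first.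
    by move=> u _; rewrite lee_fin mulr_ge0.
  apply: eq_integral => u _; under eq_integral do rewrite EFinM.
  rewrite ge0_integralZl ?lee_fin//; last 2 first.
  - exact/measurable_EFinP.
  - by move=> x _; rewrite lee_fin.
  by rewrite Ix -!EFinM mulrCA.
have Ik : (\int[sigma]_u \int[gauss_rV R n]_x (L * e * k (u, x))%:E = (L * e * c)%:E)%E.
  rewrite -[RHS]mule1 -Ichi -ge0_integralZl ?lee_fin ?mulr_ge0//; last 2 first.
  - exact/measurable_EFinP.
  - by move=> u _; rewrite lee_fin.
  apply: eq_integral => u _; under eq_integral do rewrite EFinM.
  rewrite ge0_integralZl ?lee_fin ?mulr_ge0//; last 2 first.
  - exact/measurable_EFinP.
  - by move=> x _; rewrite lee_fin.
  by rewrite Ix -!EFinM mulrA.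
have mfk : measurable_fun setT (fun p : borel_rV R n * borel_rV R n => f p.1 * k p).
  by apply: measurable_funM => //; exact: (measurableT_comp mf mfst).
have mek : measurable_fun setT (fun p : borel_rV R n * borel_rV R n => L * e * k p).
  exact: measurable_funM.
have meg : measurable_fun setT (fun p : borel_rV R n * borel_rV R n => (f p.1 + L * e) * k p).
  by apply: measurable_funM => //; apply: measurable_funD => //; exact: (measurableT_comp mf mfst).
have le2 (h1 h2 : borel_rV R n * borel_rV R n -> R) :
    measurable_fun setT h1 -> measurable_fun setT h2 ->
    (forall p, 0 <= h1 p <= h2 p) ->
    (\int[sigma]_u \int[gauss_rV R n]_x (h1 (u, x))%:E <=
     \int[sigma]_u \int[gauss_rV R n]_x (h2 (u, x))%:E)%E.
  move=> m1 m2 h12; have h1_0 p : 0 <= h1 p by have /andP[] := h12 p.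
  have h2_0 p : 0 <= h2 p by have /andP[/le_trans] := h12 p; exact.
  apply: ge0_le_integral => //.
  - by move=> u _; apply: integral_ge0 => x _; rewrite lee_fin.
  - apply: (@measurable_fun_fubini_tonelli_F _ _ _ _ _ (gauss_rV R n) (EFin \o h1)).
      exact/measurable_EFinP.
    by move=> p; rewrite lee_fin.
  - apply: (@measurable_fun_fubini_tonelli_F _ _ _ _ _ (gauss_rV R n) (EFin \o h2)).
      exact/measurable_EFinP.
    by move=> p; rewrite lee_fin.
  - move=> u _; apply: ge0_le_integral => //.
    + by move=> x _; rewrite lee_fin.
    + apply/measurable_EFinP; exact: (measurableT_comp m1 (measurable_pair1 u)).
    + apply/measurable_EFinP; exact: (measurableT_comp m2 (measurable_pair1 u)).
    + by move=> x _; rewrite lee_fin; have /andP[] := h12 (u, x).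
have add2 (h1 h2 : borel_rV R n * borel_rV R n -> R) :
    measurable_fun setT h1 -> measurable_fun setT h2 ->
    (forall p, 0 <= h1 p) -> (forall p, 0 <= h2 p) ->
    (\int[sigma]_u \int[gauss_rV R n]_x (h1 (u, x) + h2 (u, x))%:E =
     \int[sigma]_u \int[gauss_rV R n]_x (h1 (u, x))%:E +
     \int[sigma]_u \int[gauss_rV R n]_x (h2 (u, x))%:E)%E.
  move=> m1 m2 h1_0 h2_0; rewrite -ge0_integralD//.
  - apply: eq_integral => u _; rewrite -ge0_integralD//.
    + by move=> x _; rewrite lee_fin.
    + apply/measurable_EFinP; exact: (measurableT_comp m1 (measurable_pair1 u)).
    + by move=> x _; rewrite lee_fin.
    + apply/measurable_EFinP; exact: (measurableT_comp m2 (measurable_pair1 u)).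
  - by move=> u _; apply: integral_ge0 => x _; rewrite lee_fin.
  - apply: (@measurable_fun_fubini_tonelli_F _ _ _ _ _ (gauss_rV R n) (EFin \o h1)).
      exact/measurable_EFinP.
    by move=> p; rewrite lee_fin.
  - by move=> u _; apply: integral_ge0 => x _; rewrite lee_fin.
  - apply: (@measurable_fun_fubini_tonelli_F _ _ _ _ _ (gauss_rV R n) (EFin \o h2)).
      exact/measurable_EFinP.
    by move=> p; rewrite lee_fin.
rewrite swap// in Ig.
have fk0 p : 0 <= f p.1 * k p by rewrite mulr_ge0.
have Le0 : 0 <= L * e by rewrite mulr_ge0.
have ek0 p : 0 <= L * e * k p by exact: mulr_ge0.
have pt p : g p <= f p.1 * k p + L * e * k p /\ f p.1 * k p <= g p + L * e * k p.
  have [h1 h2] := cone_kernel_close e (p.1 : 'rV[R]_n) (p.2 : 'rV[R]_n) L0 fL fZ.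
  rewrite /g -mulrDl; have [x00|nx0] := eqVneq (enorm (p.2 : 'rV[R]_n)) 0.
    have kp0 : k p = 0.
      apply/eqP; rewrite eq_le k0 andbT /k -(mul0r (chi p.1)) ler_wpM2r//.
      by have := cone_kernel_le (p.1 : 'rV[R]_n) p.2 e0'; rewrite x00 mulr0.
    by rewrite kp0 !mulr0 mul0r mulr0 addr0.
  have xgt0 : 0 < enorm (p.2 : 'rV[R]_n) by rewrite lt0r nx0 enorm_ge0.
  split; rewrite -(ler_pM2l xgt0).
  - have -> : enorm p.2 * (f p.2 * (k p / enorm p.2)) = f p.2 * cone_kernel e p.1 p.2 * chi p.1.
      by rewrite /k; field.
    by rewrite /k !mulrA ler_wpM2r.
  - have -> : enorm p.2 * (f p.2 * (k p / enorm p.2) + L * e * k p) =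
        (f p.2 + L * e * enorm p.2) * cone_kernel e p.1 p.2 * chi p.1.
      by rewrite /k; field.
    by rewrite /k !mulrA ler_wpM2r.
have h1 := le2 g (fun p => f p.1 * k p + L * e * k p) mg (measurable_funD mfk mek) _.
have h2 := le2 (fun p => f p.1 * k p) (fun p => g p + L * e * k p) mfk (measurable_funD mg mek) _.
have e1 : (\int[sigma]_u \int[gauss_rV R n]_x (f u * k (u, x) + L * e * k (u, x))%:E =
    (c * fine A + L * e * c)%:E)%E.
  by rewrite (add2 (fun p => f p.1 * k p) (fun p => L * e * k p))//= Ifk Ik.
have e2 : (\int[sigma]_u \int[gauss_rV R n]_x (g (u, x) + L * e * k (u, x))%:E =
    (kap * fine F + L * e * c)%:E)%E.
  by rewrite (add2 g (fun p => L * e * k p))//= Ig Ik.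
rewrite /= e1 Ig lee_fin cE in h1; rewrite /= e2 Ifk lee_fin cE in h2.
have {}h1 : kap * fine F <= kap * fine M * fine A + L * e * (kap * fine M).
  by apply: h1 => p; rewrite g0; have [] := pt p.
have {}h2 : kap * fine M * fine A <= kap * fine F + L * e * (kap * fine M).
  by apply: h2 => p; rewrite fk0; have [] := pt p.
by split; rewrite -(ler_pM2l kc0); lra.
Qed.

(** * Regular simplices and their support functions *)

Definition maxf (R : realType) (m : nat) (a : 'I_m.+1 -> R) : R :=
  \big[Num.max/a ord0]_(i < m.+1) a i.

Lemma maxf_ge (R : realType) (m : nat) (a : 'I_m.+1 -> R) i : a i <= maxf a.
Proof. exact: le_bigmax. Qed.

Lemma maxf_eq (R : realType) (m : nat) (a : 'I_m.+1 -> R) : exists i, maxf a = a i.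
Proof.
rewrite /maxf; elim/big_ind: _ => [|x y [i ->] [j ->]|i _]; first by exists ord0.
  by case: (leP (a i) (a j)) => _; [exists j|exists i].
by exists i.
Qed.

Lemma maxf_le (R : realType) (m : nat) (a : 'I_m.+1 -> R) t :
  (maxf a <= t) = [forall i, a i <= t].
Proof.
apply/idP/forallP => [h i|h]; first exact: le_trans (maxf_ge a i) h.
by have [i ->] := maxf_eq a.
Qed.

Lemma maxfZ (R : realType) (m : nat) (c : R) (a : 'I_m.+1 -> R) : 0 <= c ->
  maxf (fun i => c * a i) = c * maxf a.
Proof.
move=> c0; apply/eqP; rewrite eq_le; apply/andP; split.
  by rewrite maxf_le; apply/forallP => i; rewrite ler_wpM2l// maxf_ge.
by have [i ->] := maxf_eq a; exact: (maxf_ge (fun i => c * a i)).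
Qed.

Lemma maxfDr (R : realType) (m : nat) (c : R) (a : 'I_m.+1 -> R) :
  maxf (fun i => a i + c) = maxf a + c.
Proof.
apply/eqP; rewrite eq_le; apply/andP; split.
  by rewrite maxf_le; apply/forallP => i; rewrite lerD2r maxf_ge.
by have [i ->] := maxf_eq a; exact: (maxf_ge (fun i => a i + c)).
Qed.

(** A linear form on a convex hull attains its supremum at one of the generating
points. *)
Lemma support_function_hull (R : realType) (n m : nat) (v : 'I_m.+1 -> 'rV[R]_n)
    (u : 'rV[R]_n) :
  support_function (convex_hull_of v) u = maxf (fun i => dotp u (v i)).
Proof.
set M := maxf _; rewrite /support_function.
set S := [set _ | _ in _].
have ub : ubound S M.
  move=> _ [y [a [a0 a1 ->]] <-]; rewrite dotpC dotp_suml -[M]mul1r -a1 mulr_suml.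
  apply: ler_sum => i _; rewrite dotpZl dotpC ler_wpM2l//.
  exact: (maxf_ge (fun i => dotp u (v i))).
have MS : S M.
  have [i Mi] := maxf_eq (fun i => dotp u (v i)).
  exists (v i); last by rewrite /M Mi.
  exists (fun j => (j == i)%:R); split => //.
    by rewrite (bigD1 i)//= eqxx big1 ?addr0// => j /negbTE ->.
  by rewrite (bigD1 i)//= eqxx scale1r big1 ?addr0// => j /negbTE ->; rewrite scale0r.
apply/eqP; rewrite eq_le; apply/andP; split.
  by apply: sup_le_ub => //; exists M.
by apply: sup_ubound => //; exists M.
Qed.

Lemma maxf_dotp_lipschitz (R : realType) (n m : nat) (w : 'I_m.+1 -> 'rV[R]_n) :
  elipschitz (\sum_i enorm (w i)) (fun x => maxf (fun i => dotp x (w i))).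
Proof.
move=> x y; rewrite lerBlDr; have [i ->] := maxf_eq (fun i => dotp x (w i)).
rewrite -lerBlDr; apply: le_trans (_ : dotp x (w i) - dotp y (w i) <= _).
  by rewrite lerB// (maxf_ge (fun i => dotp y (w i))).
rewrite -dotpNl -dotpDl (le_trans (dotp_le_enorm _ _))// mulrC ler_wpM2r ?enorm_ge0//.
by rewrite (bigD1 i)//= lerDl sumr_ge0// => j _; rewrite enorm_ge0.
Qed.

(** The simplex centred at the origin and scaled by [sqrt 2], so that its vertices
are the projections of an orthonormal basis of one dimension more. *)
Definition simplex_frame (R : realType) (n : nat) (v : 'I_n.+1 -> 'rV[R]_n) (i : 'I_n.+1) :=
  Num.sqrt 2 *: (v i - n.+1%:R^-1 *: \sum_j v j).

Lemma sum_simplex_frame (R : realType) (n : nat) (v : 'I_n.+1 -> 'rV[R]_n) :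
  \sum_i simplex_frame v i = 0.
Proof.
rewrite /simplex_frame -scaler_sumr sumrB sumr_const card_ord -[X in _ - X]scaler_nat scalerA.
by rewrite mulfV ?pnatr_eq0// scale1r subrr scaler0.
Qed.

(** The mutual distances and the vanishing sum of the vectors determine their Gram
matrix, which is that of the standard basis projected orthogonally to
[(1, ..., 1)]. *)
Lemma dotp_simplex_frame (R : realType) (n : nat) (v : 'I_n.+1 -> 'rV[R]_n) i j :
  (forall i j, i != j -> enorm (v i - v j) = 1) ->
  dotp (simplex_frame v i) (simplex_frame v j) = (i == j)%:R - n.+1%:R^-1.
Proof.
move=> v1; set w := simplex_frame v; pose N : R := n.+1%:R.
have N0 : N != 0 by rewrite pnatr_eq0.
have polar x y : dotp (x - y) (x - y) = dotp x x + dotp y y - 2 * dotp x y :> R.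
  by rewrite dotpDl dotpNl ![dotp _ (x - y)]dotpC !dotpDl !dotpNl (dotpC y x); ring.
have dist a b : dotp (w a - w b) (w a - w b) = 2 * (a != b)%:R.
  have -> : w a - w b = Num.sqrt 2 *: (v a - v b).
    by rewrite /w /simplex_frame -scalerBr opprB addrA subrK.
  rewrite dotpZl dotpC dotpZl mulrA -expr2 sqr_sqrtr// -enorm_sqr.
  by case: eqVneq => [->|ab]; rewrite ?subrr ?enorm0 ?expr0n// v1// expr1n.
pose S := \sum_b dotp (w b) (w b).
have sumw a : \sum_b dotp (w a) (w b) = 0.
  under eq_bigr do rewrite dotpC.
  by rewrite -dotp_suml sum_simplex_frame -(scale0r (w a)) dotpZl mul0r.
(* Sum the squared distances from [w a] to all the vectors. *)
have Na a : N * dotp (w a) (w a) + S = 2 * (N - 1).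
  transitivity (\sum_b dotp (w a - w b) (w a - w b)).
    under eq_bigr do rewrite polar.
    rewrite sumrB big_split/= sumr_const card_ord -mulr_sumr sumw mulr0 subr0.
    by rewrite mulr_natl.
  under eq_bigr do rewrite dist.
  rewrite -mulr_sumr (bigD1 a)//= eqxx add0r; congr (_ * _).
  rewrite (eq_bigr (fun=> 1)); last by move=> b ba; rewrite eq_sym ba.
  rewrite sumr_const (_ : #|_| = n) ?/N -?[n.+1]addn1 ?natrD ?addrK//.
  by have := cardC1 a; rewrite card_ord.
have HS : N * S + N * S = N * (2 * (N - 1)).
  have : \sum_a (N * dotp (w a) (w a) + S) = \sum_(a < n.+1) (2 * (N - 1)).
    by apply: eq_bigr => a _; rewrite Na.
  rewrite big_split/= -mulr_sumr !sumr_const card_ord -[S *+ _]mulr_natl.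
  by rewrite -[(2 * (N - 1)) *+ _]mulr_natl.
have S1 : S = N - 1 by apply: (mulfI N0); lra.
have diag a : dotp (w a) (w a) = 1 - N^-1.
  by apply: (mulfI N0); have h := Na a; rewrite S1 in h; rewrite mulrBr mulr1 mulfV//; lra.
have := dist i j; rewrite polar !diag -/N.
case: eqVneq => [->|ij] /=; first by rewrite diag.
by rewrite mulr1; move: N^-1 => q; lra.
Qed.

(** The orthogonal matrix that realizes the simplex as a projection of the standard
basis; its first column is the normalized vector [(1, ..., 1)]. *)
Definition simplex_rotation (R : realType) (n : nat) (v : 'I_n.+1 -> 'rV[R]_n) :
  'M[R]_n.+1 :=
  \matrix_(i, j) (if unlift ord0 j is Some k then simplex_frame v i ord0 k
                  else (Num.sqrt n.+1%:R)^-1).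

Lemma simplex_rotation_orthogonal (R : realType) (n : nat) (v : 'I_n.+1 -> 'rV[R]_n) :
  (forall i j, i != j -> enorm (v i - v j) = 1) ->
  simplex_rotation v *m (simplex_rotation v)^T = 1%:M.
Proof.
move=> v1; apply/matrixP => i j; rewrite !mxE big_ord_recl !mxE unlift_none.
rewrite -expr2 exprVn sqr_sqrtr// (eq_bigr (fun k => simplex_frame v i 0 k * simplex_frame v j 0 k)).
  by rewrite -[X in _ + X]/(dotp _ _) dotp_simplex_frame// subrKC.
by move=> k _; rewrite !mxE liftK !mxE.
Qed.

Lemma tail_simplex_rotation (R : realType) (n : nat) (v : 'I_n.+1 -> 'rV[R]_n)
    (g : 'rV[R]_n.+1) :
  tail_rV (g *m simplex_rotation v) = \sum_i g 0 i *: simplex_frame v i.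
Proof.
apply/rowP => k; rewrite mxE mxE summxE; apply: eq_bigr => i _.
by rewrite !mxE liftK !mxE.
Qed.

(** Projecting a vector orthogonally to [(1, ..., 1)] subtracts the mean of its
coordinates, hence subtracts this mean from their maximum. *)
Lemma maxf_simplex_frame (R : realType) (n : nat) (v : 'I_n.+1 -> 'rV[R]_n)
    (g : 'rV[R]_n.+1) :
  (forall i j, i != j -> enorm (v i - v j) = 1) ->
  maxf (fun i => dotp (tail_rV (g *m simplex_rotation v)) (simplex_frame v i)) =
  n.+1%:R^-1 * \sum_j (maxf (fun i => g 0 i) - g 0 j).
Proof.
move=> v1; rewrite sumrB sumr_const card_ord -[maxf _ *+ _]mulr_natl mulrBr mulKf ?pnatr_eq0//.
rewrite -maxfDr; congr maxf; apply/funext => i; rewrite tail_simplex_rotation dotp_suml.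
rewrite (eq_bigr (fun k => g 0 k * (k == i)%:R - n.+1%:R^-1 * g 0 k)); last first.
  by move=> k _; rewrite dotpZl dotp_simplex_frame// mulrBr [_^-1 * _]mulrC.
rewrite sumrB -mulr_sumr; congr (_ - _).
rewrite (bigD1 i)//= eqxx mulr1 big1 ?addr0// => k /negbTE ->.
by rewrite mulr0.
Qed.

(** * The mean width as a quotient of Gaussian expectations *)

Lemma elipschitzD (R : realType) (n : nat) (L K : R) (f g : 'rV[R]_n -> R) :
  elipschitz L f -> elipschitz K g -> elipschitz (L + K) (fun x => f x + g x).
Proof. by move=> fL gK x y; have := fL x y; have := gK x y; lra. Qed.

Lemma elipschitzZ (R : realType) (n : nat) (L a : R) (f : 'rV[R]_n -> R) :
  0 <= a -> elipschitz L f -> elipschitz (a * L) (fun x => a * f x).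
Proof. by move=> a0 fL x y; rewrite -mulrBr -mulrA ler_wpM2l. Qed.

Lemma elipschitz_dotp (R : realType) (n : nat) (c : 'rV[R]_n) :
  elipschitz (enorm c) (fun x => dotp x c).
Proof. by move=> x y; rewrite -dotpNl -dotpDl mulrC dotp_le_enorm. Qed.

Lemma elipschitz_enorm (R : realType) (n : nat) : elipschitz 1 (@enorm R n).
Proof. by move=> x y; rewrite mul1r enorm_lipschitz. Qed.

Lemma enorm_tail_rV_le (R : realType) (n : nat) (x : 'rV[R]_n.+1) :
  enorm (tail_rV x) <= enorm x.
Proof.
rewrite /enorm ler_wsqrtr// /dotp big_ord_recl ler_wpDl -?expr2 ?sqr_ge0//.
by rewrite le_eqVlt; apply/orP; left; apply/eqP/eq_bigr => i _; rewrite !mxE.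
Qed.

Lemma integral_gauss_rV_tail (R : realType) (n : nat) (L : R) (f : 'rV[R]_n -> R) :
  0 <= L -> (forall x, 0 <= f x) -> elipschitz L f ->
  (\int[gauss_rV R n.+1]_x (f (tail_rV (x : 'rV[R]_n.+1)))%:E =
   \int[gauss_rV R n]_x (f x)%:E)%E.
Proof.
move=> L0 f0 fL; have mf := elipschitz_measurable L0 fL.
rewrite ge0_integral_gauss_rVS.
- pose I := (\int[gauss_rV R n]_x (f x)%:E)%E.
  transitivity (\int[stdnormal]_t (cst I (t : measurableTypeR R)))%E.
    by apply: eq_integral => t _; apply: eq_integral => y _; rewrite cons_rVK.
  by rewrite integral_cst// [X in (_ * X)%E]probability_setT mule1.
- apply/measurable_EFinP; apply: (measurableT_comp mf); apply: measurable_fun_rV => i.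
  by under eq_fun do rewrite mxE; exact: measurable_coord.
- by move=> x; rewrite lee_fin.
Qed.

(** The linear part integrates to 0 by symmetry; the multiple of the norm keeps the
integrand nonnegative. *)
Lemma integral_gauss_rV_support (R : realType) (n : nat) (b : R) (c : 'rV[R]_n) :
  b = enorm c ->
  (\int[gauss_rV R n]_x (dotp (x : 'rV[R]_n) c + b * enorm (x : 'rV[R]_n))%:E =
   b%:E * \int[gauss_rV R n]_x (enorm (x : 'rV[R]_n))%:E)%E.
Proof.
move=> bE; have b0 : 0 <= b by rewrite bE enorm_ge0.
pose p (x : 'rV[R]_n) := dotp x c + b * enorm x.
have p0 x : 0 <= p x.
  have := dotp_le_enorm (- x) c; rewrite enormN dotpNl -bE /p mulrC; lra.
have pL : elipschitz (b + b * 1) p.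
  rewrite {1}bE; apply: elipschitzD; first exact: elipschitz_dotp.
  exact: (elipschitzZ b0 (@elipschitz_enorm R n)).
have L0 : 0 <= b + b * 1 by rewrite mulr1 addr_ge0.
have me : measurable_fun setT (fun x : borel_rV R n => (enorm (x : 'rV[R]_n))%:E).
  by apply/measurable_EFinP; apply: measurable_enorm => i; exact: measurable_coord.
have mp := elipschitz_measurable L0 pL.
have mpN : measurable_fun setT (fun x : borel_rV R n => p (- (x : 'rV[R]_n))).
  apply: (measurableT_comp mp); apply: measurable_fun_rV => i.
  under eq_fun do rewrite mxE; apply: measurableT_comp => //.
  exact: measurable_coord.
have orthN : (- 1%:M : 'M[R]_n) *m (- 1%:M)^T = 1%:M.
  by rewrite linearN/= trmx1 mulNmx mulmxN opprK mulmx1.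
have sym : (\int[gauss_rV R n]_x (p (- (x : 'rV[R]_n)))%:E = \int[gauss_rV R n]_x (p x)%:E)%E.
  rewrite -(gauss_rV_orthogonal orthN L0 p0 pL); apply: eq_integral => x _.
  by rewrite mulmxN mulmx1.
have two : (2%:E * \int[gauss_rV R n]_x (p x)%:E =
    2%:E * (b%:E * \int[gauss_rV R n]_x (enorm (x : 'rV[R]_n))%:E))%E.
  rewrite -[2%:E]/(1 + 1)%:E EFinD [LHS]ge0_muleDl// !mul1e -[X in (_ + X)%E]sym.
  rewrite -ge0_integralD//; last 4 first.
  - by move=> x _; rewrite lee_fin.
  - exact/measurable_EFinP.
  - by move=> x _; rewrite lee_fin.
  - exact/measurable_EFinP.
  rewrite -EFinD muleA -EFinM -ge0_integralZl ?lee_fin ?mulr_ge0//; last first.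
    by move=> x _; rewrite lee_fin enorm_ge0.
  apply: eq_integral => x _; rewrite -EFinD -EFinM /p enormN dotpNl; congr _%:E.
  by ring.
have h2 : 2 != 0 :> R by [].
have := congr1 (fun z => (2^-1)%:E * z)%E two.
by rewrite !muleA -!EFinM mulVf// mul1r !mul1e.
Qed.

(** Write the support function as that of the centred simplex plus [dotp u c], where
[c] is the centroid, and apply [sphere_average] to the two parts together. *)
Lemma mean_width_simplexE (R : realType) (n : nat)
    (sigma : probability (borel_rV R n) R) (v : 'I_n.+1 -> 'rV[R]_n) (F M : R) :
  (1 < n)%N -> rotation_invariant_sphere_probability sigma ->
  (forall i j, i != j -> enorm (v i - v j) = 1) ->
  (\int[gauss_rV R n.+1]_g (n.+1%:R^-1 *
     \sum_j (maxf (fun i => (g : 'rV[R]_n.+1) 0 i) - (g : 'rV[R]_n.+1) 0 j))%:E = F%:E)%E ->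
  (\int[gauss_rV R n]_x (enorm (x : 'rV[R]_n))%:E = M%:E)%E -> 0 < M ->
  mean_width sigma (convex_hull_of v) = F / (Num.sqrt 2 * M).
Proof.
move=> n1 sinv v1 FE ME M0; have [sS _] := sinv.
pose w := simplex_frame v; pose f (u : 'rV[R]_n) := maxf (fun i => dotp u (w i)).
pose L := \sum_i enorm (w i).
have L0 : 0 <= L by rewrite sumr_ge0// => i _; rewrite enorm_ge0.
have fL : elipschitz L f by exact: maxf_dotp_lipschitz.
have f0 u : 0 <= f u.
  have h : 0 <= n.+1%:R * f u.
    have <- : \sum_i dotp u (w i) = 0.
      under eq_bigr do rewrite dotpC.
      by rewrite -dotp_suml sum_simplex_frame -(scale0r u) dotpZl mul0r.
    have -> : n.+1%:R * f u = \sum_(i < n.+1) f u.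
      by rewrite sumr_const card_ord mulr_natl.
    apply: ler_sum => i _.
    exact: (maxf_ge (fun i => dotp u (w i))).
  by move: h; rewrite pmulr_rge0// ltr0n.
have fZ a u : 0 <= a -> f (a *: u) = a * f u.
  by move=> a0; rewrite /f -maxfZ//; congr maxf; apply/funext => i; rewrite dotpZl.
have gf : (\int[gauss_rV R n]_x (f x)%:E = F%:E)%E.
  rewrite -(integral_gauss_rV_tail L0 f0 fL).
  have tL : elipschitz L (fun x : 'rV[R]_n.+1 => f (tail_rV x)).
    move=> x y; apply: le_trans (fL _ _) _; rewrite ler_wpM2l//.
    rewrite (_ : tail_rV x - tail_rV y = tail_rV (x - y)) ?enorm_tail_rV_le//.
    by apply/rowP => i; rewrite !mxE.
  rewrite -(gauss_rV_orthogonal (simplex_rotation_orthogonal v1) L0 (fun x => f0 _) tL).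
  by rewrite -FE; apply: eq_integral => g _; rewrite /f maxf_simplex_frame.
pose s := Num.sqrt 2 : R; have s0 : 0 < s by rewrite sqrtr_gt0.
pose c := n.+1%:R^-1 *: \sum_j v j.
pose b := enorm c; have b0 : 0 <= b by rewrite enorm_ge0.
have hE u : support_function (convex_hull_of v) u = s^-1 * f u + dotp u c.
  rewrite support_function_hull /f -maxfZ ?invr_ge0 ?(ltW s0)// -maxfDr.
  congr maxf; apply/funext => i; rewrite /w /simplex_frame -/s -/c.
  by rewrite ![dotp u _]dotpC dotpZl dotpDl dotpNl mulKf ?gt_eqF// subrK.
(* The term [b * enorm u] makes the function nonnegative; on the sphere it is the
   constant [b], subtracted at the end. *)
pose F1 (u : 'rV[R]_n) := s^-1 * f u + (dotp u c + b * enorm u).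
have F1L : elipschitz (s^-1 * L + (b + b * 1)) F1.
  apply: elipschitzD; first by apply: elipschitzZ => //; rewrite invr_ge0 ltW.
  apply: elipschitzD; first exact: elipschitz_dotp.
  exact: (elipschitzZ b0 (@elipschitz_enorm R n)).
have p0 u : 0 <= dotp u c + b * enorm u.
  have := dotp_le_enorm (- u) c; rewrite enormN dotpNl -/b mulrC; lra.
have sf0 u : 0 <= s^-1 * f u by rewrite mulr_ge0// invr_ge0 ltW.
have F10 u : 0 <= F1 u by rewrite addr_ge0.
have F1Z a u : 0 <= a -> F1 (a *: u) = a * F1 u.
  by move=> a0; rewrite /F1 fZ// dotpZl enormZ ger0_norm//; ring.
have L1 : 0 <= s^-1 * L + (b + b * 1).
  by rewrite addr_ge0 ?mulr_ge0 ?invr_ge0 ?(ltW s0)// mulr1 addr_ge0.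
have := sphere_average n1 sinv L1 F10 F1L F1Z.
have -> : (\int[gauss_rV R n]_x (F1 x)%:E = (s^-1 * F + b * M)%:E)%E.
  rewrite EFinD EFinM -gf EFinM -ME -(integral_gauss_rV_support (c := c))//.
  have mf := elipschitz_measurable L0 fL.
  rewrite -ge0_integralZl ?lee_fin ?invr_ge0 ?(ltW s0)//; last 2 first.
  - exact/measurable_EFinP.
  - by move=> x _; rewrite lee_fin.
  rewrite -ge0_integralD//.
  - by move=> x _; rewrite mule_ge0// lee_fin// invr_ge0 ltW.
  - by apply: emeasurable_funM => //; exact/measurable_EFinP.
  - by move=> x _; rewrite lee_fin.
  - apply/measurable_EFinP; apply: measurable_funD.
      by apply: measurable_dotp => // i; exact: measurable_coord.
    apply: measurable_funM => //.
    by apply: measurable_enorm => i; exact: measurable_coord.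
rewrite ME => key.
have mF1 := elipschitz_measurable L1 F1L.
have mS : measurable (@usphere R n : set (borel_rV R n)) by exact: measurable_usphere.
have IF1 : (\int[sigma]_(u in @usphere R n) (F1 u)%:E = ((s^-1 * F + b * M) / M)%:E)%E.
  rewrite mulrC EFinM key muleA -EFinM mulVf ?gt_eqF// mul1e.
  by [].
have iF1 : sigma.-integrable (@usphere R n) (EFin \o F1).
  apply/integrableP; split.
    by apply: measurable_funTS; exact/measurable_EFinP.
  under eq_integral do rewrite /= ger0_norm//.
  by rewrite IF1 ltry.
have ib : sigma.-integrable (@usphere R n) (EFin \o cst b).
  by apply: finite_measure_integrable_cst.
rewrite /mean_width /Rintegral.
rewrite (eq_integral (fun u : borel_rV R n => ((F1 u)%:E - b%:E)%E)); last first.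
  move=> u; rewrite inE => u1; rewrite hE -EFinB; congr _%:E.
  by rewrite /F1 u1 mulr1 addrA addrK.
rewrite integralB//= IF1 integral_cst// [X in (_ - _ * X)%E]sS mule1 -EFinB/=.
rewrite -/s; field.
by rewrite !gt_eqF.
Qed.

(** * The expected maximum of independent normal variables *)

Definition Phi (R : realType) (t : R) : R :=
  fine (\int[stdnormal]_s ((s <= t)%R%:R)%:E)%E.

Lemma measurable_le_ind (d : measure_display) (T : measurableType d) (R : realType)
    (f g : T -> R) : measurable_fun setT f -> measurable_fun setT g ->
  measurable_fun setT (fun x => (f x <= g x)%R%:R : R).
Proof.
move=> mf mg; rewrite (_ : (fun x => _) = (fun x => if f x <= g x then 1 else 0)).
  by apply: measurable_fun_ifT => //; exact: measurable_fun_ler.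
by apply/funext => x; case: (f x <= g x).
Qed.

Lemma PhiE (R : realType) (t : R) :
  (\int[stdnormal]_s ((s <= t)%R%:R)%:E = (Phi t)%:E)%E.
Proof.
rewrite /Phi fineK// ge0_fin_numE; last by apply: integral_ge0 => s _; rewrite lee_fin.
apply: (@le_lt_trans _ _ (\int[stdnormal]_(s in setT) (cst 1%:E (s : measurableTypeR R)))%E).
  apply: ge0_le_integral => //.
  - by apply/measurable_EFinP; exact: measurable_le_ind.
  - by move=> s _; rewrite /= lee_fin; case: (s <= t).
by rewrite integral_cst// [X in (_ * X)%E]probability_setT mule1 ltry.
Qed.

Lemma integral_ind_diff (R : realType) (a b : R) : a <= b ->
  (\int[lebesgue_measure]_t ((a <= t)%R%:R - (b <= t)%R%:R)%:E = (b - a)%:E)%E.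
Proof.
move=> ab.
transitivity (\int[lebesgue_measure]_t (\1_`[a, b[%classic t)%:E)%E.
  apply: eq_integral => t _; congr _%:E; rewrite indicE mem_setE in_itv/=.
  have [bt|tb] := leP b t; last by rewrite subr0 andbT.
  by rewrite (le_trans ab bt) subrr.
rewrite integral_indic//= setIT lebesgue_measure_itv/= lte_fin.
case: ltP => [//|ba].
by have -> : a = b by [apply/eqP; rewrite eq_le ab ba]; rewrite subrr.
Qed.

(** Layer-cake formula: [max - g j] is the length of the set of [t] with
[g j <= t < max], and the events [g i <= t] are independent of probability
[Phi t]. *)
Lemma integral_gauss_rV_maxB (R : realType) (n : nat) (j : 'I_n.+1) :
  (\int[gauss_rV R n.+1]_g
     (maxf (fun i => (g : 'rV[R]_n.+1) 0 i) - (g : 'rV[R]_n.+1) 0 j)%:E =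
   \int[lebesgue_measure]_t (Phi t - Phi t ^+ n.+1)%:E)%E.
Proof.
pose a (g : 'rV[R]_n.+1) (i : 'I_n.+1) (t : R) : R := (g 0 i <= t)%R%:R.
pose h (p : borel_rV R n.+1 * measurableTypeR R) : R :=
  a p.1 j p.2 - \prod_i a p.1 i p.2.
have prodE g t : \prod_i a g i t = (maxf (fun i => g 0 i) <= t)%R%:R.
  rewrite maxf_le; apply/esym; have [/forallP gt|] := boolP [forall i, g 0 i <= t].
    by rewrite big1// => i _; rewrite /a gt.
  rewrite negb_forall => /existsP[i /negbTE gi].
  by rewrite (bigD1 i)//= {1}/a gi mul0r.
have h0 p : 0 <= h p.
  rewrite /h prodE subr_ge0 /a; case: (leP (maxf _) p.2) => // m.
  by rewrite (le_trans (maxf_ge _ j) m).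
have ma i : measurable_fun setT (fun p : borel_rV R n.+1 * measurableTypeR R => a p.1 i p.2).
  apply: measurable_le_ind => //.
  exact: (measurableT_comp (@measurable_coord R n.+1 i) measurable_fst).
have mh : measurable_fun setT h.
  apply: measurable_funB => //.
  by apply: (@measurable_prod _ _ _ _ _ (index_enum _)
    (fun i (p : borel_rV R n.+1 * measurableTypeR R) => a p.1 i p.2)).
transitivity (\int[gauss_rV R n.+1]_g \int[lebesgue_measure]_t (h (g, t))%:E)%E.
  apply: eq_integral => g _; rewrite -integral_ind_diff; last exact: (maxf_ge (fun i => g 0 i)).
  by apply: eq_integral => t _; rewrite /h/= prodE.
rewrite (@fubini_tonelli _ _ _ _ _ (gauss_rV R n.+1) lebesgue_measure (EFin \o h)); last 2 first.
- exact/measurable_EFinP.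
- by move=> p; rewrite lee_fin.
apply: eq_integral => t _ /=.
have ai0 g i : 0 <= a g i t by rewrite /a.
have mai i : measurable_fun setT (fun g : borel_rV R n.+1 => a g i t).
  by apply: measurable_le_ind => //; exact: measurable_coord.
have mpr : measurable_fun setT (fun g : borel_rV R n.+1 => \prod_i a g i t).
  exact: (@measurable_prod_coord _ _ (fun i s => (s <= t)%R%:R) (fun i => measurable_le_ind _ _)).
have I1 : (\int[gauss_rV R n.+1]_g (\prod_i a g i t)%:E = (Phi t ^+ n.+1)%:E)%E.
  rewrite (integral_gauss_rV_prod (h := fun i s => (s <= t)%R%:R) (c := fun=> Phi t)).
  - by rewrite prodr_const card_ord.
  - by move=> i; exact: measurable_le_ind.
  - by move=> i s.
  - by move=> i; exact: PhiE.
have I2 : (\int[gauss_rV R n.+1]_g (a g j t)%:E = (Phi t)%:E)%E.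
  pose hh i (s : measurableTypeR R) : R := if i == j then (s <= t)%R%:R else 1.
  transitivity (\int[gauss_rV R n.+1]_g (\prod_i hh i ((g : 'rV[R]_n.+1) 0 i))%:E)%E.
    apply: eq_integral => g _; rewrite (bigD1 j)//= big1 ?mulr1.
      by rewrite /hh eqxx.
    by move=> i /negbTE ij; rewrite /hh ij.
  rewrite (integral_gauss_rV_prod (c := fun i => if i == j then Phi t else 1)).
  - by rewrite (bigD1 j)//= big1 ?mulr1 ?eqxx// => i /negbTE ->.
  - by move=> i; rewrite /hh; case: (i == j) => //; exact: measurable_le_ind.
  - by move=> i s; rewrite /hh; case: (i == j).
  - move=> i; rewrite /hh; case: (i == j); first exact: PhiE.
    by rewrite integral_cst// [X in (_ * X)%E]probability_setT mule1.
have : ((Phi t)%:E = \int[gauss_rV R n.+1]_g (h (g, t))%:E + (Phi t ^+ n.+1)%:E)%E.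
  rewrite -I1 -I2 -ge0_integralD//.
  - by apply: eq_integral => g _; rewrite -EFinD /h/= subrK.
  - by move=> g _; rewrite lee_fin.
  - apply/measurable_EFinP; exact: measurable_funB.
  - by move=> g _; rewrite lee_fin prodr_ge0.
  - exact/measurable_EFinP.
by rewrite EFinB => ->; rewrite addeK.
Qed.

Lemma integral_gauss_rV_max (R : realType) (n : nat) :
  (\int[gauss_rV R n.+1]_g (n.+1%:R^-1 *
     \sum_j (maxf (fun i => (g : 'rV[R]_n.+1) 0 i) - (g : 'rV[R]_n.+1) 0 j))%:E =
   \int[lebesgue_measure]_t (Phi t - Phi t ^+ n.+1)%:E)%E.
Proof.
have mc (i : 'I_n.+1) : measurable_fun setT (fun g : borel_rV R n.+1 => (g : 'rV[R]_n.+1) 0 i).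
  exact: measurable_coord.
have mm : measurable_fun setT (fun g : borel_rV R n.+1 => maxf (fun i => (g : 'rV[R]_n.+1) 0 i)).
  pose w (i : 'I_n.+1) : 'rV[R]_n.+1 := delta_mx 0 i.
  rewrite (_ : (fun g => _) = (fun g : borel_rV R n.+1 => maxf (fun i => dotp g (w i)))).
    apply: elipschitz_measurable (maxf_dotp_lipschitz w).
    by apply: sumr_ge0 => i _; rewrite enorm_ge0.
  apply/funext => g; congr maxf; apply/funext => i; rewrite /dotp (bigD1 i)//= big1 ?addr0.
    by rewrite mxE !eqxx mulr1.
  by move=> k /negbTE ki; rewrite mxE ki andbF mulr0.
have d0 (g : borel_rV R n.+1) j : 0 <= maxf (fun i => (g : 'rV[R]_n.+1) 0 i) - (g : 'rV[R]_n.+1) 0 j.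
  by rewrite subr_ge0 (maxf_ge (fun i => (g : 'rV[R]_n.+1) 0 i)).
have md j : measurable_fun setT (fun g : borel_rV R n.+1 =>
    (maxf (fun i => (g : 'rV[R]_n.+1) 0 i) - (g : 'rV[R]_n.+1) 0 j)%:E).
  by apply/measurable_EFinP; exact: measurable_funB.
under eq_integral do rewrite EFinM -sumEFin.
rewrite ge0_integralZl ?lee_fin ?invr_ge0//; last 2 first.
- exact: emeasurable_sum.
- by move=> g _; apply: sume_ge0 => j _; rewrite lee_fin.
rewrite ge0_integral_sum//; last by move=> j g _; rewrite lee_fin.
under eq_bigr do rewrite integral_gauss_rV_maxB.
set I := (\int[lebesgue_measure]_t _)%E.
have -> : (\sum_(j < n.+1) I = n.+1%:R%:E * I)%E.
  transitivity (\sum_(j < n.+1) 1%:E * I)%E.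
    by apply: eq_bigr => j _; rewrite mul1e.
  by rewrite -ge0_sume_distrl// sumEFin sumr_const card_ord.
by rewrite muleA -EFinM mulVf ?mul1e// pnatr_eq0.
Qed.

(** * Integration by parts for the expected maximum *)

Definition phi (R : realType) (t : R) : R := normal_pdf 0 1 t.

Lemma phiE (R : realType) (t : R) :
  phi t = normal_peak 1 * expR (- (2^-1 * t ^+ 2)).
Proof.
rewrite /phi normal_pdf_expR ?oner_neq0// subr0 expr1n; congr (_ * expR _).
by rewrite mulNr mulrC.
Qed.

Lemma phi_gt0 (R : realType) (t : R) : 0 < phi t.
Proof. by rewrite phiE mulr_gt0 ?expR_gt0// normal_peak_gt0// oner_neq0. Qed.

Lemma phiN (R : realType) (t : R) : phi (- t) = phi t.
Proof. by rewrite !phiE sqrrN. Qed.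

Lemma is_derive_phi (R : realType) (t : R) : is_derive t 1 (@phi R) (- t * phi t).
Proof.
rewrite (_ : @phi R = fun t => normal_peak 1 * expR (- (2^-1 * t ^+ 2))).
  apply: is_derive_eq (is_derive_scale _ (is_derive_gauss 2^-1 t)) _.
  by rewrite mulfV// mul1r mulrCA.
by apply/funext => x; rewrite phiE.
Qed.

Lemma continuous_phi (R : realType) : continuous (@phi R).
Proof. exact: is_derive_continuous (@is_derive_phi R). Qed.

Lemma cvgy_phi (R : realType) : @phi R t @[t --> +oo] --> (0 : R).
Proof.
rewrite (_ : @phi R = fun t => normal_peak 1 * (t ^+ 0 * expR (- (2^-1 * t ^+ 2)))).
  rewrite -[X in _ --> X](mulr0 (normal_peak 1)); apply: cvgM; first exact: cvg_cst.
  exact: cvgy_pow_gauss.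
by apply/funext => x; rewrite phiE expr0 mul1r.
Qed.

Lemma Phi_integral (R : realType) (t : R) :
  (\int[lebesgue_measure]_(s in `]-oo, t]) (phi s)%:E = (Phi t)%:E)%E.
Proof.
rewrite -PhiE ge0_integral_normal_prob; last 2 first.
- by apply/measurable_EFinP; exact: measurable_le_ind.
- by move=> s; rewrite lee_fin.
rewrite [LHS]integral_mkcond; apply: eq_integral => s _.
rewrite patchE mem_setE in_itv/= /phi.
by case: (s <= t); rewrite ?mul1e ?mul0e.
Qed.

Lemma Phi_ge0 (R : realType) (t : R) : 0 <= Phi t.
Proof.
rewrite -lee_fin -Phi_integral; apply: integral_ge0 => s _.
by rewrite lee_fin ltW// phi_gt0.
Qed.

Lemma is_derive_Phi (R : realType) (t : R) : is_derive t 1 (@Phi R) (phi t).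
Proof.
have iphi u : lebesgue_measure.-integrable `]-oo, u] (EFin \o @phi R).
  by apply: integrableS (integrable_normal_pdf 0 1).
have PhiR : @Phi R = fun x => (\int[lebesgue_measure]_(s in `]-oo, x]) phi s)%R.
  by apply/funext => x; rewrite /Rintegral Phi_integral.
have t1 : t < t + 1 by rewrite ltrDl.
have [] := continuous_FTC1 t1 (iphi (t + 1)) (ltNyr _) (@continuous_phi R t).
rewrite -PhiR => dPhi ePhi; apply: DeriveDef => //.
by rewrite -derive1E.
Qed.

Lemma continuous_Phi (R : realType) : continuous (@Phi R).
Proof. exact: is_derive_continuous (@is_derive_Phi R). Qed.

Lemma Phi0 (R : realType) : Phi (0 : R) = 2^-1.
Proof.
have e1 := integral_normal_pdf (0 : R) 1.
rewrite ge0_symfun_integralT in e1; last 3 first.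
- by move=> x; exact: normal_pdf_ge0.
- exact: (@continuous_phi R).
- by move=> x /=; rewrite -/(phi x) -/(phi (- x)) phiN.
have e2 : (\int[lebesgue_measure]_(x in [set x : R | (0 <= x)%R]) (phi x)%:E = (Phi 0)%:E)%E.
  rewrite (_ : [set x | _] = `[0, +oo[%classic); last first.
    by apply/seteqP; split => x/=; rewrite in_itv/= andbT.
  rewrite -Phi_integral (ge0_integration_by_substitution0 (f := fun x => (phi x)%:E)).
  - by apply: eq_integral => x _; rewrite phiN.
  - by apply/measurable_EFinP; exact: measurable_normal_pdf.
  - by move=> x; rewrite lee_fin ltW// phi_gt0.
move: e1; rewrite -/phi e2 -EFinM => -[] e1.
have h2 : 2 != 0 :> R by [].
by apply: (mulfI h2); rewrite e1 mulfV.
Qed.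

Lemma PhiN (R : realType) (t : R) : Phi (- t) = 1 - Phi t.
Proof.
have d (x : R) : is_derive x 1 (fun x => Phi x + Phi (- x)) 0.
  have d1 : is_derive x 1 (fun x : R => Phi (- x)) _ :=
    @is_derive1_comp _ _ _ x _ _ (is_derive_Phi (- x)) (is_deriveNid x 1).
  apply: is_derive_eq (is_derive_add (is_derive_Phi x) d1) _.
  by rewrite phiN mulrN1 subrr.
have := is_derive_0_is_cst t 0 d; rewrite oppr0 Phi0 => h.
lra.
Qed.

Lemma Phi_le1 (R : realType) (t : R) : Phi t <= 1.
Proof. by rewrite -subr_ge0 -PhiN Phi_ge0. Qed.

(** The Mills ratio bound, from [t <= x] on the domain of integration.  It makes the
boundary terms of the next integration by parts vanish. *)
Lemma Phi_tail (R : realType) (t : R) : 0 < t -> t * (1 - Phi t) <= phi t.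
Proof.
move=> t0; rewrite -PhiN -lee_fin EFinM -Phi_integral.
rewrite ge0_integration_by_substitutionNy; last 2 first.
- exact/continuous_subspaceT/continuous_phi.
- by move=> x _; rewrite ltW// phi_gt0.
have mphi : measurable_fun `[t, +oo[ (fun x : R => (phi x)%:E).
  apply: measurable_funTS; apply/measurable_EFinP; exact: measurable_normal_pdf.
have -> : (phi t)%:E = (\int[lebesgue_measure]_(x in `[t, +oo[) (x * phi x)%:E)%E.
  rewrite (@ge0_continuous_FTC2y _ (fun x => x * phi x) (fun x => - phi x) t 0).
  - by rewrite EFinN oppeK add0e.
  - by move=> x tx; rewrite mulr_ge0 ?(ltW (phi_gt0 x))// (le_trans (ltW t0)).
  - apply: continuous_subspaceT => x; apply: cvgM; [exact: cvg_id|exact: continuous_phi].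
  - by rewrite -oppr0; apply: cvgN; exact: cvgy_phi.
  - by move=> x _; have [] := is_deriveN (is_derive_phi x).
  - by apply: cvgN; apply: cvg_at_right_filter; exact: continuous_phi.
  - move=> x _; rewrite derive1E.
    have dN : is_derive x 1 (fun x : R => - phi x) (x * phi x).
      by apply: is_derive_eq (is_deriveN (is_derive_phi x)) _; rewrite mulNr opprK.
    by have [_ ->] := dN.
under eq_integral do rewrite /= phiN.
rewrite -ge0_integralZl ?lee_fin ?(ltW t0)//; last first.
  by move=> x _; rewrite lee_fin ltW// phi_gt0.
apply: ge0_le_integral => //.
- by move=> x _; rewrite mule_ge0// lee_fin ltW// phi_gt0.
- by apply: emeasurable_funM.
- apply: measurable_funTS; apply/measurable_EFinP; apply: measurable_funM => //.
  exact: measurable_normal_pdf.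
- move=> x; rewrite /= in_itv/= andbT => tx.
  by rewrite -EFinM lee_fin ler_wpM2r// ltW// phi_gt0.
Qed.

Lemma ge0_integral_symmetrize (R : realType) (g : R -> R) :
  (forall x, 0 <= g x) -> continuous g ->
  (\int[lebesgue_measure]_x (g x)%:E = int0y (fun x => g x + g (- x)))%E.
Proof.
move=> g0 cg.
have mg : measurable_fun setT g by exact: continuous_measurable_fun.
have cgN : continuous (fun x => g (- x)).
  move=> x; apply: (@cvg_comp _ _ _ -%R g); last exact: cg.
  by apply: cvgN; exact: cvg_id.
have mgN : measurable_fun setT (fun x : R => g (- x)) by exact: continuous_measurable_fun.
have refl : (\int[lebesgue_measure]_x (g (- x))%:E = \int[lebesgue_measure]_x (g x)%:E)%E.
  have mN : measurable_fun setT (-%R : measurableTypeR R -> measurableTypeR R).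
    exact: oppr_measurable.
  have mgE : measurable_fun setT (fun x : measurableTypeR R => (g x)%:E).
    exact/measurable_EFinP.
  have := @ge0_integral_pushforward _ _ _ _ R _ mN lebesgue_measure setT _ measurableT mgE.
  rewrite preimage_setT => <-; last by move=> x _; rewrite lee_fin.
  by apply: eq_measure_integral => A mA _; exact: lebesgue_measureN.
have := @ge0_symfun_integralT R (fun x => g x + g (- x)).
rewrite (_ : [set x | _] = `[0, +oo[%classic); last first.
  by apply/seteqP; split => x/=; rewrite in_itv/= andbT.
under eq_integral do rewrite EFinD.
rewrite ge0_integralD//; last 4 first.
- by move=> x _; rewrite lee_fin.
- exact/measurable_EFinP.
- by move=> x _; rewrite lee_fin.
- exact/measurable_EFinP.
rewrite refl => h.
have {}h : (2%:E * \int[lebesgue_measure]_x (g x)%:E =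
    2%:E * int0y (fun x => g x + g (- x)%R))%E.
  rewrite -h; last 3 first.
  - by move=> x; rewrite addr_ge0.
  - by move=> x; apply: cvgD; [exact: cg|exact: cgN].
  - by move=> x /=; rewrite opprK addrC.
  by rewrite -[2%:E]/(1 + 1)%:E EFinD ge0_muleDl// !mul1e.
have h2 : 2 != 0 :> R by [].
have := congr1 (fun z => (2^-1)%:E * z)%E h.
by rewrite !muleA -!EFinM mulVf// !mul1e.
Qed.

Lemma one_sub_pow_le (R : realType) (n : nat) (q : R) : 0 <= q <= 1 ->
  1 - q ^+ n <= n%:R * (1 - q).
Proof.
move=> /andP[q0 q1]; elim: n => [|n IH]; first by rewrite expr0 subrr mul0r.
rewrite exprS -[n.+1]addn1 natrD.
have : q ^+ n <= 1 by rewrite exprn_ile1.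
have : 0 <= q ^+ n by rewrite exprn_ge0.
nra.
Qed.

(** The left-hand side is symmetrized to an integral over the half-line of
[1 - Phi ^ (m+2) - (1 - Phi) ^ (m+2)].  Two integrations by parts, the second
one with [phi' = - t * phi], are performed at once by the primitive [F] below. *)
Lemma integral_PhiB (R : realType) (m : nat) (B : R) :
  int0y (fun t : R => phi t ^+ 2 * (Phi t ^+ m + (1 - Phi t) ^+ m)) = B%:E ->
  (\int[lebesgue_measure]_t (Phi t - Phi t ^+ m.+2)%:E =
   (m.+2%:R * m.+1%:R * B)%:E)%E.
Proof.
move=> HB.
have q01 (t : R) : 0 <= Phi t <= 1 by rewrite Phi_ge0 Phi_le1.
have q01' (t : R) : 0 <= 1 - Phi t <= 1 by have := q01 t; lra.
have g0 (t : R) : 0 <= Phi t - Phi t ^+ m.+2.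
  have /andP[q0 q1] := q01 t; rewrite subr_ge0 exprS ler_piMr// exprn_ile1//.
have cPhi := @continuous_Phi R.
have cPhiX k : continuous (fun t : R => Phi t ^+ k).
  exact: continuous_pow.
have cPhi1X k : continuous (fun t : R => (1 - Phi t) ^+ k).
  by apply: continuous_pow => t; apply: cvgB; [exact: cvg_cst|exact: cPhi].
rewrite ge0_integral_symmetrize//; last by move=> t; apply: cvgB; [exact: cPhi|exact: cPhiX].
pose e (t : R) := 1 - Phi t ^+ m.+2 - (1 - Phi t) ^+ m.+2.
transitivity (int0y e).
  by apply: eq_integral => t _; rewrite PhiN /e; congr _%:E; ring.
pose c : R := m.+2%:R * m.+1%:R; have c0 : 0 <= c by rewrite mulr_ge0.
pose f (t : R) := phi t ^+ 2 * (Phi t ^+ m + (1 - Phi t) ^+ m).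
have f0 t : 0 <= f t.
  have /andP[a _] := q01 t; have /andP[b _] := q01' t.
  by rewrite mulr_ge0 ?sqr_ge0// addr_ge0// exprn_ge0.
have cf : continuous f.
  apply: continuous_mul; first exact/continuous_pow/continuous_phi.
  by move=> t; apply: cvgD; [exact: cPhiX|exact: cPhi1X].
(* The boundary term of both integrations by parts; it vanishes at 0 and, by
   [Phi_tail], at infinity. *)
pose F (t : R) := t * e t - m.+2%:R * (phi t * (Phi t ^+ m.+1 - (1 - Phi t) ^+ m.+1)).
have e0 t : 0 <= e t.
  by have := addr_ge0 (g0 t) (g0 (- t)); rewrite PhiN /e; lra.
have ce : continuous e.
  move=> t; apply: cvgB; last exact: cPhi1X.
  by apply: cvgB; [exact: cvg_cst|exact: cPhiX].
have dF (t : R) : is_derive t 1 F (e t - c * f t).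
  have dq1 : is_derive t 1 (fun t : R => 1 - Phi t) _ :=
    is_derive_sub (is_derive_cst (1 : R) t 1) (is_derive_Phi t).
  have dpow k := is_derive_pow k (is_derive_Phi t).
  have dpow1 k := is_derive_pow k dq1.
  have de : is_derive t 1 e _ :=
    is_derive_sub (is_derive_sub (is_derive_cst (1 : R) t 1) (dpow m.+2)) (dpow1 m.+2).
  apply: is_derive_eq (is_derive_sub (is_derive_mul (is_derive_id t 1) de)
    (is_derive_scale m.+2%:R (is_derive_mul (is_derive_phi t)
      (is_derive_sub (dpow m.+1) (dpow1 m.+1))))) _.
  rewrite /c /f /=; ring.
have Fy : F t @[t --> +oo] --> (0 : R).
  have lim0 : m.+2%:R * 2 * @phi R t @[t --> +oo] --> (0 : R).
    rewrite -[X in _ --> X](mulr0 (m.+2%:R * 2)); apply: cvgM; first exact: cvg_cst.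
    exact: cvgy_phi.
  apply: (@squeeze_cvgr _ _ _ _ (fun t => - (m.+2%:R * 2 * phi t)) (fun t => m.+2%:R * 2 * phi t)) => //.
  - near=> t.
    have t0 : 0 < t by near: t; exact: nbhs_pinfty_gt.
    have /andP[a1 a2] := q01 t; have /andP[b1 b2] := q01' t.
    have te : t * e t <= m.+2%:R * phi t.
      have h1 := Phi_tail t0; have h2 := one_sub_pow_le m.+2 (q01 t).
      have h3 : 0 <= (1 - Phi t) ^+ m.+2 by rewrite exprn_ge0.
      apply: (@le_trans _ _ (t * (m.+2%:R * (1 - Phi t)))).
        by rewrite ler_pM2l// /e; lra.
      by rewrite mulrCA ler_wpM2l.
    have te0 : 0 <= t * e t by rewrite mulr_ge0// ltW.
    have x0 : 0 <= Phi t ^+ m.+1 by rewrite exprn_ge0.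
    have x1 : Phi t ^+ m.+1 <= 1 by rewrite exprn_ile1.
    have y0 : 0 <= (1 - Phi t) ^+ m.+1 by rewrite exprn_ge0.
    have y1 : (1 - Phi t) ^+ m.+1 <= 1 by rewrite exprn_ile1.
    have p0 := phi_gt0 t.
    have N0 : 0 <= m.+2%:R * phi t by rewrite mulr_ge0// ltW.
    rewrite /F mulrA -/(e t) ![m.+2%:R * 2 * _]mulrAC.
    move: (m.+2%:R * phi t) (Phi t ^+ m.+1) ((1 - Phi t) ^+ m.+1) (t * e t)
      N0 x0 x1 y0 y1 te te0 => N x y z N0 x0 x1 y0 y1 te te0.
    have h1 : N * (x - y) <= N by rewrite -[leRHS]mulr1 ler_wpM2l//; lra.
    have h2 : - N <= N * (x - y) by rewrite -[leLHS]mulrN1 ler_wpM2l//; lra.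
    by apply/andP; split; lra.
  - by rewrite -oppr0; exact: cvgN.
have cfE := integral0yZ c0 (fun t _ => f0 t) cf HB.
have ccf : continuous (fun t => c * f t) by move=> t; apply: cvgM; [exact: cvg_cst|exact: cf].
rewrite (integral0y_by_parts e0 (fun t => mulr_ge0 c0 (f0 t)) ce ccf dF Fy cfE).
congr _%:E; rewrite addr0 -[RHS]subr0; congr (_ - _).
by rewrite /F mul0r Phi0 (_ : 1 - 2^-1 = 2^-1) ?subrr ?mulr0 ?subr0//; field.
Unshelve. all: end_near.
Qed.

(** * The expected norm and the integral formula *)

(** Integrating out [r] replaces the square root in the norm by Gaussian weights
whose expectation is known. *)
Lemma enorm_gauss_integral (R : realType) (n : nat) (x : 'rV[R]_n) :
  (\int[lebesgue_measure]_r (dotp x x * expR (- (r ^+ 2 * dotp x x / 2)))%:E =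
   (Num.sqrt (2 * pi) * enorm x)%:E)%E.
Proof.
have d0 := dotp_ge0 x; have [dx|dx] := eqVneq (dotp x x) 0.
  under eq_integral do rewrite dx mul0r.
  by rewrite integral0 /enorm dx sqrtr0 mulr0.
have {dx}d0 : 0 < dotp x x by rewrite lt0r dx.
pose a := dotp x x / 2; have a0 : 0 < a by rewrite divr_gt0.
have ca : continuous (fun r : R => expR (- (a * r ^+ 2))).
  exact: is_derive_continuous (is_derive_gauss a).
transitivity ((dotp x x)%:E * \int[lebesgue_measure]_r (expR (- (a * r ^+ 2)))%:E)%E.
  rewrite -ge0_integralZl ?lee_fin ?(ltW d0)//.
  - apply: eq_integral => r _; rewrite -EFinM /a; congr (_ * expR (- _))%:E.
    by rewrite -mulrA mulrC.
  - by apply/measurable_EFinP; exact: continuous_measurable_fun.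
rewrite ge0_symfun_integralT//; last first.
  by move=> r /=; rewrite sqrrN.
rewrite (_ : [set r | _] = `[0, +oo[%classic); last first.
  by apply/seteqP; split => r/=; rewrite in_itv/= andbT.
rewrite integral0y_gauss_scale// -!EFinM; congr _%:E.
rewrite [2 * _]mulrC divfK// /a invf_div mulrA [pi * 2]mulrC sqrtrM ?mulr_ge0 ?pi_ge0//.
rewrite sqrtrV ?(ltW d0)// -/(enorm x) -enorm_sqr; field.
by rewrite gt_eqF// sqrtr_gt0.
Qed.

Lemma inv_hypN (R : realType) (r : R) : inv_hyp (- r) = inv_hyp r.
Proof. by rewrite /inv_hyp sqrrN. Qed.

(** By Tonelli's theorem, the expected norm is an integral over [r] of expectations
of products over the coordinates. *)
Lemma integral_gauss_rV_enorm (R : realType) (n : nat) (c : R) :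
  int0y (fun r : R => inv_hyp r ^+ n.+2) = c%:E ->
  (\int[gauss_rV R n]_x (enorm (x : 'rV[R]_n))%:E =
   (Num.sqrt (2 / pi) * n%:R * c)%:E)%E.
Proof.
move=> hc; pose s : R := Num.sqrt (2 * pi).
have s0 : 0 < s by rewrite sqrtr_gt0 mulr_gt0// pi_gt0.
pose h (p : borel_rV R n * measurableTypeR R) : R :=
  dotp p.1 p.1 * expR (- (p.2 ^+ 2 * dotp p.1 p.1 / 2)).
have h0 p : 0 <= h p by rewrite mulr_ge0 ?dotp_ge0 ?expR_ge0.
have md : measurable_fun setT (fun p : borel_rV R n * measurableTypeR R => dotp p.1 p.1).
  by apply: measurable_dotp => i;
    exact: (measurableT_comp (@measurable_coord R n i) measurable_fst).
have mh : measurable_fun setT h.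
  apply: measurable_funM => //; apply: measurableT_comp => //.
  apply: measurableT_comp => //; apply: measurable_funM => //; apply: measurable_funM => //.
  by apply: measurable_funX; exact: measurable_snd.
have key : (s%:E * \int[gauss_rV R n]_x (enorm (x : 'rV[R]_n))%:E = (n%:R * (2 * c))%:E)%E.
  rewrite -ge0_integralZl ?lee_fin ?(ltW s0)//; last 2 first.
  - by apply/measurable_EFinP; apply: measurable_enorm => i; exact: measurable_coord.
  - by move=> x _; rewrite lee_fin enorm_ge0.
  transitivity (\int[gauss_rV R n]_x \int[lebesgue_measure]_r (h (x, r))%:E)%E.
    by apply: eq_integral => x _; rewrite enorm_gauss_integral EFinM.
  rewrite (@fubini_tonelli _ _ _ _ _ (gauss_rV R n) lebesgue_measure (EFin \o h)); last 2 first.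
  - exact/measurable_EFinP.
  - by move=> p; rewrite lee_fin.
  transitivity (\int[lebesgue_measure]_r (n%:R%:E * (@inv_hyp R r ^+ n.+2)%:E))%E.
    by apply: eq_integral => r _; rewrite /= integral_gauss_rV_sqr EFinM.
  have i0 (r : R) : 0 <= inv_hyp r ^+ n.+2 by rewrite exprn_ge0// ltW// inv_hyp_gt0.
  rewrite ge0_integralZl ?lee_fin//; last 2 first.
  - apply/measurable_EFinP; apply: continuous_measurable_fun.
    exact: continuous_inv_hyp_pow.
  - by move=> r _; rewrite lee_fin.
  rewrite ge0_symfun_integralT//; last 2 first.
  - exact: continuous_inv_hyp_pow.
  - by move=> r /=; rewrite inv_hypN.
  rewrite (_ : [set r | _] = `[0, +oo[%classic); last first.
    by apply/seteqP; split => r/=; rewrite in_itv/= andbT.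
  by rewrite hc -!EFinM.
have := congr1 (fun z => (s^-1)%:E * z)%E key.
rewrite muleA -!EFinM mulVf ?gt_eqF// mul1e => ->; congr _%:E.
have -> : Num.sqrt (2 / pi) = s^-1 * 2 :> R.
  apply: (mulfI (lt0r_neq0 s0)); rewrite mulrA mulfV ?gt_eqF// mul1r /s.
  rewrite -sqrtrM ?mulr_ge0 ?pi_ge0// mulrACA mulfV ?gt_eqF ?pi_gt0// mulr1.
  by rewrite -expr2 sqrtr_sqr ger0_norm.
by ring.
Qed.

Theorem mean_width_regular_simplex (R : realType) (m : nat)
    (sigma : probability (borel_rV R m.+1) R) (T : set 'rV[R]_m.+1) (B c : R) :
  (0 < m)%N -> rotation_invariant_sphere_probability sigma ->
  unit_regular_simplex T ->
  int0y (fun t : R => phi t ^+ 2 * (Phi t ^+ m + (1 - Phi t) ^+ m)) = B%:E ->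
  int0y (fun r : R => inv_hyp r ^+ m.+3) = c%:E -> 0 < c ->
  mean_width sigma T = m.+2%:R * Num.sqrt pi * B / (2 * c).
Proof.
move=> m0 sinv [v [v1 ->]] HB Hc c0.
have p0 : 0 < Num.sqrt pi :> R by rewrite sqrtr_gt0 pi_gt0.
have FE : (\int[gauss_rV R m.+2]_g (m.+2%:R^-1 * \sum_j
    (maxf (fun i => (g : 'rV[R]_m.+2) 0 i) - (g : 'rV[R]_m.+2) 0 j))%:E =
    (m.+2%:R * m.+1%:R * B)%:E)%E.
  by rewrite integral_gauss_rV_max (integral_PhiB HB).
have ME := integral_gauss_rV_enorm Hc.
rewrite (mean_width_simplexE _ sinv v1 FE ME) ?ltnS//; last first.
  by rewrite !mulr_gt0 ?sqrtr_gt0 ?divr_gt0 ?pi_gt0// ltr0n.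
have -> : Num.sqrt (2 / pi) = Num.sqrt 2 / Num.sqrt pi :> R.
  by rewrite sqrtrM// sqrtrV// pi_ge0.
have s2 : Num.sqrt 2 * Num.sqrt 2 = 2 :> R by rewrite -expr2 sqr_sqrtr.
have -> : Num.sqrt 2 * (Num.sqrt 2 / Num.sqrt pi * m.+1%:R * c) = 2 / Num.sqrt pi * m.+1%:R * c :> R.
  by rewrite -[in RHS]s2; ring.
have m1 : m.+1%:R != 0 :> R by rewrite pnatr_eq0.
move: (m.+2%:R) (m.+1%:R : R) m1 (Num.sqrt pi) p0 => N q q0 p p0.
by field; rewrite q0 !gt_eqF.
Qed.

(** * The power series of the normal distribution function *)

Lemma derive_ge0_le (R : realType) (F f : R -> R) (b : R) :
  continuous f -> (forall x : R, is_derive x 1 F (f x)) ->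
  (forall x : R, 0 <= x -> 0 <= f x) -> 0 <= b -> F 0 <= F b.
Proof.
move=> cf dF f0 b0; rewrite -subr_ge0 -lee_fin -(FTC2_segment b0 cf dF).
by apply: integral_ge0 => x /=; rewrite in_itv/= lee_fin => /andP[/f0].
Qed.

(** The double factorial (2 k + 1)!!. *)
Definition odd_fact (R : realType) (k : nat) : R := \prod_(i < k.+1) (2 * i + 1)%:R.

Lemma odd_fact0 (R : realType) : odd_fact R 0 = 1.
Proof. by rewrite /odd_fact big_ord1. Qed.

Lemma odd_factS (R : realType) (k : nat) :
  odd_fact R k.+1 = odd_fact R k * (2 * k.+1 + 1)%:R.
Proof. by rewrite /odd_fact big_ord_recr. Qed.

Lemma odd_fact_gt0 (R : realType) (k : nat) : 0 < odd_fact R k.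
Proof. by apply: prodr_gt0 => i _; rewrite ltr0n addn1. Qed.

Definition odd_series (R : realType) (K : nat) (t : R) : R :=
  \sum_(k < K.+1) t ^+ (2 * k + 1) / odd_fact R k.

(** The full series solves [P' = 1 + t * P], so that [phi * P] is a primitive of
[phi]; the truncation misses one monomial. *)
Lemma is_derive_odd_series (R : realType) (K : nat) (t : R) :
  is_derive t 1 (odd_series K)
    (1 + t * odd_series K t - t ^+ (2 * K + 2) / odd_fact R K).
Proof.
have dX k : is_derive t 1 (fun t : R => t ^+ (2 * k + 1) / odd_fact R k)
    ((2 * k + 1)%:R * t ^+ (2 * k) / odd_fact R k).
  have h := is_derive_scale (odd_fact R k)^-1 (is_derive_pow (2 * k + 1) (is_derive_id t 1)).
  rewrite (_ : (fun t : R => _) = fun t => (odd_fact R k)^-1 * t ^+ (2 * k + 1)).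
    by apply: is_derive_eq h _; rewrite addn1/=; ring.
  by apply/funext => x; rewrite mulrC.
elim: K => [|K IH].
  rewrite (_ : odd_series 0 = fun t : R => t ^+ (2 * 0 + 1) / odd_fact R 0); last first.
    by apply/funext => x; rewrite /odd_series big_ord1.
  apply: is_derive_eq (dX 0%N) _.
  by rewrite !odd_fact0 muln0; field.
rewrite (_ : odd_series K.+1 = fun t : R => odd_series K t + t ^+ (2 * K.+1 + 1) / odd_fact R K.+1); last first.
  by apply/funext => x; rewrite /odd_series big_ord_recr.
apply: is_derive_eq (is_derive_add IH (dX K.+1)) _.
rewrite odd_factS (_ : (2 * K.+1 = (2 * K).+2)%N) ?mulnS// ?addn1 ?addn2.
have e := odd_fact_gt0 R K; move: (odd_series K t) (odd_fact R K) e => S D D0.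
have n0 : 0 < (2 * K).+3%:R :> R by rewrite ltr0n.
rewrite !exprSr.
move: ((2 * K).+3%:R : R) n0 (t ^+ (2 * K)) => n n0 y.
by field; rewrite !gt_eqF.
Qed.

Section normal_series.
Variables (R : realType) (K : nat).
Implicit Types t : R.

Let gap t : R := Phi t - 2^-1 - phi t * odd_series K t.

Lemma gap0 : gap 0 = 0.
Proof.
rewrite /gap Phi0 subrr sub0r /odd_series big1 ?mulr0 ?oppr0// => i _.
by rewrite addn1 expr0n mul0r.
Qed.

Lemma is_derive_gap t :
  is_derive t 1 gap (phi t * (t ^+ (2 * K + 2) / odd_fact R K)).
Proof.
have d := is_derive_sub (is_derive_sub (is_derive_Phi t) (is_derive_cst (2^-1 : R) t 1))
  (is_derive_mul (is_derive_phi t) (is_derive_odd_series K t)).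
by apply: is_derive_eq d _; ring.
Qed.

Lemma continuous_gap_derive :
  continuous (fun t => phi t * (t ^+ (2 * K + 2) / odd_fact R K)).
Proof.
move=> t; apply: cvgM; first exact: continuous_phi.
by apply: cvgM; [exact: exprn_continuous|exact: cvg_cst].
Qed.

Lemma Phi_series_lower t : 0 <= t -> phi t * odd_series K t <= Phi t - 2^-1.
Proof.
move=> t0; rewrite -subr_ge0 -[leRHS]/(gap t) -gap0.
apply: derive_ge0_le continuous_gap_derive is_derive_gap _ t0 => x x0.
by rewrite mulr_ge0 ?(ltW (phi_gt0 _))// divr_ge0 ?exprn_ge0// ltW// odd_fact_gt0.
Qed.

(** The derivative of the truncation error is [phi t * t ^ (2 K + 2) / (2 K + 1)!!], and
[phi] is at most its value at 0. *)
Lemma Phi_series_upper t : 0 <= t ->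
  Phi t - 2^-1 <= phi t * odd_series K t +
                  normal_peak 1 * (t ^+ (2 * K + 3) / odd_fact R K.+1).
Proof.
move=> t0; pose F t := normal_peak 1 * (t ^+ (2 * K + 3) / odd_fact R K.+1) - gap t.
suff : F 0 <= F t by rewrite /F gap0 expr0n !addnS/= mul0r mulr0 subr0 /gap; lra.
have D0 := odd_fact_gt0 R K; have n0 : (2 * K + 3)%:R != 0 :> R by rewrite pnatr_eq0 addnS.
apply: (@derive_ge0_le _ F (fun x => normal_peak 1 * (x ^+ (2 * K + 2) / odd_fact R K) -
   phi x * (x ^+ (2 * K + 2) / odd_fact R K))) t0.
- move=> x; apply: cvgB; last exact: continuous_gap_derive.
  apply: cvgM; first exact: cvg_cst.
  by apply: cvgM; [exact: exprn_continuous|exact: cvg_cst].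
- move=> x; apply: is_derive_sub (is_derive_gap x).
  apply: is_derive_eq (is_derive_scale _ (is_derive_mul
    (is_derive_pow (2 * K + 3) (is_derive_id x 1)) (is_derive_cst ((odd_fact R K.+1)^-1) x 1))) _.
  rewrite odd_factS (_ : (2 * K.+1 + 1 = 2 * K + 3)%N); last by lia.
  rewrite (_ : (2 * K + 3).-1 = (2 * K + 2)%N); last by lia.
  rewrite mulr1 mulr0 addr0 [cst _ x]/=.
  move: ((2 * K + 3)%:R : R) n0 (odd_fact R K) D0 => n n0 D D0.
  by field; rewrite n0 gt_eqF.
- move=> x x0; rewrite -mulrBl mulr_ge0//.
    rewrite phiE subr_ge0 ler_piMr// ?(ltW (normal_peak_gt0 _))//.
    by rewrite -[leRHS]expR0 ler_expR oppr_le0 mulr_ge0// sqr_ge0.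
  by rewrite divr_ge0 ?exprn_ge0// ltW.
Qed.

End normal_series.

(** * Symmetric powers *)

Definition sym_pow (R : realType) (m : nat) (y : R) : R :=
  (2^-1 + y) ^+ m + (2^-1 - y) ^+ m.

(** The difference of the two values is [z - y] times a sum of [m] terms, each the
difference of a larger and a smaller product of numbers in [[0, 1]]. *)
Lemma sym_pow_lip (R : realType) (m : nat) (y z : R) :
  0 <= y -> y <= z -> z <= 2^-1 ->
  sym_pow m y <= sym_pow m z <= sym_pow m y + m%:R * (z - y).
Proof.
move=> y0 yz z2.
have -> : sym_pow m z = sym_pow m y + (z - y) *
    \sum_(i < m) ((2^-1 + z) ^+ (m.-1 - i) * (2^-1 + y) ^+ i -
                  (2^-1 - y) ^+ (m.-1 - i) * (2^-1 - z) ^+ i).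
  rewrite sumrB mulrBr.
  have e1 : (z - y) * \sum_(i < m) (2^-1 + z) ^+ (m.-1 - i) * (2^-1 + y) ^+ i =
            (2^-1 + z) ^+ m - (2^-1 + y) ^+ m.
    rewrite subrXX (_ : 2^-1 + z - (2^-1 + y) = z - y); last by ring.
    by congr (_ * _); apply: eq_bigr => i _; rewrite -predn_sub subn1 -subnS.
  have e2 : (z - y) * \sum_(i < m) (2^-1 - y) ^+ (m.-1 - i) * (2^-1 - z) ^+ i =
            (2^-1 - y) ^+ m - (2^-1 - z) ^+ m.
    rewrite subrXX (_ : 2^-1 - y - (2^-1 - z) = z - y); last by ring.
    by congr (_ * _); apply: eq_bigr => i _; rewrite -predn_sub subn1 -subnS.
  by rewrite e1 e2 /sym_pow; ring.
have zy : 0 <= z - y by rewrite subr_ge0.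
rewrite lerDl lerD2l mulr_ge0//=; last first.
  apply: sumr_ge0 => i _; rewrite subr_ge0 ler_pM// ?exprn_ge0//; try lra.
    by apply: lerXn2r; rewrite ?nnegrE; lra.
  by apply: lerXn2r; rewrite ?nnegrE; lra.
rewrite mulrC ler_wpM2r//.
rewrite (@le_trans _ _ (\sum_(i < m) 1))//; last by rewrite sumr_const card_ord.
apply: ler_sum => i _; rewrite lerBlDr ler_wpDr//.
  by rewrite mulr_ge0// exprn_ge0//; lra.
by rewrite mulr_ile1 ?exprn_ge0 ?exprn_ile1//; lra.
Qed.

Lemma phi_sqrE (R : realType) (j : nat) (t : R) :
  phi t ^+ (2 * j) = normal_peak 1 ^+ (2 * j) * expR (- (j%:R * t ^+ 2)).
Proof.
rewrite phiE exprMn -expRM_natl; congr (_ * expR _).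
by rewrite natrM; field.
Qed.

Lemma normal_peak1_sqr (R : realType) : normal_peak 1 ^+ 2 = (2 * pi)^-1 :> R.
Proof.
rewrite /normal_peak expr1n mul1r exprVn -[pi *+ 2]mulr_natl sqr_sqrtr//.
by rewrite mulr_ge0 ?pi_ge0.
Qed.

(** * Truncating the power series *)

Lemma continuous_sym_pow (R : realType) (f : R -> R) (m : nat) :
  continuous f -> continuous (fun t => sym_pow m (f t)).
Proof.
move=> cf t; apply: cvgD.
  apply: (@continuous_pow _ (fun t => 2^-1 + f t) m) => {}t.
  by apply: cvgD; [exact: cvg_cst|exact: cf].
apply: (@continuous_pow _ (fun t => 2^-1 - f t) m) => {}t.
by apply: cvgB; [exact: cvg_cst|exact: cf].
Qed.

Lemma prod_odd_half (R : realType) (k : nat) :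
  \prod_(j < k.+1) ((2 * j + 1)%:R / (2 * 1)) = odd_fact R k / 2 ^+ k.+1.
Proof.
by rewrite big_split/= prodr_const card_ord mulr1 exprVn.
Qed.

Lemma pow_odd_le (R : realType) (k : nat) (t : R) : 0 <= t ->
  2 * t ^+ (2 * k + 1) <= t ^+ (2 * k) + t ^+ (2 * k.+1).
Proof.
move=> t0; rewrite -subr_ge0.
have -> : t ^+ (2 * k) + t ^+ (2 * k.+1) - 2 * t ^+ (2 * k + 1) = t ^+ (2 * k) * (1 - t) ^+ 2.
  by rewrite (_ : (2 * k.+1 = 2 * k + 2)%N) ?mulnS 1?addnC// !exprD expr1; ring.
by apply: mulr_ge0; [exact: exprn_ge0|exact: sqr_ge0].
Qed.

(** The odd power of [t] in the error of [Phi_series_upper] is bounded by the mean of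
the two neighbouring even powers, whose Gaussian moments are known. *)
Definition truncation_majorant (R : realType) (K : nat) (t : R) : R :=
  normal_peak 1 ^+ 3 / (2 * odd_fact R K.+1) *
    (t ^+ (2 * K.+1) * expR (- (1 * t ^+ 2)) +
     t ^+ (2 * K.+2) * expR (- (1 * t ^+ 2))).

Lemma truncation_error (R : realType) (K : nat) :
  exists2 E : R,
    int0y (@truncation_majorant R K) = E%:E &
    Num.sqrt pi * E <= (2 ^+ (K + 5))^-1.
Proof.
have k0 : 0 < normal_peak 1 :> R by rewrite normal_peak_gt0// oner_neq0.
have h i : int0y (fun t : R => _) = _ := integral0y_moment i (ltr01 : 0 < (1 : R)).
have g0 i (x : R) : 0 <= x -> 0 <= x ^+ (2 * i) * expR (- (1 * x ^+ 2)).
  by move=> _; exact: even_moment_ge0.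
have D0 := odd_fact_gt0 R K.
have I := integral0yD (g0 K.+1) (g0 K.+2) (@continuous_pow_gauss R 1 _)
  (@continuous_pow_gauss R 1 _) (h K.+1) (h K.+2).
eexists.
  apply: integral0yZ I => //.
  - by rewrite divr_ge0 ?exprn_ge0 ?mulr_ge0// ltW// odd_fact_gt0.
  - by move=> x x0; rewrite addr_ge0// g0.
  - by move=> x; apply: cvgD; exact: continuous_pow_gauss.
rewrite !prod_odd_half odd_factS divr1.
(* With [normal_peak 1 = 1 / sqrt (2 pi)], the constant of the error is at most
   [1 / 4], which leaves only powers of 2. *)
have kp : normal_peak 1 ^+ 3 * pi = normal_peak 1 / 2 :> R.
  rewrite exprS normal_peak1_sqr; have := pi_gt0 R; move: pi (normal_peak 1) => p k p0.
  by field; rewrite gt_eqF.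
have k2 : normal_peak 1 <= 2^-1 :> R.
  rewrite -ler_sqr ?nnegrE ?(ltW k0)// normal_peak1_sqr exprVn lef_pV2 ?posrE ?exprn_gt0 ?mulr_gt0 ?pi_gt0//.
  by have := pi_ge2 R; lra.
have sp : Num.sqrt pi * Num.sqrt pi = pi :> R by rewrite -expr2 sqr_sqrtr// pi_ge0.
rewrite addrC (exprS 2 K.+1) (exprS 2 K) exprD.
have n3 : 3 <= (2 * K.+1 + 1)%:R :> R by rewrite ler_nat; lia.
have q0 : 0 < 2 ^+ K :> R by rewrite exprn_gt0.
move: (odd_fact R K) D0 (2 ^+ K) q0 ((2 * K.+1 + 1)%:R : R) n3 => D D0 q q0 n n3.
set s := Num.sqrt pi in sp *.
have n0 : 0 < n by lra.
have -> : s * (normal_peak 1 ^+ 3 / (2 * (D * n)) *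
    (s / 2 * (D * n / (2 * (2 * q))) + s / 2 * (D / (2 * q)))) =
    (normal_peak 1 ^+ 3 * (s * s)) / (8 * q) * (2^-1 + n^-1).
  by field; rewrite !gt_eqF.
rewrite sp kp [leRHS]invfM (_ : normal_peak 1 / 2 / (8 * q) * _ =
  q^-1 * (normal_peak 1 * (2^-1 + n^-1) / 16)); last by field; rewrite !gt_eqF.
rewrite ler_wpM2l ?invr_ge0 ?(ltW q0)//.
have ni : n^-1 <= 2^-1 by rewrite lef_pV2 ?posrE//; lra.
have : normal_peak 1 * (2^-1 + n^-1) <= 2^-1 * 1.
  rewrite ler_pM ?(ltW k0)//; last by lra.
  by rewrite addr_ge0// invr_ge0 ltW.
lra.
Qed.

(** By [Phi_series_lower], [Phi_series_upper] and [sym_pow_lip], the integrand lies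
between its truncation and the truncation plus [m] times the majorant. *)
Lemma PhiB_truncation (R : realType) (m K : nat) (B0 : R) :
  int0y (fun t : R => phi t ^+ 2 * sym_pow m (phi t * odd_series K t)) = B0%:E ->
  exists2 B, int0y (fun t : R => phi t ^+ 2 * (Phi t ^+ m + (1 - Phi t) ^+ m)) = B%:E &
    B0 <= B /\ Num.sqrt pi * (B - B0) <= m%:R / 2 ^+ (K + 5).
Proof.
move=> hB0; have [E hE EK] := truncation_error R K.
set e := @truncation_majorant R K in hE.
pose f (t : R) := phi t ^+ 2 * (Phi t ^+ m + (1 - Phi t) ^+ m).
pose f0 (t : R) := phi t ^+ 2 * sym_pow m (phi t * odd_series K t).
have fE t : f t = phi t ^+ 2 * sym_pow m (Phi t - 2^-1).
  by rewrite /f /sym_pow; congr (_ * (_ ^+ _ + _ ^+ _)); lra.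
have k0 : 0 < normal_peak 1 :> R by rewrite normal_peak_gt0// oner_neq0.
have bnd t : 0 <= t -> [/\ 0 <= f0 t, f0 t <= f t & f t <= f0 t + m%:R * e t].
  move=> t0; have lo := Phi_series_lower K t0; have up := Phi_series_upper K t0.
  have q0 : 0 <= phi t * odd_series K t.
    rewrite mulr_ge0 ?(ltW (phi_gt0 _))// sumr_ge0// => i _.
    by rewrite divr_ge0 ?exprn_ge0// ltW// odd_fact_gt0.
  have h2 : Phi t - 2^-1 <= 2^-1 by have := Phi_le1 t; lra.
  have /andP[l1 l2] := sym_pow_lip m q0 lo h2.
  have p0 : 0 <= phi t ^+ 2 by rewrite sqr_ge0.
  split.
  - by rewrite mulr_ge0// addr_ge0// exprn_ge0//; lra.
  - by rewrite fE ler_wpM2l.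
  rewrite fE; apply: le_trans (ler_wpM2l p0 l2) _.
  rewrite mulrDr lerD2l mulrCA ler_wpM2l//.
  apply: (@le_trans _ _ (phi t ^+ 2 * (normal_peak 1 * (t ^+ (2 * K + 3) / odd_fact R K.+1)))).
    by rewrite ler_wpM2l//; lra.
  rewrite (@phi_sqrE _ 1) /e /truncation_majorant; have := pow_odd_le K.+1 t0.
  rewrite (_ : (2 * K.+1 + 1 = 2 * K + 3)%N); last by lia.
  move: (t ^+ (2 * K + 3)) (t ^+ (2 * K.+1)) (t ^+ (2 * K.+2)) => a b c abc.
  rewrite (_ : normal_peak 1 ^+ 3 / _ * _ = expR (- (1 * t ^+ 2)) * normal_peak 1 ^+ 3
    / odd_fact R K.+1 * ((b + c) / 2)); last first.
    by have := odd_fact_gt0 R K.+1; move: (odd_fact R K.+1) => D D0; field; rewrite gt_eqF.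
  rewrite [leLHS](_ : _ = expR (- (1 * t ^+ 2)) * normal_peak 1 ^+ 3
    / odd_fact R K.+1 * a); last by ring.
  rewrite ler_wpM2l//; last by lra.
  by rewrite mulr_ge0// ?invr_ge0 ?(ltW (odd_fact_gt0 _ _))// mulr_ge0 ?expR_ge0// exprn_ge0// ltW.
have cphi2 : continuous (fun t : R => phi t ^+ 2) by apply: continuous_pow; exact: continuous_phi.
have codd : continuous (@odd_series R K).
  by apply: is_derive_continuous => x; exact: is_derive_odd_series.
have cf0 : continuous f0.
  apply: continuous_mul => //; apply: continuous_sym_pow.
  by apply: continuous_mul => //; exact: continuous_phi.
have cf : continuous f.
  rewrite (_ : f = fun t => phi t ^+ 2 * sym_pow m (Phi t - 2^-1)); last exact/funext.
  apply: continuous_mul => //; apply: continuous_sym_pow => t.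
  by apply: cvgB; [exact: continuous_Phi|exact: cvg_cst].
have ce : continuous e.
  apply: continuous_mul => t; first exact: cvg_cst.
  by apply: cvgD; exact: continuous_pow_gauss.
have e0 t : 0 <= e t.
  apply: mulr_ge0; first by rewrite divr_ge0 ?exprn_ge0 ?mulr_ge0// ltW// odd_fact_gt0.
  by rewrite addr_ge0// even_moment_ge0.
have cme : continuous (fun t => m%:R * e t) by apply: continuous_mul => // t; exact: cvg_cst.
have hmE := integral0yZ (ler0n R m) (fun x _ => e0 x) ce hE.
have hs : int0y (fun x => f0 x + m%:R * e x) = (B0 + m%:R * E)%:E.
  apply: integral0yD => //; first by move=> x /bnd[].
  by move=> x _; rewrite mulr_ge0.
have le1 : (B0%:E <= int0y f)%E.
  by rewrite -hB0; apply: integral0y_le => // x /bnd[-> ->].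
have le2 : (int0y f <= (B0 + m%:R * E)%:E)%E.
  rewrite -hs; apply: integral0y_le => //; last by move=> t; apply: cvgD; [exact: cf0|exact: cme].
  by move=> x /bnd[a b c]; rewrite c andbT (le_trans a b).
have ffin : int0y f \is a fin_num.
  by rewrite fin_numE; apply/andP; split; apply/eqP => h; move: le1 le2; rewrite h.
exists (fine (int0y f)); first by rewrite -[LHS](fineK ffin).
move: le1 le2; rewrite -(fineK ffin) !lee_fin/= => le1 le2; split => //.
apply: (@le_trans _ _ (m%:R * (Num.sqrt pi * E))); last by rewrite ler_wpM2l.
by rewrite mulrCA ler_wpM2l ?sqrtr_ge0//; lra.
Qed.

(** * Two-sided bounds by moments *)

(** Horner's scheme for the moments: up to the common factor of [integral0y_moment],
this is the integral of [t ^ (2 i)] times the polynomial with coefficients [s]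
at [t ^ 2], against [expR (- (a * t ^ 2))]. *)
Fixpoint gauss_moment (R : realType) (a : R) (i : nat) (s : seq R) : R :=
  if s is c :: s' then c + (2 * i + 1)%:R / (2 * a) * gauss_moment a i.+1 s' else 0.

Lemma horner_rec_ge0 (R : realType) (s : seq R) (x : R) :
  all (>= 0) s -> 0 <= x -> 0 <= horner_rec s x.
Proof.
by move=> + x0; elim: s => //= c s IH /andP[c0 /IH h]; rewrite addr_ge0// mulr_ge0.
Qed.

Lemma continuous_horner_rec (R : realType) (s : seq R) :
  continuous (fun x : R => horner_rec s x).
Proof.
elim: s => [|c s IH] x /=; first exact: cvg_cst.
by apply: cvgD; [apply: cvgM; [exact: IH|exact: cvg_id]|exact: cvg_cst].
Qed.

Lemma integral0y_horner_gauss (R : realType) (a : R) (i : nat) (s : seq R) :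
  0 < a -> all (>= 0) s ->
  int0y (fun t => t ^+ (2 * i) * horner_rec s (t ^+ 2) * expR (- (a * t ^+ 2))) =
  (Num.sqrt (pi / a) / 2 * \prod_(j < i) ((2 * j + 1)%:R / (2 * a)) *
   gauss_moment a i s)%:E.
Proof.
move=> a0; elim: s i => [|c s IH] i /=.
  move=> _; rewrite mulr0; apply: integral0_eq => x _ /=.
  by rewrite mulr0 mul0r.
move=> /andP[c0 s0].
transitivity (int0y (fun t => c * (t ^+ (2 * i) * expR (- (a * t ^+ 2))) +
   t ^+ (2 * i.+1) * horner_rec s (t ^+ 2) * expR (- (a * t ^+ 2)))).
  apply: eq_integral => t _; congr _%:E.
  by rewrite (_ : (2 * i.+1 = 2 * i + 2)%N) ?exprD; [ring|lia].
have cs (k : nat) : continuous (fun t : R => t ^+ (2 * k) * horner_rec s (t ^+ 2) * expR (- (a * t ^+ 2))).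
  rewrite (_ : (fun t => _) = fun t => t ^+ (2 * k) * expR (- (a * t ^+ 2)) * horner_rec s (t ^+ 2)).
    apply: continuous_mul; first exact: continuous_pow_gauss.
    move=> t; apply: (@cvg_comp _ _ _ (fun t : R => t ^+ 2) (horner_rec s)).
      exact: exprn_continuous.
    exact: continuous_horner_rec.
  by apply/funext => t; rewrite mulrAC.
have g0 (x : R) : 0 <= x -> 0 <= x ^+ (2 * i) * expR (- (a * x ^+ 2)).
  by move=> _; exact: even_moment_ge0.
have h := integral0yZ c0 g0 (@continuous_pow_gauss R a _) (integral0y_moment i a0).
rewrite (integral0yD _ _ _ (cs i.+1) h (IH i.+1 s0)); last 3 first.
- by move=> x x0; rewrite mulr_ge0// g0.
- by move=> x x0; rewrite !mulr_ge0 ?expR_ge0 ?exprn_ge0// horner_rec_ge0// exprn_ge0.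
- by apply: continuous_mul; [move=> t; exact: cvg_cst|exact: continuous_pow_gauss].
by rewrite big_ord_recr/=; congr _%:E; ring.
Qed.

(** In the truncated integrand the term of degree [2 j] is a constant times
[odd_series K t ^ (2 j) * expR (- (j + 1) * t ^ 2)], because [phi ^ (2 j + 2)] is
again Gaussian. *)
Theorem mean_width_bounds (R : realType) (m K : nat)
    (sigma : probability (borel_rV R m.+1) R) (T : set 'rV[R]_m.+1)
    (n : nat) (a A : nat -> R) (c W : R) :
  (0 < m)%N -> rotation_invariant_sphere_probability sigma ->
  unit_regular_simplex T ->
  (forall y : R, sym_pow m y = \sum_(j < n) a j * y ^+ (2 * j)) ->
  (forall j, 0 <= a j) ->
  (forall j, int0y (fun t => odd_series K t ^+ (2 * j) * expR (- (j.+1%:R * t ^+ 2))) =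
     (Num.sqrt (pi / j.+1%:R) / 2 * A j)%:E) ->
  int0y (fun r : R => inv_hyp r ^+ m.+3) = c%:E -> 0 < c ->
  \sum_(j < n) a j * (2 * pi) ^- j * A j / Num.sqrt j.+1%:R = W ->
  m.+2%:R / (8 * c) * W <= mean_width sigma T <=
  m.+2%:R / (8 * c) * W + m.+2%:R / (2 * c) * (m%:R / 2 ^+ (K + 5)).
Proof.
move=> m0 sinv unitT Ea a0 hA hc c0 hW.
have codd : continuous (@odd_series R K).
  by apply: is_derive_continuous => x; exact: is_derive_odd_series.
pose b j : R := normal_peak 1 ^+ (2 * j.+1) * a j.
have b0 j : 0 <= b j by rewrite mulr_ge0// exprM exprn_ge0 ?sqr_ge0.
pose g j (t : R) := odd_series K t ^+ (2 * j) * expR (- (j.+1%:R * t ^+ 2)).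
have g0 j t : 0 <= g j t by rewrite mulr_ge0 ?expR_ge0// exprM exprn_ge0// sqr_ge0.
have cg j : continuous (g j).
  apply: continuous_mul; first exact: continuous_pow.
  move=> t; have := @continuous_pow_gauss R j.+1%:R 0 t.
  by rewrite (_ : (fun x => _) = fun x => expR (- (j.+1%:R * x ^+ 2)))// funeqE => x; rewrite expr0 mul1r.
have hB0 : int0y (fun t : R => phi t ^+ 2 * sym_pow m (phi t * odd_series K t)) =
    (\sum_(j < n) b j * (Num.sqrt (pi / j.+1%:R) / 2 * A j))%:E.
  transitivity (int0y (fun t => \sum_(j < n) b j * g j t)); last first.
    apply: integral0y_sum.
    - by move=> j x _; rewrite mulr_ge0.
    - by move=> j; apply: continuous_mul => // t; exact: cvg_cst.
    - by move=> j; apply: integral0yZ => //; exact: hA.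
  apply: eq_integral => t _; congr _%:E; rewrite Ea mulr_sumr; apply: eq_bigr => j _.
  rewrite exprMn [LHS](_ : _ = phi t ^+ (2 * j.+1) * (a j * odd_series K t ^+ (2 * j))).
    by rewrite phi_sqrE /b /g; ring.
  by rewrite mulnS exprD; ring.
have [B hB [B1 B2]] := PhiB_truncation hB0.
rewrite (mean_width_regular_simplex m0 sinv unitT hB hc c0).
set B0 := \sum_(j < n) _ in B1 B2.
have s0 : 0 < Num.sqrt pi :> R by rewrite sqrtr_gt0 pi_gt0.
have WE : Num.sqrt pi * B0 = W / 4.
  rewrite /B0 -hW mulr_sumr mulr_suml; apply: eq_bigr => j _.
  rewrite /b exprM normal_peak1_sqr sqrtrM ?pi_ge0// sqrtrV// exprS.
  have sj : 0 < Num.sqrt j.+1%:R :> R by rewrite sqrtr_gt0 ltr0n.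
  have sp : Num.sqrt pi * Num.sqrt pi = pi :> R by rewrite -expr2 sqr_sqrtr// pi_ge0.
  rewrite [LHS](_ : _ = (2 * pi)^-1 * (Num.sqrt pi * Num.sqrt pi) * a j * (2 * pi)^-1 ^+ j * A j / Num.sqrt j.+1%:R / 2); last by ring.
  rewrite sp exprVn; have := pi_gt0 R; move: (pi : R) => p p0.
  have : 0 < (2 * p) ^+ j by rewrite exprn_gt0// mulr_gt0.
  by move: ((2 * p) ^+ j) => q q0; field; rewrite !gt_eqF.
have k0 : 0 < m.+2%:R / (2 * c) :> R by rewrite divr_gt0 ?mulr_gt0.
have -> : m.+2%:R * Num.sqrt pi * B / (2 * c) = m.+2%:R / (2 * c) * (Num.sqrt pi * B).
  by move: (pi : R) => p; field; rewrite gt_eqF.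
have -> : m.+2%:R / (8 * c) * W = m.+2%:R / (2 * c) * (Num.sqrt pi * B0).
  by rewrite WE; field; rewrite gt_eqF.
rewrite -mulrDr !ler_pM2l// B1/=; lra.
Qed.

(** * Bounds for pi *)

Definition atan_series (R : realType) (n : nat) (x : R) : R :=
  \sum_(k < n) (-1) ^+ k * x ^+ (2 * k + 1) / (2 * k + 1)%:R.

(** A geometric sum. *)
Lemma is_derive_atan_series (R : realType) (n : nat) (x : R) :
  is_derive x 1 (atan_series n) ((1 - (- x ^+ 2) ^+ n) / (1 + x ^+ 2)).
Proof.
have x1 : 1 + x ^+ 2 != 0 by rewrite gt_eqF// ltr_pwDl// sqr_ge0.
elim: n => [|n IH].
  rewrite (_ : atan_series 0 = cst (0 : R)); last first.
    by apply/funext => y; rewrite /atan_series big_ord0.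
  by apply: is_derive_eq (is_derive_cst (0 : R) x 1) _; rewrite subrr mul0r.
rewrite (_ : atan_series n.+1 = fun x : R => atan_series n x +
    ((-1) ^+ n / (2 * n + 1)%:R) * x ^+ (2 * n + 1)); last first.
  by apply/funext => y; rewrite /atan_series big_ord_recr/= mulrAC.
apply: is_derive_eq (is_derive_add IH (is_derive_scale _
  (is_derive_pow (2 * n + 1) (is_derive_id x 1)))) _.
rewrite [(- x ^+ 2) ^+ n.+1]exprS addn1/= exprM [(- x ^+ 2) ^+ n]exprNn mulr1.
have n0 : (2 * n).+1%:R != 0 :> R by rewrite pnatr_eq0.
move: ((2 * n).+1%:R : R) n0 ((-1) ^+ n) ((x ^+ 2) ^+ n) => k k0 s y.
by field; rewrite k0 x1.
Qed.

(** The derivative of the signed error is [x ^ (2 n) / (1 + x ^ 2)], which is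
nonnegative. *)
Lemma atan_series_sign (R : realType) (n : nat) (x : R) : 0 <= x ->
  0 <= (-1) ^+ n * (atan x - atan_series n x).
Proof.
move=> x0; pose F (x : R) := (-1) ^+ n * (atan x - atan_series n x).
have -> : 0 = F 0.
  rewrite /F atan0 /atan_series big1 ?subrr ?mulr0// => i _.
  by rewrite addn1 expr0n mulr0 mul0r.
have p1 (y : R) : 0 < 1 + y ^+ 2 by rewrite ltr_pwDl// sqr_ge0.
apply: (@derive_ge0_le _ F (fun y => y ^+ (2 * n) / (1 + y ^+ 2))) x0.
- apply: continuous_mul; first exact: exprn_continuous.
  move=> y; apply: cvgV; first by rewrite gt_eqF.
  by apply: cvgD; [exact: cvg_cst|exact: exprn_continuous].
- move=> y; have d := is_derive_scale ((-1) ^+ n)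
    (is_derive_sub (is_derive1_atan y) (is_derive_atan_series n y)).
  apply: is_derive_eq d _; rewrite [(- y ^+ 2) ^+ n]exprNn -[(y ^+ 2) ^+ n]exprM.
  have : (-1) ^+ n * (-1) ^+ n = 1 :> R by rewrite -expr2 sqrr_sign.
  have := p1 y; move: (1 + y ^+ 2) => q q0; move: ((-1) ^+ n) (y ^+ (2 * n)) => s z ss.
  rewrite [LHS](_ : _ = s * s * (z / q)); last by field; rewrite gt_eqF.
  by rewrite ss mul1r.
- by move=> y y0; rewrite divr_ge0 ?exprn_ge0 ?(ltW (p1 _)).
Qed.

(** The addition formula gives [tan = 1] for the sum, which lies in [[0, pi / 2]]. *)
Lemma pi_euler (R : realType) : pi / 4 = atan (2^-1) + atan (3^-1) :> R.
Proof.
have a0 (x : R) : 0 < x -> 0 < atan x by move=> x0; rewrite -[X in X < _]atan0 lt_atan.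
have a1 (x : R) : x < 1 -> atan x < pi / 4 by move=> x1; rewrite -atan1 lt_atan.
have c0 (x : R) : cos (atan x) != 0.
  by rewrite cos_atan invr_neq0// gt_eqF// sqrtr_gt0 ltr_pwDl// sqr_ge0.
have p0 := pi_gt0 R.
have h20 : 0 < 2^-1 :> R by []; have h30 : 0 < 3^-1 :> R by [].
have h21 : 2^-1 < 1 :> R by lra.
have h31 : 3^-1 < 1 :> R by lra.
have := a0 _ h20; have := a0 _ h30; have := a1 _ h21; have := a1 _ h31 => b1 b2 b3 b4.
apply: tan_inj; rewrite ?in_itv/=; try by apply/andP; split; lra.
rewrite tan_piquarter tanD ?c0// !atanK.
rewrite (_ : 2^-1 + 3^-1 = 1 - 2^-1 * 3^-1); last by lra.
by rewrite divff// gt_eqF//; lra.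
Qed.

Lemma pi_bounds (R : realType) :
  3 + decimal R [:: 1; 4; 1; 5; 9; 2; 6; 5; 3]%N <= pi <=
  3 + decimal R [:: 1; 4; 1; 5; 9; 2; 6; 5; 4]%N.
Proof.
have := pi_euler R; move: (pi : R) => p.
have l2 := @atan_series_sign R 16 (2^-1); have l3 := @atan_series_sign R 16 (3^-1).
have u2 := @atan_series_sign R 15 (2^-1); have u3 := @atan_series_sign R 15 (3^-1).
move: l2 l3 u2 u3; rewrite /atan_series !big_ord_recr !big_ord0 !invr_ge0 !ler0n.
move=> /(_ isT) + /(_ isT) + /(_ isT) + /(_ isT).
move: (atan 2^-1) (atan 3^-1) => x y.
rewrite /decimal/=.
(* Evaluating the exponents lets the linear arithmetic recognize rational
   constants. *)
repeat match goal with |- context [(2 * ?k + 1)%N] =>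
  let n := eval compute in (2 * k + 1)%N in change (2 * k + 1)%N with n end.
lra.
Qed.

(** * Exact evaluation of the moments *)

Definition ofN (R : realType) (n : N) : R := (nat_of_bin n)%:R.

Lemma ofND (R : realType) (m n : N) : ofN R (N.add m n) = ofN R m + ofN R n.
Proof. by rewrite /ofN -natrD; congr _%:R; lia. Qed.

Lemma ofNM (R : realType) (m n : N) : ofN R (N.mul m n) = ofN R m * ofN R n.
Proof. by rewrite /ofN -natrM; congr _%:R; lia. Qed.

Lemma ofN_ge0 (R : realType) (n : N) : 0 <= ofN R n.
Proof. exact: ler0n. Qed.

Lemma ofN_nat (R : realType) (n : nat) : ofN R (bin_of_nat n) = n%:R.
Proof. by rewrite /ofN bin_of_natK. Qed.

Lemma ofN_le (R : realType) (m n : N) : N.leb m n -> ofN R m <= ofN R n.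
Proof. by move=> mn; rewrite ler_nat; lia. Qed.

(** Polynomials over the binary natural numbers: the coefficients below have
hundreds of digits, and their sequences are multiplied by computation. *)
Definition hornerN (R : realType) (s : seq N) (x : R) : R :=
  horner_rec [seq ofN R c | c <- s] x.

Definition scaleN (c : N) (s : seq N) : seq N := [seq N.mul c d | d <- s].

Fixpoint addN (s t : seq N) : seq N :=
  match s, t with
  | [::], _ => t
  | _, [::] => s
  | c :: s', d :: t' => N.add c d :: addN s' t'
  end.

Definition mulN (s t : seq N) : seq N :=
  foldr (fun c r => addN (scaleN c t) (N0 :: r)) [::] s.

Fixpoint powN (s : seq N) (k : nat) : seq N :=
  if k is k'.+1 then mulN s (powN s k') else [:: 1%num].

Lemma hornerN_scale (R : realType) c s (x : R) :
  hornerN (scaleN c s) x = ofN R c * hornerN s x.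
Proof.
rewrite /hornerN; elim: s => [|d s /= ->]; first by rewrite mulr0.
by rewrite ofNM; ring.
Qed.

Lemma hornerN_add (R : realType) s t (x : R) :
  hornerN (addN s t) x = hornerN s x + hornerN t x.
Proof.
rewrite /hornerN; elim: s t => [|c s IH] [|d t] /=; rewrite ?add0r ?addr0//.
by rewrite IH ofND; ring.
Qed.

Lemma hornerN_mul (R : realType) s t (x : R) :
  hornerN (mulN s t) x = hornerN s x * hornerN t x.
Proof.
elim: s => [|c s /= IH]; first by rewrite mul0r.
rewrite hornerN_add hornerN_scale [in X in _ + X]/hornerN/= -/(hornerN _ _) IH.
rewrite [hornerN (c :: s) x]/hornerN/= -/(hornerN _ _) /ofN/=; ring.
Qed.

Lemma hornerN_pow (R : realType) s k (x : R) :
  hornerN (powN s k) x = hornerN s x ^+ k.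
Proof.
elim: k => [|k IH]; first by rewrite /hornerN/= /ofN/= expr0; ring.
by rewrite hornerN_mul IH exprS.
Qed.

Lemma hornerN_rcons (R : realType) s c (x : R) :
  hornerN (rcons s c) x = hornerN s x + ofN R c * x ^+ size s.
Proof.
rewrite /hornerN; elim: s => [|d s /= ->]; first by rewrite /= expr0; ring.
by rewrite exprS; ring.
Qed.

Lemma hornerN_ncons (R : realType) k s (x : R) :
  hornerN (ncons k 0%num s) x = x ^+ k * hornerN s x.
Proof.
rewrite /hornerN; elim: k => [|k /= ->]; first by rewrite mul1r.
by rewrite /ofN/= exprS; ring.
Qed.

(** The common denominator and the numerators of the coefficients of [odd_series]. *)
Fixpoint odd_seriesN (K : nat) : N * seq N :=
  if K is K'.+1 then
    let d := bin_of_nat (2 * K'.+1 + 1) in let p := odd_seriesN K' in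
    (N.mul p.1 d, rcons (scaleN d p.2) 1%num)
  else (1%num, [:: 1%num]).

Lemma odd_seriesNE (R : realType) (K : nat) (t : R) :
  odd_series K t = t * hornerN (odd_seriesN K).2 (t ^+ 2) / odd_fact R K.
Proof.
have D0 k := odd_fact_gt0 R k.
have sz : size (odd_seriesN K).2 = K.+1.
  by elim: (K) => //= k <-; rewrite size_rcons size_map.
elim: K sz => [_|K IH sz].
  by rewrite /odd_series big_ord1 /hornerN/= /ofN/= odd_fact0 expr1; ring.
have sz' : size (odd_seriesN K).2 = K.+1.
  by move: sz; rewrite /= size_rcons size_map => -[].
rewrite [LHS](_ : _ = odd_series K t + t ^+ (2 * K.+1 + 1) / odd_fact R K.+1); last first.
  by rewrite /odd_series big_ord_recr.
have -> : (odd_seriesN K.+1).2 =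
  rcons (scaleN (bin_of_nat (2 * K.+1 + 1)) (odd_seriesN K).2) 1%num by [].
rewrite IH// hornerN_rcons hornerN_scale size_map sz' ofN_nat odd_factS.
have n0 : 0 < (2 * K.+1 + 1)%:R :> R by rewrite ltr0n addn1.
rewrite -exprM [t ^+ (_ + 1)]exprD expr1 /ofN/=.
move: (D0 K) (t ^+ (2 * K.+1)) n0; move: ((2 * K.+1 + 1)%:R : R) (odd_fact R K).
by move=> n D D1 y n0; field; rewrite !gt_eqF.
Qed.

Lemma odd_seriesN1 (R : realType) (K : nat) : ofN R (odd_seriesN K).1 = odd_fact R K.
Proof.
elim: K => [|K IH]; first by rewrite odd_fact0.
rewrite odd_factS -IH -[(2 * K.+1 + 1)%:R]ofN_nat -ofNM.
by [].
Qed.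

(** A numerator and a denominator of [gauss_moment]; the arguments [s] and [o] are
[2 a] and [2 i + 1]. *)
Fixpoint gauss_momentN (s o : N) (l : seq N) : N * N :=
  if l is c :: l' then
    let p := gauss_momentN s (N.add o 2) l' in
    let d := N.mul s p.2 in (N.add (N.mul c d) (N.mul o p.1), d)
  else (0%num, 1%num).

Lemma gauss_momentNE (R : realType) (a : R) (i : nat) (s o : N) (l : seq N) :
  0 < a -> ofN R s = 2 * a -> ofN R o = (2 * i + 1)%:R ->
  gauss_moment a i [seq ofN R c | c <- l] =
    ofN R (gauss_momentN s o l).1 / ofN R (gauss_momentN s o l).2 /\
  0 < ofN R (gauss_momentN s o l).2.
Proof.
move=> a0 sE; elim: l i o => [|c l IH] i o oE /=.
  by rewrite /ofN/= mul0r.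
have [|-> d0] := IH i.+1 (N.add o 2).
  by rewrite ofND oE -natrD; congr _%:R; lia.
rewrite !(ofND, ofNM) sE oE mulr_gt0 ?mulr_gt0//; split=> //.
by field; rewrite !gt_eqF.
Qed.

(** The leading zeros account for the factor [t ^ (2 j)] of [odd_series K t ^ (2 j)],
which is a polynomial in [t ^ 2]. *)
Definition odd_series_powN (K j : nat) : seq N :=
  ncons j 0%num (powN (odd_seriesN K).2 (2 * j)).

Lemma odd_series_powNE (R : realType) (K j : nat) (t : R) :
  odd_series K t ^+ (2 * j) =
  hornerN (odd_series_powN K j) (t ^+ 2) / odd_fact R K ^+ (2 * j).
Proof.
by rewrite odd_seriesNE exprMn exprVn exprMn -hornerN_pow hornerN_ncons exprM.
Qed.

Definition series_momentN (K j : nat) : N * N :=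
  let q := gauss_momentN (bin_of_nat (2 * j.+1)) 1 (odd_series_powN K j) in
  (q.1, N.mul q.2 (N.pow (odd_seriesN K).1 (bin_of_nat (2 * j)))).

Definition series_moment (R : realType) (K j : nat) : R :=
  ofN R (series_momentN K j).1 / ofN R (series_momentN K j).2.

Lemma ofNX (R : realType) (m : N) (k : nat) :
  ofN R (N.pow m (bin_of_nat k)) = ofN R m ^+ k.
Proof.
elim: k => [|k IH]; first by rewrite expr0.
rewrite exprS -IH -ofNM -N.pow_succ_r'; congr (ofN R (N.pow m _)).
by lia.
Qed.

Lemma gauss_moment_series (R : realType) (K j : nat) :
  let q := gauss_momentN (bin_of_nat (2 * j.+1)) 1 (odd_series_powN K j) in
  gauss_moment j.+1%:R 0 [seq ofN R c | c <- odd_series_powN K j] =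
    ofN R q.1 / ofN R q.2 /\ 0 < ofN R q.2.
Proof.
by apply: gauss_momentNE; rewrite ?ltr0Sn// ofN_nat natrM.
Qed.

Lemma series_momentN_gt0 (R : realType) (K j : nat) : 0 < ofN R (series_momentN K j).2.
Proof.
have [_ q0] := gauss_moment_series R K j.
by rewrite ofNM ofNX odd_seriesN1 mulr_gt0 ?exprn_gt0 ?odd_fact_gt0.
Qed.

Lemma integral0y_series_moment (R : realType) (K j : nat) :
  int0y (fun t : R => odd_series K t ^+ (2 * j) * expR (- (j.+1%:R * t ^+ 2))) =
  (Num.sqrt (pi / j.+1%:R) / 2 * series_moment R K j)%:E.
Proof.
set l := [seq ofN R c | c <- odd_series_powN K j].
have l0 : all (>= 0) l by rewrite /l; elim: odd_series_powN => //= c s ->; rewrite ofN_ge0.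
have h := integral0y_horner_gauss 0 (ltr0Sn R j) l0.
have D0 := exprn_gt0 (2 * j) (odd_fact_gt0 R K).
transitivity (int0y (fun t : R => (odd_fact R K ^+ (2 * j))^-1 *
   (t ^+ (2 * 0) * horner_rec l (t ^+ 2) * expR (- (j.+1%:R * t ^+ 2))))).
  apply: eq_integral => t _; congr _%:E.
  by rewrite muln0 expr0 mul1r odd_series_powNE mulrAC mulrC.
rewrite (integral0yZ _ _ _ h); last 3 first.
- by rewrite invr_ge0 ltW.
- by move=> t t0; rewrite !mulr_ge0 ?expR_ge0 ?exprn_ge0// horner_rec_ge0// exprn_ge0.
- rewrite (_ : (fun t => _) = fun t : R => t ^+ (2 * 0) * expR (- (j.+1%:R * t ^+ 2)) *
     horner_rec l (t ^+ 2)); last by apply/funext => t; rewrite mulrAC.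
  apply: continuous_mul; first exact: continuous_pow_gauss.
  move=> t; apply: (@cvg_comp _ _ _ (fun t : R => t ^+ 2)); first exact: exprn_continuous.
  exact: continuous_horner_rec.
congr _%:E; have [-> q0] := gauss_moment_series R K j.
rewrite big_ord0 mulr1 /series_moment ofNM ofNX odd_seriesN1.
by rewrite invfM [LHS]mulrCA; congr (_ * _); rewrite [LHS]mulrC -mulrA.
Qed.

(** * Decimal enclosures of the moments *)

Fixpoint decimalN (ds : seq nat) : N * N :=
  if ds is d :: ds' then
    let p := decimalN ds' in (N.add (N.mul (bin_of_nat d) p.2) p.1, N.mul 10 p.2)
  else (0%num, 1%num).

Lemma decimalNE (R : realType) (ds : seq nat) :
  decimal R ds = ofN R (decimalN ds).1 / ofN R (decimalN ds).2 /\
  0 < ofN R (decimalN ds).2.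
Proof.
elim: ds => [|d ds [IH d0]]; first by rewrite /= /ofN/= mul0r ltr01.
have e : ofN R (decimalN (d :: ds)).2 = 10 * ofN R (decimalN ds).2.
  by rewrite ofNM; congr (_ * _); rewrite /ofN.
rewrite e mulr_gt0// (_ : decimal R (d :: ds) = (d%:R + decimal R ds) / 10)// IH.
rewrite [ofN R (decimalN (d :: ds)).1]ofND ofNM ofN_nat; split=> //.
by field; rewrite gt_eqF.
Qed.

Lemma le_fracN (R : realType) (p q : N * N) : 0 < ofN R p.2 -> 0 < ofN R q.2 ->
  N.leb (N.mul p.1 q.2) (N.mul q.1 p.2) -> ofN R p.1 / ofN R p.2 <= ofN R q.1 / ofN R q.2.
Proof.
move=> p0 q0 /(@ofN_le R); rewrite !ofNM => h.
by rewrite ler_pdivrMr// mulrAC ler_pdivlMr.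
Qed.

Definition fracN_between (ds es : seq nat) (p : N * N) : bool :=
  let a := decimalN ds in let b := decimalN es in
  N.leb (N.mul a.1 p.2) (N.mul p.1 a.2) && N.leb (N.mul p.1 b.2) (N.mul b.1 p.2).

Lemma series_moment_between (R : realType) (K j : nat) (ds es : seq nat) :
  fracN_between ds es (series_momentN K j) ->
  decimal R ds <= series_moment R K j <= decimal R es.
Proof.
move=> /andP[h1 h2].
have [-> a0] := decimalNE R ds; have [-> b0] := decimalNE R es.
by rewrite /series_moment !le_fracN// series_momentN_gt0.
Qed.

Lemma series_moment0 (R : realType) (K : nat) : series_moment R K 0 = 1.
Proof.
by apply: divff; rewrite gt_eqF// series_momentN_gt0.
Qed.

(** This bound and the two that follow are the only steps that compute with the long
numbers. *)
Lemma series_moment1_bounds (R : realType) :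
  decimal R [:: 4; 8; 0; 6; 0; 1; 9; 6; 6]%N <= series_moment R 24 1 <=
  decimal R [:: 4; 8; 0; 6; 0; 1; 9; 6; 7]%N.
Proof. by apply: series_moment_between; vm_compute. Qed.

Lemma series_moment2_bounds (R : realType) :
  decimal R [:: 4; 1; 7; 6; 2; 7; 0; 3; 0]%N <= series_moment R 24 2 <=
  decimal R [:: 4; 1; 7; 6; 2; 7; 0; 3; 1]%N.
Proof. by apply: series_moment_between; vm_compute. Qed.

Lemma series_moment3_bounds (R : realType) :
  decimal R [:: 4; 3; 7; 5; 3; 9; 5; 1; 5]%N <= series_moment R 24 3 <=
  decimal R [:: 4; 3; 7; 5; 3; 9; 5; 1; 6]%N.
Proof. by apply: series_moment_between; vm_compute. Qed.

(** * Decimal enclosures of the terms of the bounds *)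

Lemma ler_pM_between (R : realType) (a b c d x y : R) :
  0 <= a -> 0 <= c -> a <= x <= b -> c <= y <= d -> a * c <= x * y <= b * d.
Proof.
move=> a0 c0 /andP[ax xb] /andP[cy yd].
by rewrite !ler_pM// ?(le_trans a0 ax) ?(le_trans c0 cy).
Qed.

Lemma inv_twopi_bounds (R : realType) :
  decimal R [:: 1; 5; 9; 1; 5; 4; 9; 4; 3]%N <= (2 * pi)^-1 <=
  decimal R [:: 1; 5; 9; 1; 5; 4; 9; 4; 4]%N.
Proof.
have /andP[] := pi_bounds R; have := pi_gt0 R; move: (pi : R) => p p0.
have p20 : 0 < 2 * p by rewrite mulr_gt0.
by rewrite -div1r ler_pdivlMr// ler_pdivrMr// /decimal/=; lra.
Qed.

Lemma sqrt_between (R : realType) (x a b : R) : 0 <= a -> 0 <= b ->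
  a ^+ 2 <= x <= b ^+ 2 -> a <= Num.sqrt x <= b.
Proof.
move=> a0 b0 /andP[ax xb].
by rewrite -{1}[a]ger0_norm// -sqrtr_sqr -[b]ger0_norm// -[`|b|]sqrtr_sqr !ler_wsqrtr.
Qed.

Lemma decimal_ge0 (R : realType) (ds : seq nat) : 0 <= decimal R ds.
Proof. by elim: ds => //= d ds IH; rewrite divr_ge0// addr_ge0. Qed.

Lemma sqrt2_bounds (R : realType) :
  1 + decimal R [:: 4; 1; 4; 2; 1; 3; 5; 6; 2]%N <= Num.sqrt 2 <=
  1 + decimal R [:: 4; 1; 4; 2; 1; 3; 5; 6; 3]%N.
Proof.
apply: sqrt_between; rewrite ?addr_ge0 ?decimal_ge0//.
by apply/andP; split; rewrite /decimal/=; lra.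
Qed.

Lemma sqrt3_bounds (R : realType) :
  1 + decimal R [:: 7; 3; 2; 0; 5; 0; 8; 0; 7]%N <= Num.sqrt 3 <=
  1 + decimal R [:: 7; 3; 2; 0; 5; 0; 8; 0; 8]%N.
Proof.
apply: sqrt_between; rewrite ?addr_ge0 ?decimal_ge0//.
by apply/andP; split; rewrite /decimal/=; lra.
Qed.

(** The summand of index [j] in [mean_width_bounds], without its coefficient. *)
Definition width_term (R : realType) (K j : nat) : R :=
  (2 * pi) ^- j * series_moment R K j / Num.sqrt j.+1%:R.

(** The reciprocals of the square roots are written [sqrt k / k], so that only products
of enclosed nonnegative numbers occur. *)
Lemma width_term_bounds (R : realType) :
  [/\ decimal R [:: 0; 5; 4; 0; 8; 6; 7; 2]%N <= width_term R 24 1 <= decimal R [:: 0; 5; 4; 0; 8; 6; 7; 3]%N,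
      decimal R [:: 0; 0; 6; 1; 0; 7; 5; 6]%N <= width_term R 24 2 <= decimal R [:: 0; 0; 6; 1; 0; 7; 5; 7]%N &
      decimal R [:: 0; 0; 0; 8; 8; 1; 9; 5]%N <= width_term R 24 3 <= decimal R [:: 0; 0; 0; 8; 8; 1; 9; 6]%N].
Proof.
have pos := @decimal_ge0 R.
have p1 ds : 0 <= 1 + decimal R ds by rewrite addr_ge0.
have u1 := inv_twopi_bounds R.
have s1 := series_moment1_bounds R; have s2 := series_moment2_bounds R.
have s3 := series_moment3_bounds R.
have u2 := ler_pM_between (pos _) (pos _) u1 u1.
have u3 := ler_pM_between (mulr_ge0 (pos _) (pos _)) (pos _) u2 u1.
have v1 := ler_pM_between (pos _) (pos _) u1 s1.
have v2 := ler_pM_between (mulr_ge0 (pos _) (pos _)) (pos _) u2 s2.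
have v3 := ler_pM_between (mulr_ge0 (mulr_ge0 (pos _) (pos _)) (pos _)) (pos _) u3 s3.
have r2 := sqrt2_bounds R; have r3 := sqrt3_bounds R.
have r4 : Num.sqrt 4 = 2 :> R.
  by rewrite (_ : 4 = 2 ^+ 2) ?sqrtr_sqr ?ger0_norm//; ring.
have i2 : (Num.sqrt 2)^-1 = Num.sqrt 2 / 2 :> R.
  have q : Num.sqrt 2 * Num.sqrt 2 = 2 :> R by rewrite -expr2 sqr_sqrtr.
  by rewrite -[X in _ / X]q invfM mulrA divff ?mul1r// gt_eqF// sqrtr_gt0.
have i3 : (Num.sqrt 3)^-1 = Num.sqrt 3 / 3 :> R.
  have q : Num.sqrt 3 * Num.sqrt 3 = 3 :> R by rewrite -expr2 sqr_sqrtr.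
  by rewrite -[X in _ / X]q invfM mulrA divff ?mul1r// gt_eqF// sqrtr_gt0.
have w1 := ler_pM_between (mulr_ge0 (pos _) (pos _)) (p1 _) v1 r2.
have w2 := ler_pM_between (mulr_ge0 (mulr_ge0 (pos _) (pos _)) (pos _)) (p1 _) v2 r3.
rewrite /width_term -!exprVn i2 i3 r4 !exprS expr0 !mulr1.
move: v3 w1 w2; move: (series_moment R 24 1) (series_moment R 24 2) (series_moment R 24 3).
move: (Num.sqrt 2) (Num.sqrt 3) (2 * pi)^-1 {i2 i3 r2 r3 r4 u1 u2 u3 v1 v2 s1 s2 s3} => a b u x y z.
rewrite /decimal/=.
by move=> /andP[? ?] /andP[? ?] /andP[? ?]; split; apply/andP; split; lra.
Qed.

(** * The four simplices *)

(** Symmetric powers of degree at most 6 suffice for dimensions up to 8. *)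
Lemma simplex_width_between (R : realType) (m K : nat)
    (sigma : probability (borel_rV R m.+1) R) (T : set 'rV[R]_m.+1)
    (a0 a1 a2 a3 c : R) :
  (0 < m)%N -> rotation_invariant_sphere_probability sigma ->
  unit_regular_simplex T -> [/\ 0 <= a0, 0 <= a1, 0 <= a2 & 0 <= a3] ->
  (forall y : R, sym_pow m y =
     a0 + a1 * y ^+ 2 + a2 * y ^+ 4 + a3 * y ^+ 6) ->
  int0y (fun r : R => inv_hyp r ^+ m.+3) = c%:E -> 0 < c ->
  let W := a0 + a1 * width_term R K 1 + a2 * width_term R K 2 +
           a3 * width_term R K 3 in
  m.+2%:R / (8 * c) * W <= mean_width sigma T /\
  mean_width sigma T <=
    m.+2%:R / (8 * c) * W + m.+2%:R / (2 * c) * (m%:R / 2 ^+ (K + 5)).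
Proof.
move=> m0 sinv unitT [a0p a1p a2p a3p] Ea hc c0 W.
pose a := [:: a0; a1; a2; a3].
have W_sum : \sum_(j < 4) a`_j * (2 * pi) ^- j * series_moment R K j / Num.sqrt j.+1%:R = W.
  rewrite !big_ord_recl big_ord0 series_moment0 sqrtr1 /W /width_term /= expr0 invr1; ring.
have Ea' (y : R) : sym_pow m y = \sum_(j < 4) a`_j * y ^+ (2 * j).
  by rewrite Ea !big_ord_recl big_ord0 /= expr0 mulr1 addr0 !addrA.
have apos j : 0 <= a`_j by case: j => [|[|[|[|j]]]]//=; rewrite nth_nil.
have /andP[] := mean_width_bounds m0 sinv unitT Ea' apos (integral0y_series_moment R K)
  hc c0 W_sum.
by [].
Qed.

Lemma simplex5_width (R : realType) (sigma : probability (borel_rV R 5) R)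
    (T : set 'rV[R]_5) :
  rotation_invariant_sphere_probability sigma -> unit_regular_simplex T ->
  decimal R [:: 4; 2; 0; 8]%N <= mean_width sigma T <= decimal R [:: 4; 2; 1; 5]%N.
Proof.
move=> sinv unitT.
have hc := integral0y_inv_hypSS (integral0y_inv_hypSS (integral0y_inv_hyp3 R)).
have a0 : [/\ (0 : R) <= 1 / 8, (0 : R) <= 3, (0 : R) <= 2 & (0 : R) <= 0].
  by split; rewrite ?divr_ge0.
have Ea (y : R) : sym_pow 4 y =
    1 / 8 + 3 * y ^+ 2 + 2 * y ^+ 4 + 0 * y ^+ 6.
  by rewrite /sym_pow; field.
have c0 : 0 < 4 / 5 * (2 / 3 * 1) :> R by rewrite !mulr_gt0 ?pi_gt0.
have [] := simplex_width_between (m := 4) 24 isT sinv unitT a0 Ea hc c0.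
have [] := width_term_bounds R.
move: (width_term R 24 1) (width_term R 24 2) (width_term R 24 3) (mean_width sigma T).
move=> x1 x2 x3 w; rewrite /decimal/= => /andP[? ?] /andP[? ?] /andP[? ?] l u.
by apply/andP; split; lra.
Qed.

(** In even dimensions the denominator contributes a factor [1 / pi], which is
combined with the terms before the linear arithmetic. *)
Lemma simplex6_width (R : realType) (sigma : probability (borel_rV R 6) R)
    (T : set 'rV[R]_6) :
  rotation_invariant_sphere_probability sigma -> unit_regular_simplex T ->
  decimal R [:: 4; 0; 6; 7]%N <= mean_width sigma T <= decimal R [:: 4; 0; 7]%N.
Proof.
move=> sinv unitT.
have hc := integral0y_inv_hypSS (integral0y_inv_hypSS
  (integral0y_inv_hypSS (integral0y_inv_hyp2 R))).
have a0 : [/\ (0 : R) <= 1 / 16, (0 : R) <= 5 / 2, (0 : R) <= 5 & (0 : R) <= 0].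
  by split; rewrite ?divr_ge0.
have Ea (y : R) : sym_pow 5 y =
    1 / 16 + 5 / 2 * y ^+ 2 + 5 * y ^+ 4 + 0 * y ^+ 6.
  by rewrite /sym_pow; field.
have c0 : 0 < 5 / 6 * (3 / 4 * (1 / 2 * (pi / 2))) :> R by rewrite !mulr_gt0 ?pi_gt0.
have [] := simplex_width_between (m := 5) 24 isT sinv unitT a0 Ea hc c0.
have [e1 e2] : 7 / (8 * (5 / 6 * (3 / 4 * (1 / 2 * (pi / 2))))) = 56 / 5 * (2 * pi)^-1 :> R /\
    7 / (2 * (5 / 6 * (3 / 4 * (1 / 2 * (pi / 2))))) = 224 / 5 * (2 * pi)^-1 :> R.
  by have := pi_gt0 R; move: (pi : R) => p p0; split; field; rewrite gt_eqF.
rewrite e1 e2.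
have pos := @decimal_ge0 R; have b := inv_twopi_bounds R.
have [b1 b2 b3] := width_term_bounds R.
have := ler_pM_between (pos _) (pos _) b b3.
have := ler_pM_between (pos _) (pos _) b b2.
have := ler_pM_between (pos _) (pos _) b b1; move: b {b1 b2 b3}.
move: (width_term R 24 1) (width_term R 24 2) (width_term R 24 3) (mean_width sigma T).
move: (2 * pi)^-1 => u x1 x2 x3 w {hc c0 e1 e2}.
rewrite /decimal/= => /andP[? ?] /andP[? ?] /andP[? ?] /andP[? ?] l h.
by apply/andP; split; lra.
Qed.

Lemma simplex7_width (R : realType) (sigma : probability (borel_rV R 7) R)
    (T : set 'rV[R]_7) :
  rotation_invariant_sphere_probability sigma -> unit_regular_simplex T ->
  decimal R [:: 3; 9; 4; 2; 5]%N <= mean_width sigma T <= decimal R [:: 3; 9; 4; 2; 7]%N.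
Proof.
move=> sinv unitT.
have hc := integral0y_inv_hypSS (integral0y_inv_hypSS
  (integral0y_inv_hypSS (integral0y_inv_hyp3 R))).
have a0 : [/\ (0 : R) <= 1 / 32, (0 : R) <= 15 / 8, (0 : R) <= 15 / 2 & (0 : R) <= 2].
  by split; rewrite ?divr_ge0.
have Ea (y : R) : sym_pow 6 y =
    1 / 32 + 15 / 8 * y ^+ 2 + 15 / 2 * y ^+ 4 + 2 * y ^+ 6.
  by rewrite /sym_pow; field.
have c0 : 0 < 6 / 7 * (4 / 5 * (2 / 3 * 1)) :> R by rewrite !mulr_gt0 ?pi_gt0.
have [] := simplex_width_between (m := 6) 24 isT sinv unitT a0 Ea hc c0.
have [] := width_term_bounds R.
move: (width_term R 24 1) (width_term R 24 2) (width_term R 24 3) (mean_width sigma T).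
move=> x1 x2 x3 w; rewrite /decimal/= => /andP[? ?] /andP[? ?] /andP[? ?] l u.
by apply/andP; split; lra.
Qed.

Lemma simplex8_width (R : realType) (sigma : probability (borel_rV R 8) R)
    (T : set 'rV[R]_8) :
  rotation_invariant_sphere_probability sigma -> unit_regular_simplex T ->
  decimal R [:: 3; 8; 3]%N <= mean_width sigma T <= decimal R [:: 3; 8; 3; 0; 1]%N.
Proof.
move=> sinv unitT.
have hc := integral0y_inv_hypSS (integral0y_inv_hypSS (integral0y_inv_hypSS
  (integral0y_inv_hypSS (integral0y_inv_hyp2 R)))).
have a0 : [/\ (0 : R) <= 1 / 64, (0 : R) <= 21 / 16, (0 : R) <= 35 / 4 & (0 : R) <= 7].
  by split; rewrite ?divr_ge0.
have Ea (y : R) : sym_pow 7 y =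
    1 / 64 + 21 / 16 * y ^+ 2 + 35 / 4 * y ^+ 4 + 7 * y ^+ 6.
  by rewrite /sym_pow; field.
have c0 : 0 < 7 / 8 * (5 / 6 * (3 / 4 * (1 / 2 * (pi / 2)))) :> R by rewrite !mulr_gt0 ?pi_gt0.
have [] := simplex_width_between (m := 7) 24 isT sinv unitT a0 Ea hc c0.
have [e1 e2] : 9 / (8 * (7 / 8 * (5 / 6 * (3 / 4 * (1 / 2 * (pi / 2)))))) = 576 / 35 * (2 * pi)^-1 :> R /\
    9 / (2 * (7 / 8 * (5 / 6 * (3 / 4 * (1 / 2 * (pi / 2)))))) = 2304 / 35 * (2 * pi)^-1 :> R.
  by have := pi_gt0 R; move: (pi : R) => p p0; split; field; rewrite gt_eqF.
rewrite e1 e2.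
have pos := @decimal_ge0 R; have b := inv_twopi_bounds R.
have [b1 b2 b3] := width_term_bounds R.
have := ler_pM_between (pos _) (pos _) b b3.
have := ler_pM_between (pos _) (pos _) b b2.
have := ler_pM_between (pos _) (pos _) b b1; move: b {b1 b2 b3}.
move: (width_term R 24 1) (width_term R 24 2) (width_term R 24 3) (mean_width sigma T).
move: (2 * pi)^-1 => u x1 x2 x3 w {hc c0 e1 e2}.
rewrite /decimal/= => /andP[? ?] /andP[? ?] /andP[? ?] /andP[? ?] l h.
by apply/andP; split; lra.
Qed.

Theorem corollary5 (R : realType) :
  [/\ forall (sigma : probability (borel_rV R 5) R) (T : set 'rV[R]_5),
        rotation_invariant_sphere_probability sigma ->
        unit_regular_simplex T ->
        decimal R [:: 4; 2; 0; 8]%N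
          <= mean_width sigma T
          <= decimal R [:: 4; 2; 1; 5]%N,
      forall (sigma : probability (borel_rV R 6) R) (T : set 'rV[R]_6),
        rotation_invariant_sphere_probability sigma ->
        unit_regular_simplex T ->
        decimal R [:: 4; 0; 6; 7]%N
          <= mean_width sigma T
          <= decimal R [:: 4; 0; 7]%N,
      forall (sigma : probability (borel_rV R 7) R) (T : set 'rV[R]_7),
        rotation_invariant_sphere_probability sigma ->
        unit_regular_simplex T ->
        decimal R [:: 3; 9; 4; 2; 5]%N
          <= mean_width sigma T
          <= decimal R [:: 3; 9; 4; 2; 7]%N
    & forall (sigma : probability (borel_rV R 8) R) (T : set 'rV[R]_8),
        rotation_invariant_sphere_probability sigma ->
        unit_regular_simplex T ->
        decimal R [:: 3; 8; 3]%N
          <= mean_width sigma T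
          <= decimal R [:: 3; 8; 3; 0; 1]%N].
Proof.
by split=> sigma T; [exact: simplex5_width|exact: simplex6_width|
                     exact: simplex7_width|exact: simplex8_width].
Qed.
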